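(* Let $f(x)$ be an entire function of exponential type $\tau>0$ satisfying $f(-x)=f(x)$. For every nonnegative integer $m$ and $\lambda>\tau$, $$\int_{0}^{\infty}\frac{f(x)\,\sin^{2m+1}(\lambda x)}{x^{2m+1}}\,dx=\frac{(-1)^m\pi\,(2m+1)!}{2^{2m+1}}\sum_{l=0}^{m}D_{l,m}\,\lambda^{2l},$$ where $$D_{l,m}=\frac{(-1)^l\,f^{(2m-2l)}(0)}{(2l)!\,(2m-2l)!}\sum_{k=0}^{m}\frac{(-1)^k(2m-2k+1)^{2l}}{k!\,(2m+1-k)!}.$$
   Context: An entire function $f$ is of exponential type $\tau$ if for every arbitrarily small $\epsilon>0$ the inequality $|f(z)|\le e^{(\tau+\epsilon)|z|}$ holds for all complex $z$ with $|z|$ sufficiently large. $f^{(j)}(0)$ denotes the $j$-th derivative of $f$ at $0$, with $f^{(0)}=f$.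
   Formalization: The integral is additionally assumed to converge as an improper (possibly conditionally convergent) Riemann integral; without this the claim fails, e.g. for f(x)=cosh(τx), m=0, where the integral diverges. *)

(* Defs.v *)
From Stdlib Require Import Reals Factorial.
From Coquelicot Require Import Coquelicot.
Open Scope R_scope.

Definition entire (f : C -> C) : Prop :=
  forall z : C, ex_derive (K := C_AbsRing) (V := C_NormedModule) f z.

(* The type is at most tau: the bound is only required from above. *)
Definition exponential_type (f : C -> C) (tau : R) : Prop :=
  forall eps : R, 0 < eps ->
    exists r : R, forall z : C,
      r <= Cmod z -> Cmod (f z) <= exp ((tau + eps) * Cmod z).

(* Complex counterpart of [Derive_n]. The total operator [C_derive] is the
   derivative wherever it exists (lemma [C_derive_correct]). *)
Fixpoint C_derive_n (f : C -> C) (n : nat) (z : C) : C :=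
  match n with
  | O => f z
  | S n => C_derive (C_derive_n f n) z
  end.

(* The value at x = 0 is a junk value at a single point, which the integral
   ignores. *)
Definition integrand (f : C -> C) (m : nat) (lambda : R) (x : R) : C :=
  (f (RtoC x) * RtoC (sin (lambda * x) ^ (2 * m + 1))%R
     / RtoC (x ^ (2 * m + 1))%R)%C.

Definition D_coef (f : C -> C) (l m : nat) : C :=
  (RtoC ((-1) ^ l)%R * C_derive_n f (2 * m - 2 * l) (RtoC 0)
     / RtoC (INR (fact (2 * l)) * INR (fact (2 * m - 2 * l)))%R
   * RtoC (sum_n (G := R_AbelianMonoid) (fun k : nat =>
       (-1) ^ k * INR (2 * m - 2 * k + 1) ^ (2 * l)
         / (INR (fact k) * INR (fact (2 * m + 1 - k)))) m)%R)%C.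

(* Main.v *)
Require Import Defs.
From Stdlib Require Import Reals Factorial Lra Lia ClassicalEpsilon FunctionalExtensionality.
From Coquelicot Require Import Coquelicot.
Open Scope R_scope.

(** Write [N = 2 m + 1] and [sin (lambda z) ^ N = (e z - e (- z)) / (2 i)], where
    [e] is a combination of exponentials [exp (i w z)] with [w >= lambda], so
    that [u = e f] is [O (exp (sigma |z| - lambda Im z))] in the upper half-plane
    for some [sigma < lambda].  Let [E] be [u / z^N] minus its polar part and let
    [b] be the coefficient of [1 / z] in that polar part.  Since [f] is even,
    the integrand is [(E x + E (- x)) / (2 i)].  The function
    [k z = E z - b (exp (i lambda z) - 1) / z] is still entire, the symmetric
    integral of [(exp (i lambda x) - 1) / x] is [i PI] (semicircle), and that of
    [k], which converges because the given integral does, is [0]; hence the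
    value is [PI b / 2].

    For the vanishing of the integral of [k] no growth of [f] along the real
    axis is known beyond its exponential type.  The convergent integrals over
    the half-lines are therefore computed as Abel means with the factor
    [exp (- delta z^(1 + 1/n))], rotated to rays on which [k] is integrable, and
    [delta] tends to [0] there. *)

(** * Derivatives of complex-valued functions *)

(** Contours never appear as such. Goursat's theorem gives every entire function a primitive, and
    moving a path of integration becomes an estimate, by the mean value inequality along an arc, of
    a difference of values of the primitive. Poles are avoided in the same spirit: division by [z]
    is iterated on entire functions, so that the polar part of [u / z^N] is read off from Taylor
    coefficients.

    The term with [b] makes rotation profitable. In directions where [u] decays, [E] behaves like
    [- b / z], which is not integrable on a ray. In [k = (E + b / z) - b exp (i lambda z) / z] the
    bracket is bounded by [|u|] plus [O(1 / |z|^2)], and the last term decays with [Im z].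

    The exponent [1 + 1/n] is forced from two sides. Between the real axis and a ray, [k] may grow
    like [exp (sigma |z|)], and since [delta] is arbitrarily small the factor needs order above 1;
    it also has to decay in the whole sector up to the angle [th < PI / 2], which requires
    [(1 + 1/n) th < PI / 2]. *)

(* With [emb] the identity of [C] this is the complex derivative, with
   [emb := RtoC] the derivative of a path. *)
Definition deriv_along {D : Type} (emb : D -> C) (X : D -> C) (t : D) (v : C) : Prop :=
  forall eps : R, 0 < eps -> exists del : R, 0 < del /\ forall s : D,
    Cmod (emb s - emb t) < del ->
    Cmod (X s - X t - v * (emb s - emb t)) <= eps * Cmod (emb s - emb t).

Definition cont_along {D : Type} (emb : D -> C) (X : D -> C) (t : D) : Prop :=
  forall eps : R, 0 < eps -> exists del : R, 0 < del /\ forall s : D,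
    Cmod (emb s - emb t) < del -> Cmod (X s - X t) < eps.

Definition Cid (z : C) : C := z.
Notation cderiv := (deriv_along Cid).
Notation pderiv := (deriv_along RtoC).
Notation ccont := (cont_along Cid).
Notation pcont := (cont_along RtoC).

Lemma Cmod_le_of_eq (x y : C) (r : R) : x = y -> Cmod y <= r -> Cmod x <= r.
Proof. intros ->; trivial. Qed.

Lemma Cmod_minus_triangle (x y : C) : Cmod (x - y) <= Cmod x + Cmod y.
Proof. rewrite <- (Cmod_opp y). apply Cmod_triangle. Qed.

Lemma Cmod_minus_sym (x y : C) : Cmod (x - y) = Cmod (y - x).
Proof. rewrite <- Cmod_opp. f_equal. ring. Qed.

Lemma Cmod_triangle_minus (x y z : C) : Cmod (x - z) <= Cmod (x - y) + Cmod (y - z).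
Proof.
  replace (x - z)%C with ((x - y) + (y - z))%C by ring. apply Cmod_triangle.
Qed.

Lemma Cmod_triangle3 (x y z : C) : Cmod (x + y + z) <= Cmod x + Cmod y + Cmod z.
Proof.
  pose proof (Cmod_triangle (x + y) z). pose proof (Cmod_triangle x y). lra.
Qed.

Lemma deriv_ext {D : Type} (emb : D -> C) (X Y : D -> C) (t : D) (v w : C) :
  (forall s, X s = Y s) -> v = w -> deriv_along emb X t v -> deriv_along emb Y t w.
Proof.
  intros H -> HX eps He. destruct (HX eps He) as [d [Hd HH]].
  exists d; split; trivial. intros s Hs. rewrite <- !H. auto.
Qed.

Lemma deriv_cont {D : Type} (emb : D -> C) (X : D -> C) (t : D) (v : C) :
  deriv_along emb X t v -> cont_along emb X t.
Proof.
  intros H eps He. destruct (H 1 Rlt_0_1) as [d [Hd HH]].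
  pose proof (Cmod_ge_0 v) as Hv.
  exists (Rmin d (eps / (2 + Cmod v))). split.
  { apply Rmin_pos; trivial. apply Rdiv_lt_0_compat; lra. }
  intros s Hs.
  assert (H1 := HH s (Rlt_le_trans _ _ _ Hs (Rmin_l _ _))).
  assert (H2 := Rlt_le_trans _ _ _ Hs (Rmin_r _ _)).
  assert (H3 : Cmod (X s - X t) <= Cmod (X s - X t - v * (emb s - emb t)) + Cmod (v * (emb s - emb t))).
  { eapply Cmod_le_of_eq; [|apply Cmod_triangle]. ring. }
  rewrite Cmod_mult in H3.
  set (m := Cmod (emb s - emb t)) in *.
  assert (Hm : 0 <= m) by apply Cmod_ge_0.
  assert (m * (2 + Cmod v) < eps).
  { apply Rmult_lt_reg_r with (/ (2 + Cmod v)). apply Rinv_0_lt_compat; lra.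
    rewrite Rmult_assoc, Rinv_r by lra. unfold Rdiv in H2. lra. }
  nra.
Qed.

Lemma deriv_const {D : Type} (emb : D -> C) (c : C) (t : D) :
  deriv_along emb (fun _ => c) t 0%C.
Proof.
  intros eps He. exists 1. split; [lra|]. intros s _.
  replace (c - c - 0 * (emb s - emb t))%C with (RtoC 0) by ring.
  rewrite Cmod_0. pose proof (Cmod_ge_0 (emb s - emb t)). nra.
Qed.

Lemma deriv_emb {D : Type} (emb : D -> C) (t : D) : deriv_along emb emb t 1%C.
Proof.
  intros eps He. exists 1. split; [lra|]. intros s _.
  replace (emb s - emb t - 1 * (emb s - emb t))%C with (RtoC 0) by ring.
  rewrite Cmod_0. pose proof (Cmod_ge_0 (emb s - emb t)). nra.
Qed.

Lemma deriv_plus {D : Type} (emb : D -> C) (X Y : D -> C) (t : D) (v w : C) :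
  deriv_along emb X t v -> deriv_along emb Y t w ->
  deriv_along emb (fun s => X s + Y s)%C t (v + w)%C.
Proof.
  intros HX HY eps He.
  destruct (HX (eps / 2)) as [d [Hd HH]]; [lra|].
  destruct (HY (eps / 2)) as [d' [Hd' HH']]; [lra|].
  exists (Rmin d d'). split; [now apply Rmin_pos|]. intros s Hs.
  specialize (HH s (Rlt_le_trans _ _ _ Hs (Rmin_l _ _))).
  specialize (HH' s (Rlt_le_trans _ _ _ Hs (Rmin_r _ _))).
  eapply Rle_trans; [eapply Cmod_le_of_eq; [|apply (Cmod_triangle (X s - X t - v * (emb s - emb t)) (Y s - Y t - w * (emb s - emb t)))]; ring|].
  lra.
Qed.

Lemma deriv_comp {D : Type} (emb : D -> C) (f : C -> C) (X : D -> C) (t : D) (l v : C) :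
  cderiv f (X t) l -> deriv_along emb X t v ->
  deriv_along emb (fun s => f (X s)) t (l * v)%C.
Proof.
  intros Hf HX eps He.
  pose proof (deriv_cont _ _ _ _ HX) as HC.
  pose proof (Cmod_ge_0 v) as Hv. pose proof (Cmod_ge_0 l) as Hl.
  (* Relative to [|s - t|], the error of [f] at [X t] is at most [e1 (e2 + |v|)] and that of [X]
     contributes [|l| e2]. The constants make each at most [eps / 2]; [e2 <= 1] serves the first. *)
  set (e1 := eps / (2 * (1 + Cmod v))).
  assert (He1 : 0 < e1) by (apply Rdiv_lt_0_compat; lra).
  assert (He1' : e1 * (1 + Cmod v) = eps / 2) by (unfold e1; field; lra).
  set (e2 := Rmin 1 (eps / (2 * (1 + Cmod l)))).
  assert (He2 : 0 < e2) by (apply Rmin_pos; [lra|apply Rdiv_lt_0_compat; lra]).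
  assert (He2' : e2 * (1 + Cmod l) <= eps / 2).
  { apply Rle_trans with (eps / (2 * (1 + Cmod l)) * (1 + Cmod l)).
    apply Rmult_le_compat_r; [lra|apply Rmin_r]. right; field; lra. }
  assert (He2'' : e2 <= 1) by apply Rmin_l.
  destruct (Hf e1 He1) as [d1 [Hd1 H1]].
  destruct (HX e2 He2) as [d2 [Hd2 H2]].
  destruct (HC d1 Hd1) as [d3 [Hd3 H3]].
  exists (Rmin d2 d3). split; [now apply Rmin_pos|]. intros s Hs.
  specialize (H2 s (Rlt_le_trans _ _ _ Hs (Rmin_l _ _))).
  specialize (H3 s (Rlt_le_trans _ _ _ Hs (Rmin_r _ _))).
  specialize (H1 (X s) H3). unfold Cid in H1.
  set (m := Cmod (emb s - emb t)) in *.
  assert (Hm : 0 <= m) by apply Cmod_ge_0.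
  assert (H4 : Cmod (X s - X t) <= (e2 + Cmod v) * m).
  { eapply Rle_trans; [eapply Cmod_le_of_eq; [|apply (Cmod_triangle (X s - X t - v * (emb s - emb t)) (v * (emb s - emb t)))]; ring|].
    rewrite Cmod_mult. fold m. lra. }
  eapply Rle_trans; [eapply Cmod_le_of_eq; [|apply (Cmod_triangle (f (X s) - f (X t) - l * (X s - X t)) (l * (X s - X t - v * (emb s - emb t))))]; ring|].
  rewrite (Cmod_mult l).
  assert (e1 * Cmod (X s - X t) <= e1 * ((1 + Cmod v) * m)).
  { apply Rmult_le_compat_l; [lra|]. eapply Rle_trans; [apply H4|].
    apply Rmult_le_compat_r; lra. }
  assert (Cmod l * Cmod (X s - X t - v * (emb s - emb t)) <= Cmod l * (e2 * m)).
  { apply Rmult_le_compat_l; trivial. }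
  nra.
Qed.

Lemma cderiv_sqr (z : C) : cderiv (fun w => w * w)%C z (2 * z)%C.
Proof.
  intros eps He. exists eps. split; trivial. unfold Cid. intros s Hs.
  replace (s * s - z * z - 2 * z * (s - z))%C with ((s - z) * (s - z))%C by ring.
  rewrite Cmod_mult. apply Rmult_le_compat_r; [apply Cmod_ge_0|lra].
Qed.

Lemma deriv_scal {D : Type} (emb : D -> C) (c : C) (X : D -> C) (t : D) (v : C) :
  deriv_along emb X t v -> deriv_along emb (fun s => c * X s)%C t (c * v)%C.
Proof.
  intros H. apply (deriv_comp emb (fun w => c * w)%C); trivial.
  intros eps He. exists 1. split; [lra|]. unfold Cid. intros s _.
  replace (c * s - c * X t - c * (s - X t))%C with (RtoC 0) by ring.
  rewrite Cmod_0. pose proof (Cmod_ge_0 (s - X t)). nra.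
Qed.

Lemma deriv_minus {D : Type} (emb : D -> C) (X Y : D -> C) (t : D) (v w : C) :
  deriv_along emb X t v -> deriv_along emb Y t w ->
  deriv_along emb (fun s => X s - Y s)%C t (v - w)%C.
Proof.
  intros HX HY.
  apply (deriv_ext emb (fun s => X s + (-(1)) * Y s)%C _ t (v + (-(1)) * w)%C).
  intros; ring. ring. apply deriv_plus; trivial. now apply deriv_scal.
Qed.

(* Polarization reduces products to squares. *)
Lemma deriv_mult {D : Type} (emb : D -> C) (X Y : D -> C) (t : D) (v w : C) :
  deriv_along emb X t v -> deriv_along emb Y t w ->
  deriv_along emb (fun s => X s * Y s)%C t (v * Y t + X t * w)%C.
Proof.
  intros HX HY.
  assert (H2 : RtoC 2 <> 0%C) by (intro A; apply RtoC_inj in A; lra).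
  assert (H4 : RtoC 4 <> 0%C) by (intro A; apply RtoC_inj in A; lra).
  pose proof (deriv_comp emb _ _ _ _ _ (cderiv_sqr _) (deriv_plus _ _ _ _ _ _ HX HY)) as H.
  pose proof (deriv_comp emb _ _ _ _ _ (cderiv_sqr _) (deriv_minus _ _ _ _ _ _ HX HY)) as H'.
  pose proof (deriv_scal emb (/ 4)%C _ _ _ (deriv_minus _ _ _ _ _ _ H H')) as K.
  revert K. apply deriv_ext. intros; field; trivial. field; trivial.
Qed.

Lemma deriv_pow {D : Type} (emb : D -> C) (X : D -> C) (t : D) (v : C) (n : nat) :
  deriv_along emb X t v ->
  deriv_along emb (fun s => X s ^ n)%C t (RtoC (INR n) * X t ^ (pred n) * v)%C.
Proof.
  intros H. induction n as [|n IH].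
  - apply (deriv_ext emb (fun _ => 1%C) _ t 0%C). intros; reflexivity.
    simpl. ring. apply deriv_const.
  - pose proof (deriv_mult _ _ _ _ _ _ H IH) as K. revert K.
    apply deriv_ext. intros; reflexivity.
    rewrite S_INR, RtoC_plus. destruct n. simpl; ring.
    simpl pred. rewrite Cpow_S. ring.
Qed.

Lemma deriv_inv {D : Type} (emb : D -> C) (X : D -> C) (t : D) (v : C) :
  X t <> 0%C -> deriv_along emb X t v ->
  deriv_along emb (fun s => / X s)%C t (- v / (X t * X t))%C.
Proof.
  intros HX0 H.
  apply (deriv_ext emb (fun s => / X s)%C _ t ((- / (X t * X t)) * v)%C).
  reflexivity. field; trivial.
  apply (deriv_comp emb Cinv); trivial. set (z := X t) in *. clearbody z.
  assert (Hz : 0 < Cmod z) by (apply Cmod_gt_0; trivial).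
  intros eps He. unfold Cid.
  (* The remainder is [(w - z)^2 / (w z^2)]. The first bound keeps [|w| >= |z| / 2], the second
     makes [|w - z|] smaller than [eps |z|^3 / 2]. *)
  exists (Rmin (Cmod z / 2) (eps * (Cmod z * Cmod z * Cmod z) / 2)). split.
  { apply Rmin_pos. lra. apply Rdiv_lt_0_compat; [|lra].
    repeat apply Rmult_lt_0_compat; lra. }
  intros w Hw.
  assert (H1 := Rlt_le_trans _ _ _ Hw (Rmin_l _ _)).
  assert (H2 := Rlt_le_trans _ _ _ Hw (Rmin_r _ _)).
  assert (H3 : Cmod z <= Cmod (w - z) + Cmod w).
  { rewrite Cmod_minus_sym. eapply Cmod_le_of_eq; [|apply Cmod_triangle]. ring. }
  assert (Hw0 : w <> 0%C). { apply Cmod_gt_0. lra. }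
  replace (/ w - / z - - / (z * z) * (w - z))%C with ((w - z) * ((w - z) * / (w * (z * z))))%C
    by (field; auto).
  rewrite !Cmod_mult, Cmod_inv by (repeat apply Cmult_neq_0; auto). rewrite !Cmod_mult.
  rewrite (Rmult_comm eps). apply Rmult_le_compat_l. apply Cmod_ge_0.
  set (a := Cmod z) in *. set (b := Cmod w) in *. set (d := Cmod (w - z)) in *.
  assert (Hb : a / 2 <= b) by lra.
  apply Rmult_le_reg_r with (b * (a * a)). { assert (0<a*a) by nra. nra. }
  rewrite Rmult_assoc, Rinv_l by (assert (0<a*a) by nra; nra).
  assert (0 < a * a) by nra.
  assert (eps * (a * a) * (a / 2) <= eps * (a * a) * b) by (apply Rmult_le_compat_l; nra).
  lra.
Qed.

Lemma cont_const {D : Type} (emb : D -> C) (c : C) (t : D) : cont_along emb (fun _ => c) t.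
Proof. eapply deriv_cont, deriv_const. Qed.

Lemma cont_plus {D : Type} (emb : D -> C) (X Y : D -> C) (t : D) :
  cont_along emb X t -> cont_along emb Y t -> cont_along emb (fun s => X s + Y s)%C t.
Proof.
  intros HX HY eps He.
  destruct (HX (eps / 2)) as [d [Hd HH]]; [lra|].
  destruct (HY (eps / 2)) as [d' [Hd' HH']]; [lra|].
  exists (Rmin d d'). split; [now apply Rmin_pos|]. intros s Hs.
  specialize (HH s (Rlt_le_trans _ _ _ Hs (Rmin_l _ _))).
  specialize (HH' s (Rlt_le_trans _ _ _ Hs (Rmin_r _ _))).
  eapply Rle_lt_trans; [eapply Cmod_le_of_eq; [|apply (Cmod_triangle (X s - X t) (Y s - Y t))]; ring|].
  lra.
Qed.

Lemma cont_comp {D : Type} (emb : D -> C) (f : C -> C) (X : D -> C) (t : D) :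
  ccont f (X t) -> cont_along emb X t -> cont_along emb (fun s => f (X s)) t.
Proof.
  intros Hf HX eps He. destruct (Hf eps He) as [d [Hd H]].
  destruct (HX d Hd) as [d' [Hd' H']]. exists d'. split; auto.
  intros s Hs. apply H, H', Hs.
Qed.

Lemma cont_scal {D : Type} (emb : D -> C) (c : C) (X : D -> C) (t : D) :
  cont_along emb X t -> cont_along emb (fun s => c * X s)%C t.
Proof.
  apply (cont_comp emb (fun w => c * w)%C).
  eapply deriv_cont, deriv_scal, (deriv_emb Cid).
Qed.

Lemma cont_mult {D : Type} (emb : D -> C) (X Y : D -> C) (t : D) :
  cont_along emb X t -> cont_along emb Y t -> cont_along emb (fun s => X s * Y s)%C t.
Proof.
  intros HX HY.
  assert (H4 : RtoC 4 <> 0%C) by (intro A; apply RtoC_inj in A; lra).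
  assert (S : forall Z : D -> C, cont_along emb Z t -> cont_along emb (fun s => Z s * Z s)%C t).
  { intros Z. apply (cont_comp emb (fun w => w * w)%C). eapply deriv_cont, cderiv_sqr. }
  pose proof (cont_scal emb (/ 4)%C _ _ (cont_plus emb _ _ _ (S _ (cont_plus _ _ _ _ HX HY))
    (cont_scal emb (- (1))%C _ _ (S _ (cont_plus _ _ _ _ HX (cont_scal emb (- (1))%C _ _ HY)))))) as K.
  intros eps He. destruct (K eps He) as [d [Hd H]]. exists d. split; trivial.
  intros s Hs. specialize (H s Hs). eapply Rle_lt_trans; [|apply H].
  right. f_equal. field; trivial.
Qed.

(** * Comparison with derivatives and continuity in normed modules *)

Lemma cderiv_is_derive (f : C -> C) (z l : C) :
  cderiv f z l <-> is_derive (K := C_AbsRing) (V := C_NormedModule) f z l.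
Proof.
  split.
  - intros H. split. apply is_linear_scal_l.
    intros x Hx eps.
    apply (is_filter_lim_locally_unique (V := AbsRing_NormedModule C_AbsRing)) in Hx. subst x.
    destruct (H eps (cond_pos eps)) as [d [Hd HH]].
    exists (mkposreal d Hd). intros y Hy. specialize (HH y Hy).
    unfold Cid in HH. rewrite Cmult_comm in HH. exact HH.
  - intros [_ H] eps He.
    destruct (H z (fun P HP => HP) (mkposreal eps He)) as [d Hd].
    exists d. split. apply cond_pos. intros s Hs. specialize (Hd s Hs).
    unfold Cid in *. rewrite (Cmult_comm l). exact Hd.
Qed.

Lemma pderiv_is_derive (X : R -> C) (t : R) (v : C) :
  pderiv X t v <-> is_derive (K := R_AbsRing) (V := C_R_NormedModule) X t v.
Proof.
  assert (E : forall s, Cmod (RtoC s - RtoC t) = Rabs (s - t)).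
  { intros s. rewrite <- RtoC_minus. apply Cmod_R. }
  split.
  - intros H. split. apply is_linear_scal_l.
    intros x Hx eps.
    apply (is_filter_lim_locally_unique (V := R_NormedModule)) in Hx. subst x.
    destruct (H eps (cond_pos eps)) as [d [Hd HH]].
    exists (mkposreal d Hd). intros y Hy.
    assert (Hy' : Cmod (RtoC y - RtoC t) < d) by (rewrite E; exact Hy).
    specialize (HH y Hy'). rewrite E in HH.
    rewrite <- RtoC_minus, Cmult_comm in HH.
    rewrite scal_R_Cmult, <- Cmod_norm. exact HH.
  - intros [_ H] eps He.
    destruct (H t (fun P HP => HP) (mkposreal eps He)) as [d Hd].
    exists d. split. apply cond_pos. intros s Hs. rewrite E in Hs |- *.
    specialize (Hd s Hs). cbv beta in Hd. rewrite scal_R_Cmult, <- Cmod_norm in Hd.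
    rewrite <- RtoC_minus, (Cmult_comm v). exact Hd.
Qed.

Lemma pcont_continuous (X : R -> C) (t : R) :
  pcont X t -> continuous (U := C_R_NormedModule) X t.
Proof.
  intros H. apply filterlim_locally. intros eps.
  destruct (H eps (cond_pos eps)) as [d [Hd HH]].
  exists (mkposreal d Hd). intros y Hy. apply C_NormedModule_mixin_compat1.
  apply HH. rewrite <- RtoC_minus, Cmod_R. exact Hy.
Qed.

Lemma pderiv_RtoC (Y : R -> R) (t y : R) : is_derive Y t y -> pderiv (fun s => RtoC (Y s)) t (RtoC y).
Proof.
  intros [_ H] eps He.
  destruct (H t (fun P HP => HP) (mkposreal eps He)) as [d Hd].
  exists d. split. apply cond_pos. intros s Hs.
  rewrite <- RtoC_minus, Cmod_R in Hs. specialize (Hd s Hs).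
  rewrite <- !RtoC_minus, <- RtoC_mult, <- RtoC_minus, !Cmod_R, (Rmult_comm y). exact Hd.
Qed.

Lemma pderiv_Re (X : R -> C) (t : R) (v : C) :
  pderiv X t v -> is_derive (fun s => Re (X s)) t (Re v).
Proof.
  intros H. split. apply is_linear_scal_l.
  intros x Hx eps.
  apply (is_filter_lim_locally_unique (V := R_NormedModule)) in Hx. subst x.
  destruct (H eps (cond_pos eps)) as [d [Hd HH]].
  exists (mkposreal d Hd). intros y Hy.
  assert (Hy' : Cmod (RtoC y - RtoC t) < d) by (rewrite <- RtoC_minus, Cmod_R; exact Hy).
  specialize (HH y Hy').
  eapply Rle_trans; [|rewrite <- RtoC_minus, Cmod_R in HH; exact HH].
  eapply Rle_trans; [|apply re_le_Cmod]. right.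
  unfold norm; simpl. unfold abs; simpl. unfold minus, plus, opp, scal; simpl. unfold mult; simpl.
  f_equal. unfold Re. simpl. ring.
Qed.

(** * Mean value inequality and integrals of paths *)

(** The real mean value theorem is applied to [Cmod D * Y - Re (Cconj D * X)] with [D = X b - X a]:
    its derivative is nonnegative since [Re (Cconj D * x) <= Cmod D * y], and its increment is
    [Cmod D * (Y b - Y a) - Cmod D ^ 2]. A variable majorant [y] is kept because tails of integrals
    are later bounded through it. *)
Lemma mean_value_ineq (X : R -> C) (x : R -> C) (Y y : R -> R) (a b : R) :
  a <= b ->
  (forall t, a <= t <= b -> pderiv X t (x t)) ->
  (forall t, a <= t <= b -> is_derive Y t (y t)) ->
  (forall t, a <= t <= b -> Cmod (x t) <= y t) ->
  Cmod (X b - X a) <= Y b - Y a.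
Proof.
  intros Hab HX HY Hxy.
  set (D := (X b - X a)%C). pose proof (Cmod_ge_0 D) as HD.
  assert (HH : forall t, a <= t <= b ->
    is_derive (fun s => Cmod D * Y s - Re (Cconj D * X s)) t (Cmod D * y t - Re (Cconj D * x t))).
  { intros t Ht. apply (is_derive_minus (V := R_NormedModule)).
    - apply (is_derive_scal Y). now apply HY.
    - apply pderiv_Re. apply deriv_scal. now apply HX. }
  destruct (MVT_gen (fun s => Cmod D * Y s - Re (Cconj D * X s)) a b (fun t => Cmod D * y t - Re (Cconj D * x t))) as [c [Hc E]].
  { rewrite Rmin_left, Rmax_right by trivial. intros; apply HH; lra. }
  { rewrite Rmin_left, Rmax_right by trivial. intros t Ht.
    apply continuity_pt_filterlim. apply (ex_derive_continuous (V := R_NormedModule) (fun s => Cmod D * Y s - Re (Cconj D * X s))).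
    eexists; apply HH; lra. }
  rewrite Rmin_left, Rmax_right in Hc by trivial.
  assert (Hpos : 0 <= Cmod D * y c - Re (Cconj D * x c)).
  { pose proof (re_le_Cmod (Cconj D * x c)) as K. apply Rabs_le_between in K.
    rewrite Cmod_mult, Cmod_conj in K. specialize (Hxy c Hc).
    pose proof (Rmult_le_compat_l _ _ _ HD Hxy). lra. }
  assert (ED : Re (Cconj D * X b) - Re (Cconj D * X a) = Cmod D * Cmod D).
  { replace (Cmod D * Cmod D) with (Cmod D ^ 2) by ring. rewrite Cmod2_alt.
    unfold D, Re, Im, Cconj, Cmult, Cminus, Cplus, Copp; simpl. ring. }
  assert (H1 : Cmod D * Cmod D <= Cmod D * (Y b - Y a)).
  { assert (0 <= (Cmod D * y c - Re (Cconj D * x c)) * (b - a)) by (apply Rmult_le_pos; lra). lra. }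
  (* For [D = 0] there is nothing to divide by; the claim is then [Y a <= Y b], which follows from
     [y >= Cmod x >= 0]. *)
  destruct (Rle_lt_or_eq_dec _ _ HD) as [Hpos'|Hz].
  - apply Rmult_le_reg_l with (Cmod D); trivial.
  - rewrite <- Hz.
    destruct (MVT_gen Y a b y) as [c' [Hc' E']].
    { rewrite Rmin_left, Rmax_right by trivial. intros; apply HY; lra. }
    { rewrite Rmin_left, Rmax_right by trivial. intros t Ht.
      apply continuity_pt_filterlim. apply (ex_derive_continuous Y). eexists; apply HY; lra. }
    rewrite Rmin_left, Rmax_right in Hc' by trivial. rewrite E'.
    apply Rmult_le_pos; [|lra]. eapply Rle_trans; [apply Cmod_ge_0|apply (Hxy c' Hc')].
Qed.

Lemma mean_value_bound (X x : R -> C) (a b M : R) :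
  a <= b -> (forall t, a <= t <= b -> pderiv X t (x t)) ->
  (forall t, a <= t <= b -> Cmod (x t) <= M) ->
  Cmod (X b - X a) <= M * (b - a).
Proof.
  intros Hab HX HM.
  replace (M * (b - a)) with (M * b - M * a) by ring.
  apply (mean_value_ineq X x (fun t => M * t) (fun _ => M)); trivial.
  intros. auto_derive; trivial. ring.
Qed.

Definition pint (X : R -> C) (a b : R) : C := RInt (V := C_R_CompleteNormedModule) X a b.

Lemma pint_ftc (X Y : R -> C) (a b : R) :
  (forall t, pcont X t) -> (forall t, pderiv Y t (X t)) -> pint X a b = (Y b - Y a)%C.
Proof.
  intros HX HY. apply (is_RInt_unique (V := C_R_CompleteNormedModule)).
  apply (is_RInt_derive (V := C_R_CompleteNormedModule)).
  - intros; now apply pderiv_is_derive.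
  - intros; now apply pcont_continuous.
Qed.

Lemma pint_deriv (X : R -> C) (a t : R) :
  (forall t, pcont X t) -> pderiv (fun b => pint X a b) t (X t).
Proof.
  intros HX. apply pderiv_is_derive.
  apply (is_derive_RInt (V := C_R_NormedModule) X _ a).
  - exists (mkposreal 1 Rlt_0_1). intros b _.
    apply (RInt_correct (V := C_R_CompleteNormedModule)).
    apply (ex_RInt_continuous (V := C_R_CompleteNormedModule)). intros; now apply pcont_continuous.
  - now apply pcont_continuous.
Qed.

Lemma pint_point (X : R -> C) (a : R) : pint X a a = 0%C.
Proof. apply (RInt_point (V := C_R_CompleteNormedModule)). Qed.

Lemma pint_bound (X : R -> C) (a b M : R) :
  a <= b -> (forall t, pcont X t) -> (forall t, a <= t <= b -> Cmod (X t) <= M) ->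
  Cmod (pint X a b) <= M * (b - a).
Proof.
  intros Hab HX HM.
  replace (pint X a b) with (pint X a b - pint X a a)%C by (rewrite pint_point; ring).
  apply (mean_value_bound (fun b => pint X a b) X); trivial.
  intros; now apply pint_deriv.
Qed.

Lemma pint_ext (X Y : R -> C) (a b : R) : (forall t, X t = Y t) -> pint X a b = pint Y a b.
Proof. intros H. f_equal. apply functional_extensionality; trivial. Qed.

(** The right-hand side, as a function of [b], is a primitive of the integrand. With one coefficient
    equal to 0 the lemma serves to pull out a factor. *)
Lemma pint_lin (c d : C) (X Y : R -> C) (a b : R) :
  (forall t, pcont X t) -> (forall t, pcont Y t) ->
  pint (fun t => c * X t + d * Y t)%C a b = (c * pint X a b + d * pint Y a b)%C.
Proof.
  intros HX HY.
  rewrite (pint_ftc _ (fun b => c * pint X a b + d * pint Y a b)%C).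
  - rewrite !pint_point. ring.
  - intros; apply cont_plus; now apply cont_scal.
  - intros; apply deriv_plus; apply deriv_scal; now apply pint_deriv.
Qed.

(** * Compactness *)

(** A Lebesgue number argument: choice attaches a radius to every centre, and compactness of the
    square around the disc bounds from below the radii that are needed. The factor 2 pays for
    passing from the maximum norm of the square to [Cmod]. *)
Lemma compact_disc (M : R) (P : C -> R -> Prop) :
  (forall u, exists del, 0 < del /\ P u del) ->
  exists d, 0 < d /\ forall z, Cmod z <= M ->
    exists u del, P u del /\ d <= del /\ Cmod (z - u) < 2 * del.
Proof.
  intros H.
  set (dl := fun u => proj1_sig (constructive_indefinite_description _ (H u))).
  assert (Hdl : forall u, 0 < dl u /\ P u (dl u))
    by (intros u; exact (proj2_sig (constructive_indefinite_description _ (H u)))).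
  destruct (compactness_value_2d (- M) M (- M) M
    (fun x y => mkposreal (dl (x, y)) (proj1 (Hdl (x, y))))) as [d Hd].
  exists d. split; [apply cond_pos|]. intros z Hz.
  pose proof (Rle_trans _ _ _ (Rmax_Cmod z) Hz) as Hm.
  pose proof (Rle_trans _ _ _ (Rmax_l _ _) Hm) as H1.
  pose proof (Rle_trans _ _ _ (Rmax_r _ _) Hm) as H2.
  apply Rabs_le_between in H1. apply Rabs_le_between in H2.
  specialize (Hd (fst z) (snd z) H1 H2). apply NNPP in Hd.
  destruct Hd as (u & v & _ & _ & A & B & E). simpl in A, B, E.
  exists (u, v), (dl (u, v)). split; [apply Hdl|]. split; trivial.
  eapply Rle_lt_trans; [apply Cmod_2Rmax|].
  apply Rle_lt_trans with (2 * Rmax (Rabs (fst z - u)) (Rabs (snd z - v))).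
  - apply Rmult_le_compat_r.
    + eapply Rle_trans; [apply Rabs_pos|apply Rmax_l].
    + apply Rlt_le, Rsqr_incrst_0; try lra. rewrite Rsqr_sqrt by lra. unfold Rsqr; lra.
      apply sqrt_pos.
  - apply Rmult_lt_compat_l; [lra|]. apply Rmax_lub_lt; trivial.
Qed.

Lemma unif_cont_disc (f : C -> C) (M eps : R) :
  (forall z, ccont f z) -> 0 < eps ->
  exists d, 0 < d /\ forall z w, Cmod z <= M -> Cmod (w - z) < d -> Cmod (f w - f z) < eps.
Proof.
  intros Hf He.
  (* The radius [3 * del] leaves room for both points: [z] is within [2 * del] of [u], and [w]
     within [d <= del] of [z]. *)
  destruct (compact_disc M (fun u del => forall w, Cmod (w - u) < 3 * del -> Cmod (f w - f u) < eps / 2))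
    as [d [Hd H]].
  { intros u. destruct (Hf u (eps / 2)) as [d [Hd H]]; [lra|].
    exists (d / 3). split; [lra|]. intros w Hw. apply H. unfold Cid. lra. }
  exists d. split; trivial. intros z w Hz Hw.
  destruct (H z Hz) as (u & del & HP & Hdel & Hzu).
  pose proof (HP z ltac:(lra)) as K1.
  pose proof (Cmod_triangle_minus w z u).
  pose proof (HP w ltac:(lra)) as K2.
  pose proof (Cmod_triangle_minus (f w) (f u) (f z)).
  rewrite (Cmod_minus_sym (f u) (f z)) in *. lra.
Qed.

Lemma bounded_disc (f : C -> C) (M : R) :
  (forall z, ccont f z) -> exists B, 0 < B /\ forall z, Cmod z <= M -> Cmod (f z) <= B.
Proof.
  intros Hf.
  (* The bound on [f] is coded in the radius as [/ del], so that the uniform lower bound [d] on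
     radii becomes the uniform upper bound [/ d] on [f]. *)
  destruct (compact_disc M (fun u del => forall w, Cmod (w - u) < 2 * del -> Cmod (f w) <= / del))
    as [d [Hd H]].
  { intros u. destruct (Hf u 1 Rlt_0_1) as [d [Hd H]].
    pose proof (Cmod_ge_0 (f u)) as Hu.
    assert (Hp : 0 < Rmin (d / 2) (/ (Cmod (f u) + 1))).
    { apply Rmin_pos; [lra|apply Rinv_0_lt_compat; lra]. }
    exists (Rmin (d / 2) (/ (Cmod (f u) + 1))). split; trivial.
    intros w Hw. pose proof (Rmin_l (d / 2) (/ (Cmod (f u) + 1))).
    pose proof (Rmin_r (d / 2) (/ (Cmod (f u) + 1))) as Hr.
    apply Rle_trans with (Cmod (f u) + 1).
    - specialize (H w ltac:(unfold Cid; lra)).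
      pose proof (Cmod_triangle (f w - f u) (f u)) as T.
      replace (f w - f u + f u)%C with (f w) in T by ring. lra.
    - eapply Rle_trans; [|apply Rinv_le_contravar; [apply Hp|apply Hr]].
      rewrite Rinv_inv. lra. }
  exists (/ d). split; [now apply Rinv_0_lt_compat|]. intros z Hz.
  destruct (H z Hz) as (u & del & HP & Hdel & Hzu).
  eapply Rle_trans; [apply HP; trivial|]. apply Rinv_le_contravar; trivial.
Qed.

(** * Goursat's theorem: entire functions have primitives *)

Definition seg (f : C -> C) (a b : C) : C :=
  ((b - a) * pint (fun t => f (a + RtoC t * (b - a))) 0 1)%C.

Lemma pderiv_line (a v : C) (t : R) : pderiv (fun t => a + RtoC t * v)%C t v.
Proof.
  apply (deriv_ext RtoC (fun t => a + v * RtoC t)%C _ t (0 + v * 1)%C).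
  intros; ring. ring. apply deriv_plus. apply deriv_const. apply deriv_scal, deriv_emb.
Qed.

Lemma pderiv_ray (v : C) (t : R) : pderiv (fun t => RtoC t * v)%C t v.
Proof.
  apply (deriv_ext RtoC (fun t => 0 + RtoC t * v)%C _ t v). intros; ring. reflexivity.
  apply pderiv_line.
Qed.

Lemma pcont_line (f : C -> C) (a v : C) :
  (forall z, ccont f z) -> forall t, pcont (fun t => f (a + RtoC t * v)%C) t.
Proof.
  intros Hf t. apply (cont_comp RtoC f (fun t => a + RtoC t * v)%C). apply Hf.
  eapply deriv_cont, pderiv_line.
Qed.

Lemma seg_primitive (f F : C -> C) (a b : C) :
  (forall z, ccont f z) -> (forall z, cderiv F z (f z)) -> seg f a b = (F b - F a)%C.
Proof.
  intros Hf HF. unfold seg.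
  assert (K := pint_lin (b - a)%C 0%C (fun t => f (a + RtoC t * (b - a))%C)
     (fun t => f (a + RtoC t * (b - a))%C) 0 1 (pcont_line _ _ _ Hf) (pcont_line _ _ _ Hf)).
  rewrite Cmult_0_l, Cplus_0_r in K. rewrite <- K.
  rewrite (pint_ftc _ (fun t => F (a + RtoC t * (b - a))%C)).
  - f_equal; f_equal; ring.
  - intros t. apply cont_plus; apply cont_scal; now apply pcont_line.
  - intros t. eapply deriv_ext; [reflexivity| |eapply deriv_comp; [apply HF|apply pderiv_line]]. ring.
Qed.

(** Affine change of parameter. Since [s] and [s'] are arbitrary reals, reversal of a segment and
    its bisection are both instances. *)
Lemma seg_sub (f : C -> C) (a b : C) (s s' : R) :
  (forall z, ccont f z) ->
  seg f (a + RtoC s * (b - a)) (a + RtoC s' * (b - a)) =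
  ((b - a) * (pint (fun t => f (a + RtoC t * (b - a))) 0 s'
              - pint (fun t => f (a + RtoC t * (b - a))) 0 s))%C.
Proof.
  intros Hf. unfold seg.
  set (X := fun t => f (a + RtoC t * (b - a))%C).
  assert (HX : forall t, pcont X t) by now apply pcont_line.
  assert (HX' : forall t, pcont (fun t => X (s + t * (s' - s))) t).
  { intros t eps He. destruct (HX (s + t * (s' - s)) eps He) as [d [Hd H]].
    exists (d / (1 + Rabs (s' - s))). pose proof (Rabs_pos (s' - s)).
    split; [apply Rdiv_lt_0_compat; lra|]. intros r Hr. apply H.
    rewrite <- RtoC_minus, Cmod_R in Hr |- *.
    replace (s + r * (s' - s) - (s + t * (s' - s))) with ((r - t) * (s' - s)) by ring.
    rewrite Rabs_mult. pose proof (Rabs_pos (r - t)).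
    apply Rle_lt_trans with (Rabs (r - t) * (1 + Rabs (s' - s))); [nra|].
    apply Rmult_lt_reg_r with (/ (1 + Rabs (s' - s))). apply Rinv_0_lt_compat; lra.
    rewrite Rmult_assoc, Rinv_r by lra. unfold Rdiv in Hr; lra. }
  rewrite (pint_ext _ (fun t => X (s + t * (s' - s)))).
  2: { intros t. unfold X. f_equal. rewrite RtoC_plus, RtoC_mult, RtoC_minus. ring. }
  replace (a + s' * (b - a) - (a + s * (b - a)))%C with ((b - a) * RtoC (s' - s))%C
    by (rewrite RtoC_minus; ring).
  rewrite <- Cmult_assoc. f_equal.
  assert (K := pint_lin (RtoC (s' - s)) 0%C _ _ 0 1 HX' HX').
  rewrite Cmult_0_l, Cplus_0_r in K. rewrite <- K.
  rewrite (pint_ftc _ (fun t => pint X 0 (s + t * (s' - s)))).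
  - f_equal; f_equal; f_equal; ring.
  - intros t. apply cont_plus; now apply cont_scal.
  - intros t.
    intros eps He.
    pose proof (Rabs_pos (s' - s)) as Hp.
    assert (He' : 0 < eps / (1 + Rabs (s' - s))) by (apply Rdiv_lt_0_compat; lra).
    destruct (pint_deriv X 0 (s + t * (s' - s)) HX _ He') as [d [Hd H]].
    exists (d / (1 + Rabs (s' - s))). split; [apply Rdiv_lt_0_compat; lra|].
    intros r Hr.
    assert (E : RtoC (s + r * (s' - s)) = (RtoC (s + t * (s' - s)) + RtoC (s' - s) * (r - t))%C).
    { rewrite <- RtoC_minus, <- RtoC_mult, <- RtoC_plus. f_equal; ring. }
    assert (E2 : Cmod (RtoC (s + r * (s' - s)) - RtoC (s + t * (s' - s))) = Rabs (s' - s) * Cmod (r - t)).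
    { rewrite E. rewrite <- (Cmod_R (s' - s)), <- Cmod_mult. f_equal. ring. }
    pose proof (Cmod_ge_0 (r - t)) as Hm.
    assert (Hlt : Cmod (r - t) * (1 + Rabs (s' - s)) < d).
    { apply Rmult_lt_reg_r with (/ (1 + Rabs (s' - s))). apply Rinv_0_lt_compat; lra.
      rewrite Rmult_assoc, Rinv_r by lra. unfold Rdiv in Hr; lra. }
    specialize (H (s + r * (s' - s))). rewrite E2 in H. specialize (H ltac:(nra)).
    eapply Rle_trans; [eapply Cmod_le_of_eq; [|apply H]|].
    + rewrite E. ring.
    + apply Rle_trans with (eps / (1 + Rabs (s' - s)) * ((1 + Rabs (s' - s)) * Cmod (r - t))).
      * apply Rmult_le_compat_l; [lra|]. nra.
      * right; field; lra.
Qed.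

Lemma seg_bound (f : C -> C) (a b : C) (M : R) :
  (forall z, ccont f z) ->
  (forall t, 0 <= t <= 1 -> Cmod (f (a + RtoC t * (b - a))%C) <= M) ->
  Cmod (seg f a b) <= M * Cmod (b - a).
Proof.
  intros Hf HM. unfold seg. rewrite Cmod_mult, Rmult_comm.
  apply Rmult_le_compat_r. apply Cmod_ge_0.
  replace M with (M * (1 - 0)) by ring.
  apply pint_bound; trivial. lra. now apply pcont_line.
Qed.

Lemma seg_minus (f g : C -> C) (a b : C) :
  (forall z, ccont f z) -> (forall z, ccont g z) ->
  seg (fun z => f z - g z)%C a b = (seg f a b - seg g a b)%C.
Proof.
  intros Hf Hg. unfold seg.
  rewrite (pint_ext _ (fun t => 1 * f (a + RtoC t * (b - a)) + (-(1)) * g (a + RtoC t * (b - a)))%C)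
    by (intros; ring).
  rewrite pint_lin; try (now apply pcont_line). ring.
Qed.

Lemma seg_as_sub (f : C -> C) (a b x y : C) (s s' : R) :
  (forall z, ccont f z) ->
  x = (a + RtoC s * (b - a))%C -> y = (a + RtoC s' * (b - a))%C ->
  seg f x y =
  ((b - a) * (pint (fun t => f (a + RtoC t * (b - a))) 0 s'
              - pint (fun t => f (a + RtoC t * (b - a))) 0 s))%C.
Proof. intros Hf -> ->. now apply seg_sub. Qed.

Lemma seg_swap (f : C -> C) (a b : C) : (forall z, ccont f z) -> seg f b a = (- seg f a b)%C.
Proof.
  intros Hf.
  rewrite (seg_as_sub f a b a b 0 1), (seg_as_sub f a b b a 1 0); trivial; try ring.
Qed.

Definition mid (a b : C) : C := (a + RtoC (/ 2) * (b - a))%C.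

Lemma RtoC_half : (RtoC (/ 2) + RtoC (/ 2))%C = 1%C.
Proof. rewrite <- RtoC_plus. f_equal. field. Qed.

Lemma half_plus_half (x : C) : x = (RtoC (/ 2) * x + RtoC (/ 2) * x)%C.
Proof. rewrite <- Cmult_plus_distr_r, RtoC_half. ring. Qed.

Lemma seg_mid (f : C -> C) (a b : C) : (forall z, ccont f z) ->
  seg f a b = (seg f a (mid a b) + seg f (mid a b) b)%C.
Proof.
  intros Hf. rewrite (seg_as_sub f a b a b 0 1), (seg_as_sub f a b a (mid a b) 0 (/ 2)),
    (seg_as_sub f a b (mid a b) b (/ 2) 1); trivial; try ring.
Qed.

Definition tri (f : C -> C) (a b c : C) : C := (seg f a b + seg f b c + seg f c a)%C.

Lemma mid_sym (a b : C) : mid a b = mid b a.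
Proof.
  unfold mid. rewrite (half_plus_half a) at 1. rewrite (half_plus_half b) at 2. ring.
Qed.

Lemma tri_split (f : C -> C) (a b c : C) : (forall z, ccont f z) ->
  tri f a b c = (tri f a (mid a b) (mid c a) + tri f b (mid b c) (mid a b)
                 + tri f c (mid c a) (mid b c) + tri f (mid a b) (mid b c) (mid c a))%C.
Proof.
  intros Hf. unfold tri.
  rewrite (seg_mid f a b), (seg_mid f b c), (seg_mid f c a) by trivial.
  rewrite (seg_swap f (mid a b) (mid b c)), (seg_swap f (mid b c) (mid c a)),
    (seg_swap f (mid c a) (mid a b)) by trivial.
  ring.
Qed.

Definition perim (a b c : C) : R := Cmod (b - a) + Cmod (c - b) + Cmod (a - c).

Lemma Cmod_half (x : C) : Cmod (RtoC (/ 2) * x) = Cmod x / 2.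
Proof. rewrite Cmod_mult, Cmod_R, Rabs_pos_eq by lra. lra. Qed.

Lemma Cmod_mid_l (a b : C) : Cmod (mid a b - a) = Cmod (b - a) / 2.
Proof. rewrite <- Cmod_half. f_equal. unfold mid. ring. Qed.

Lemma Cmod_mid_r (a b : C) : Cmod (b - mid a b) = Cmod (b - a) / 2.
Proof. rewrite <- Cmod_half. f_equal. unfold mid. rewrite (half_plus_half b) at 1.
  rewrite (half_plus_half a) at 1. ring. Qed.

Lemma Cmod_mid_mid (a b c : C) : Cmod (mid b c - mid a b) = Cmod (c - a) / 2.
Proof. rewrite <- Cmod_half. f_equal. rewrite (mid_sym a b). unfold mid. ring. Qed.

Lemma perim_corner (a b c : C) : perim a (mid a b) (mid c a) = perim a b c / 2.
Proof.
  unfold perim. rewrite Cmod_mid_l, (Cmod_minus_sym (mid c a)), Cmod_mid_mid, Cmod_mid_r.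
  rewrite (Cmod_minus_sym b c). lra.
Qed.

Lemma perim_rot (a b c : C) : perim b c a = perim a b c.
Proof. unfold perim. ring. Qed.

Lemma perim_middle (a b c : C) : perim (mid a b) (mid b c) (mid c a) = perim a b c / 2.
Proof.
  unfold perim. rewrite !Cmod_mid_mid.
  rewrite (Cmod_minus_sym c a), (Cmod_minus_sym a b), (Cmod_minus_sym b c). lra.
Qed.

Definition sub_triangle (T T' : C * C * C) : Prop :=
  let '(a, b, c) := T in
  T' = (a, mid a b, mid c a) \/ T' = (b, mid b c, mid a b) \/
  T' = (c, mid c a, mid b c) \/ T' = (mid a b, mid b c, mid c a).

Definition tperim (T : C * C * C) : R := let '(a, b, c) := T in perim a b c.

Lemma side_le_perim (a b c : C) : Cmod (b - a) <= perim a b c.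
Proof.
  unfold perim. pose proof (Cmod_ge_0 (c - b)). pose proof (Cmod_ge_0 (a - c)). lra.
Qed.

(** The second part stands in for nestedness: the first vertices of successive triangles will form a
    Cauchy sequence. *)
Lemma sub_triangle_perim (T T' : C * C * C) :
  sub_triangle T T' -> tperim T' = tperim T / 2 /\ Cmod (fst (fst T') - fst (fst T)) <= tperim T.
Proof.
  destruct T as [[a b] c]. simpl. intros H.
  pose proof (Cmod_ge_0 (c - b)). pose proof (Cmod_ge_0 (a - c)). pose proof (Cmod_ge_0 (b - a)).
  destruct H as [-> | [-> | [-> | ->]]]; simpl; (split; [|unfold perim]).
  - apply perim_corner.
  - replace (a - a)%C with (RtoC 0) by ring. rewrite Cmod_0. lra.
  - rewrite perim_corner, perim_rot. reflexivity.
  - lra.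
  - rewrite perim_corner, perim_rot, perim_rot. reflexivity.
  - rewrite (Cmod_minus_sym c a). lra.
  - apply perim_middle.
  - rewrite Cmod_mid_l. lra.
Qed.

(** Completeness of the reals is applied to each coordinate, where the geometric tail gives the
    error [2 L / 2^n]; the passage from coordinates to [Cmod] costs at most a factor 2, whence the
    4. *)
Lemma Cauchy_geometric (a : nat -> C) (L : R) :
  (forall n, Cmod (a (S n) - a n) <= L * (/ 2) ^ n) ->
  exists p, forall n, Cmod (p - a n) <= 4 * L * (/ 2) ^ n.
Proof.
  intros H.
  assert (Hp : forall n, 0 < (/ 2) ^ n) by (intros; apply pow_lt; lra).
  assert (HL : 0 <= L).
  { specialize (H O). simpl in H. pose proof (Cmod_ge_0 (a 1%nat - a O)). lra. }
  (* The subtracted term is the part of the geometric series not yet used; it is what lets the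
     induction on [k] close. *)
  assert (HC : forall n k, Cmod (a (n + k)%nat - a n) <= 2 * L * (/ 2) ^ n - 2 * L * (/ 2) ^ (n + k)).
  { intros n k. induction k as [|k IH].
    - rewrite Nat.add_0_r. replace (a n - a n)%C with (RtoC 0) by ring. rewrite Cmod_0. lra.
    - rewrite Nat.add_succ_r. pose proof (Cmod_triangle_minus (a (S (n + k))) (a (n + k)%nat) (a n)).
      specialize (H (n + k)%nat). simpl pow in *. lra. }
  assert (HC2 : forall n k, Cmod (a (n + k)%nat - a n) <= 2 * L * (/ 2) ^ n).
  { intros n k. specialize (HC n k). specialize (Hp (n + k)%nat). nra. }
  assert (key : forall g : C -> R, (forall x y, Rabs (g x - g y) <= Cmod (x - y)) ->
    exists l, forall n, Rabs (l - g (a n)) <= 2 * L * (/ 2) ^ n).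
  { intros g Hg.
    assert (Cauchy_crit (fun n => g (a n))) as HCC.
    { intros eps He.
      assert (Hlim : Un_cv (fun n => (/ 2) ^ n) 0).
      { intros e Hee. destruct (pow_lt_1_zero (/ 2) ltac:(rewrite Rabs_pos_eq; lra) e Hee) as [N HN].
        exists N. intros n Hn. unfold R_dist. rewrite Rminus_0_r. auto. }
      destruct (Hlim (eps / (4 * L + 1))) as [N HN]; [apply Rdiv_lt_0_compat; lra|].
      exists N. intros n k Hn Hk. unfold R_dist.
      specialize (HN N (Nat.le_refl _)). unfold R_dist in HN. rewrite Rminus_0_r, Rabs_pos_eq in HN by (left; apply Hp).
      assert (H1 := HC2 N (n - N)%nat). assert (H2 := HC2 N (k - N)%nat).
      replace (N + (n - N))%nat with n in H1 by lia. replace (N + (k - N))%nat with k in H2 by lia.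
      assert (H3 := Hg (a n) (a k)).
      pose proof (Cmod_triangle_minus (a n) (a N) (a k)). rewrite (Cmod_minus_sym (a N)) in *.
      assert ((/ 2) ^ N * (4 * L + 1) < eps).
      { apply Rmult_lt_reg_r with (/ (4 * L + 1)). apply Rinv_0_lt_compat; lra.
        rewrite Rmult_assoc, Rinv_r by lra. unfold Rdiv in HN; lra. }
      specialize (Hp N). nra. }
    destruct (Rcomplete.R_complete _ HCC) as [l Hl]. exists l. intros n.
    apply Rnot_lt_le. intro A.
    destruct (Hl (Rabs (l - g (a n)) - 2 * L * (/ 2) ^ n)) as [N HN]; [lra|].
    specialize (HN (n + N)%nat ltac:(lia)). unfold R_dist in HN.
    pose proof (Hg (a (n + N)%nat) (a n)). specialize (HC2 n N).
    pose proof (Rabs_triang (l - g (a (n + N)%nat)) (g (a (n + N)%nat) - g (a n))) as T.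
    replace (l - g (a (n + N)%nat) + (g (a (n + N)%nat) - g (a n))) with (l - g (a n)) in T by ring.
    rewrite Rabs_minus_sym in HN. lra. }
  destruct (key fst) as [p1 H1].
  { intros x y. eapply Rle_trans; [|apply (Rmax_Cmod (x - y)%C)]. apply Rmax_l. }
  destruct (key snd) as [p2 H2].
  { intros x y. eapply Rle_trans; [|apply (Rmax_Cmod (x - y)%C)]. apply Rmax_r. }
  exists (p1, p2). intros n. specialize (H1 n). specialize (H2 n). specialize (Hp n).
  eapply Rle_trans; [apply Cmod_2Rmax|].
  replace (4 * L * (/ 2) ^ n) with (2 * (2 * L * (/ 2) ^ n)) by ring.
  apply Rmult_le_compat.
  - apply sqrt_pos.
  - eapply Rle_trans; [apply Rabs_pos|apply Rmax_l].
  - apply Rlt_le, Rsqr_incrst_0; try lra. rewrite Rsqr_sqrt by lra. unfold Rsqr; lra.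
    apply sqrt_pos.
  - apply Rmax_lub; trivial.
Qed.

(** Bisection as an induction principle: a counterexample has a smaller counterexample among its
    four parts, and the resulting sequence shrinks to a point [p] where the local hypothesis
    applies. The distance [4 * tperim T] is the one [Cauchy_geometric] delivers. *)
Lemma triangle_induction (P : C * C * C -> Prop) :
  (forall T, (forall T', sub_triangle T T' -> P T') -> P T) ->
  (forall p, exists del, 0 < del /\ forall T, tperim T < del ->
     Cmod (p - fst (fst T)) <= 4 * tperim T -> P T) ->
  forall T, P T.
Proof.
  intros Hsub Hloc T. apply NNPP. intro HT.
  (* With the implication under the existential, a successor exists for every triple, so that choice
     gives a total function [next]. *)
  assert (Hnext : forall T, exists T', ~ P T -> sub_triangle T T' /\ ~ P T').
  { intros U. destruct (classic (P U)) as [HU|HU]. exists U; tauto.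
    apply NNPP. intro A. apply HU, Hsub. intros T' H'. apply NNPP. intro B.
    apply A. exists T'. auto. }
  set (next := fun U => proj1_sig (constructive_indefinite_description _ (Hnext U))).
  assert (Hn : forall U, ~ P U -> sub_triangle U (next U) /\ ~ P (next U))
    by (intros U; exact (proj2_sig (constructive_indefinite_description _ (Hnext U)))).
  set (t := fun n => Nat.iter n next T).
  assert (Ht : forall n, ~ P (t n)).
  { induction n. trivial. apply (Hn _ IHn). }
  assert (Hs : forall n, sub_triangle (t n) (t (S n))) by (intros n; apply (Hn _ (Ht n))).
  assert (Hper : forall n, tperim (t n) = tperim T * (/ 2) ^ n).
  { induction n. simpl; lra. destruct (sub_triangle_perim _ _ (Hs n)) as [E _].
    rewrite E, IHn. simpl. lra. }
  destruct (Cauchy_geometric (fun n => fst (fst (t n))) (tperim T)) as [p Hp].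
  { intros n. rewrite <- Hper. apply (sub_triangle_perim _ _ (Hs n)). }
  destruct (Hloc p) as [del [Hdel H]].
  assert (HT0 : 0 <= tperim T).
  { destruct T as [[a b] c]. simpl. eapply Rle_trans; [apply (Cmod_ge_0 (b - a))|apply side_le_perim]. }
  destruct (pow_lt_1_zero (/ 2) ltac:(rewrite Rabs_pos_eq; lra) (del / (tperim T + 1)))
    as [N HN]; [apply Rdiv_lt_0_compat; lra|].
  specialize (HN N (Nat.le_refl _)).
  assert (Hpow : 0 < (/ 2) ^ N) by (apply pow_lt; lra).
  rewrite Rabs_pos_eq in HN by lra.
  apply (Ht N), H.
  - rewrite Hper.
    assert ((/ 2) ^ N * (tperim T + 1) < del).
    { apply Rmult_lt_reg_r with (/ (tperim T + 1)). apply Rinv_0_lt_compat; lra.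
      rewrite Rmult_assoc, Rinv_r by lra. unfold Rdiv in HN; lra. }
    nra.
  - rewrite Hper. specialize (Hp N). simpl in Hp. lra.
Qed.

Lemma segment_near (p a b : C) (t : R) :
  0 <= t <= 1 -> Cmod (a + RtoC t * (b - a) - p) <= Cmod (a - p) + Cmod (b - a).
Proof.
  intros Ht.
  eapply Rle_trans; [eapply Cmod_le_of_eq; [|apply (Cmod_triangle (a - p) (RtoC t * (b - a)))]; ring|].
  rewrite Cmod_mult, Cmod_R, Rabs_pos_eq by lra. pose proof (Cmod_ge_0 (b - a)). nra.
Qed.

(** The bound [eps * perim^2] survives quartering, because four triangles of half the perimeter give
    [4 (S / 2)^2 = S^2]. Near a point, [f] differs little from its affine approximation [g], which
    has a primitive and integrates to 0. *)
Lemma goursat (f : C -> C) (a b c : C) :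
  (forall z, exists l, cderiv f z l) -> tri f a b c = 0%C.
Proof.
  intros Hf.
  assert (Hfc : forall z, ccont f z) by (intros z; destruct (Hf z) as [l Hl]; eapply deriv_cont, Hl).
  assert (key : forall eps, 0 < eps -> Cmod (tri f a b c) <= eps * (perim a b c * perim a b c)).
  { intros eps He.
    apply (triangle_induction (fun T => let '(a, b, c) := T in
      Cmod (tri f a b c) <= eps * (perim a b c * perim a b c))) with (T := (a, b, c)); clear a b c.
    - intros [[a b] c] H. rewrite tri_split by trivial.
      pose proof (H _ (or_introl eq_refl)) as H1.
      pose proof (H _ (or_intror (or_introl eq_refl))) as H2.
      pose proof (H _ (or_intror (or_intror (or_introl eq_refl)))) as H3.
      pose proof (H _ (or_intror (or_intror (or_intror eq_refl)))) as H4.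
      cbv beta iota in H1, H2, H3, H4.
      rewrite perim_corner in H1, H2, H3. rewrite perim_middle in H4.
      rewrite perim_rot in H2. rewrite perim_rot, perim_rot in H3.
      eapply Rle_trans; [apply Cmod_triangle|].
      eapply Rle_trans; [apply Rplus_le_compat_r, Cmod_triangle3|]. lra.
    - intros p. destruct (Hf p) as [l Hl].
      (* A side of a triangle of perimeter [S] whose first vertex is within [4 S] of [p] stays
         within [6 S] of [p]: vertices are within [5 S], and a side adds at most [S]. *)
      destruct (Hl (eps / 6)) as [del [Hdel H]]; [lra|]. unfold Cid in H.
      exists (del / 6). split; [lra|].
      intros [[a b] c]. simpl. intros HS Hp. set (S := perim a b c) in *.
      assert (H1 : Cmod (b - a) + Cmod (c - b) + Cmod (a - c) = S) by reflexivity.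
      pose proof (Cmod_ge_0 (c - b)). pose proof (Cmod_ge_0 (a - c)). pose proof (Cmod_ge_0 (b - a)).
      rewrite Cmod_minus_sym in Hp.
      pose proof (Cmod_triangle_minus b a p) as Hb.
      pose proof (Cmod_triangle_minus c a p) as Hc.
      rewrite (Cmod_minus_sym c a) in Hc.
      set (g := fun z => (f p + l * (z - p))%C).
      assert (Hg : forall z, ccont g z).
      { intros z. apply cont_plus. apply cont_const. apply cont_scal. eapply deriv_cont.
        apply (deriv_minus Cid Cid). apply deriv_emb. apply deriv_const. }
      assert (Hg2 : forall z, cderiv (fun z => f p * z + l * (RtoC (/ 2) * ((z - p) * (z - p))))%C z (g z)).
      { intros z. pose proof (deriv_minus Cid Cid _ z _ _ (deriv_emb Cid z) (deriv_const Cid p z)) as K.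
        eapply deriv_ext; [intros s; reflexivity| |apply deriv_plus;
          [apply deriv_scal, (deriv_emb Cid)|apply deriv_scal, deriv_scal, deriv_mult; apply K]].
        unfold g, Cid. rewrite (half_plus_half (z - p)) at 3. ring. }
      assert (E : tri f a b c = tri (fun z => f z - g z)%C a b c).
      { unfold tri. rewrite !seg_minus by trivial.
        rewrite !(fun x y => seg_primitive g _ x y Hg Hg2). ring. }
      rewrite E.
      assert (Hfg : forall z, ccont (fun z => f z - g z)%C z).
      { intros z. assert (K := cont_plus Cid _ _ z (Hfc z) (cont_scal Cid (-(1))%C _ _ (Hg z))).
        intros e Hee. destruct (K e Hee) as [d [Hd HH]]. exists d. split; trivial.
        intros s Hs. specialize (HH s Hs). eapply Rle_lt_trans; [|apply HH]. right; f_equal; ring. }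
      assert (Hb2 : forall z, Cmod (z - p) <= 6 * S -> Cmod (f z - g z) <= eps * S).
      { intros z Hz. eapply Rle_trans; [eapply Cmod_le_of_eq; [|apply (H z)]|].
        unfold g; ring. lra.
        apply Rle_trans with (eps / 6 * (6 * S)); [apply Rmult_le_compat_l; lra|lra]. }
      unfold tri. eapply Rle_trans; [apply Cmod_triangle3|].
      assert (K1 := seg_bound _ a b (eps * S) Hfg
        (fun t Ht => Hb2 _ (Rle_trans _ _ (6 * S) (segment_near p a b t Ht) ltac:(lra)))).
      assert (K2 := seg_bound _ b c (eps * S) Hfg
        (fun t Ht => Hb2 _ (Rle_trans _ _ (6 * S) (segment_near p b c t Ht) ltac:(lra)))).
      assert (K3 := seg_bound _ c a (eps * S) Hfg
        (fun t Ht => Hb2 _ (Rle_trans _ _ (6 * S) (segment_near p c a t Ht) ltac:(lra)))).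
      replace (eps * (S * S)) with (eps * S * (Cmod (b - a) + Cmod (c - b) + Cmod (a - c)))
        by (rewrite H1; ring).
      lra. }
  apply Cmod_eq_0. apply Rle_antisym; [|apply Cmod_ge_0].
  apply Rnot_lt_le. intro A.
  set (q := perim a b c * perim a b c) in *.
  assert (Hq : 0 <= q) by (unfold q; nra).
  specialize (key (Cmod (tri f a b c) / (2 * (q + 1)))).
  assert (K : 0 < Cmod (tri f a b c) / (2 * (q + 1))) by (apply Rdiv_lt_0_compat; lra).
  specialize (key K).
  assert (E : Cmod (tri f a b c) / (2 * (q + 1)) * (2 * (q + 1)) = Cmod (tri f a b c)) by (field; lra).
  nra.
Qed.

Lemma entire_cderiv (f : C -> C) : entire f <-> forall z, cderiv f z (C_derive f z).
Proof.
  split.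
  - intros H z. apply cderiv_is_derive. apply C_derive_correct; trivial.
  - intros H z. exists (C_derive f z). apply cderiv_is_derive, H.
Qed.

Lemma cderiv_unique (f : C -> C) (z l : C) : cderiv f z l -> C_derive f z = l.
Proof. intros H. apply is_C_derive_unique. now apply cderiv_is_derive. Qed.

Lemma entire_intro (f f' : C -> C) : (forall z, cderiv f z (f' z)) -> entire f.
Proof. intros H z. exists (f' z). apply cderiv_is_derive, H. Qed.

Lemma entire_cont (f : C -> C) : entire f -> forall z, ccont f z.
Proof. intros H z. eapply deriv_cont. now apply entire_cderiv. Qed.

(** By Goursat's theorem two integrals starting at 0 differ by the integral over the short segment
    from [z] to [w], where [f] is close to the constant [f z]. *)
Lemma entire_primitive (f : C -> C) : entire f -> exists F, forall z, cderiv F z (f z).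
Proof.
  intros Hf. pose proof (entire_cont f Hf) as Hc.
  assert (Hf' : forall z, exists l, cderiv f z l).
  { intros z; eexists; now apply entire_cderiv. }
  exists (fun z => seg f 0 z). intros z eps He.
  destruct (Hc z eps He) as [d [Hd H]]. exists d. split; trivial.
  unfold Cid in *. intros w Hw.
  assert (E : (seg f 0 w - seg f 0 z)%C = seg f z w).
  { assert (G := goursat f 0 z w Hf'). unfold tri in G.
    rewrite (seg_swap f 0 w) in G by trivial.
    replace (seg f z w) with (seg f 0 z + seg f z w + - seg f 0 w + seg f 0 w - seg f 0 z)%C by ring.
    rewrite G. ring. }
  rewrite E.
  assert (Hcst : forall x, ccont (fun _ => f z) x) by (intros; apply cont_const).
  assert (E2 : seg (fun _ => f z) z w = (f z * (w - z))%C).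
  { rewrite (seg_primitive _ (fun x => f z * x)%C); trivial. ring.
    intros x. eapply deriv_ext; [reflexivity| |apply deriv_scal, (deriv_emb Cid)]. ring. }
  rewrite <- E2, <- seg_minus by trivial.
  apply seg_bound.
  - intros x. assert (K := cont_plus Cid _ _ x (Hc x) (cont_const Cid (- f z)%C x)). exact K.
  - intros t Ht. apply Rlt_le, H.
    replace (z + t * (w - z) - z)%C with (RtoC t * (w - z))%C by ring.
    rewrite Cmod_mult, Cmod_R, Rabs_pos_eq by lra. pose proof (Cmod_ge_0 (w - z)). nra.
Qed.

(** * The complex exponential *)

Definition Cexp (z : C) : C :=
  (RtoC (exp (Re z)) * (RtoC (cos (Im z)) + Ci * RtoC (sin (Im z))))%C.

Lemma Ci_sqr : (Ci * Ci = - (1))%C.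
Proof. unfold Ci, Cmult, Copp, RtoC; simpl. f_equal; ring. Qed.

Lemma Cexp_plus (z w : C) : Cexp (z + w) = (Cexp z * Cexp w)%C.
Proof.
  unfold Cexp. rewrite re_plus, im_plus, exp_plus, cos_plus, sin_plus.
  rewrite RtoC_mult, RtoC_minus, RtoC_plus, !RtoC_mult.
  ring_simplify.
  replace (Ci ^ 2)%C with (- (1))%C by (rewrite <- Ci_sqr; ring). ring.
Qed.

Lemma Cexp_0 : Cexp 0 = 1%C.
Proof. unfold Cexp. simpl. rewrite exp_0, cos_0, sin_0. ring. Qed.

Lemma Cmod_cos_sin (t : R) : Cmod (RtoC (cos t) + Ci * RtoC (sin t)) = 1.
Proof.
  unfold Cmod. replace (fst _) with (cos t) by (simpl; ring).
  replace (snd _) with (sin t) by (simpl; ring).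
  rewrite <- sqrt_1. f_equal. pose proof (sin2_cos2 t). unfold Rsqr in *. lra.
Qed.

Lemma Cmod_Cexp (z : C) : Cmod (Cexp z) = exp (Re z).
Proof.
  unfold Cexp. rewrite Cmod_mult, Cmod_cos_sin, Cmod_R, Rabs_pos_eq; [ring|].
  left; apply exp_pos.
Qed.

Lemma Cexp_neq_0 (z : C) : Cexp z <> 0%C.
Proof. apply Cmod_gt_0. rewrite Cmod_Cexp. apply exp_pos. Qed.

Lemma Cexp_INR (n : nat) (z : C) : Cexp (RtoC (INR n) * z) = (Cexp z ^ n)%C.
Proof.
  induction n as [|n IH].
  - simpl. rewrite Cmult_0_l. apply Cexp_0.
  - rewrite S_INR, RtoC_plus, Cpow_S, <- IH, <- Cexp_plus. f_equal. ring.
Qed.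

Lemma pderiv_Cexp_ray (h : C) (t : R) : pderiv (fun t => Cexp (RtoC t * h)) t (h * Cexp (RtoC t * h))%C.
Proof.
  pose (a := Re h). pose (b := Im h).
  assert (Eh : h = (RtoC a + Ci * RtoC b)%C).
  { unfold a, b, Ci, Cplus, Cmult, RtoC, Re, Im; simpl. destruct h; simpl. f_equal; ring. }
  assert (E : forall t, Cexp (RtoC t * h) = (RtoC (exp (t * a)) * (RtoC (cos (t * b)) + Ci * RtoC (sin (t * b))))%C).
  { intros s. unfold Cexp. rewrite re_scal_l, im_scal_l. reflexivity. }
  eapply deriv_ext; [intros s; symmetry; apply E| |].
  2: { apply deriv_mult.
    - apply (pderiv_RtoC (fun t => exp (t * a)) t (a * exp (t * a))). auto_derive; trivial. ring.
    - apply deriv_plus.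
      + apply (pderiv_RtoC (fun t => cos (t * b)) t (- b * sin (t * b))). auto_derive; trivial. ring.
      + apply deriv_scal. apply (pderiv_RtoC (fun t => sin (t * b)) t (b * cos (t * b))).
        auto_derive; trivial. ring. }
  rewrite E. rewrite Eh at 1. rewrite !RtoC_mult, RtoC_opp. ring_simplify.
  replace (Ci ^ 2)%C with (- (1))%C by (rewrite <- Ci_sqr; ring). ring.
Qed.

Lemma Cexp_minus_1 (h : C) : Cmod h <= 1 -> Cmod (Cexp h - 1) <= 3 * Cmod h.
Proof.
  intros Hh.
  assert (K := mean_value_bound (fun t => Cexp (RtoC t * h)) (fun t => h * Cexp (RtoC t * h))%C 0 1 (3 * Cmod h)).
  cbv beta in K. rewrite Cmult_0_l, Cmult_1_l, Cexp_0, Rminus_0_r, Rmult_1_r in K. apply K.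
  - lra.
  - intros; apply pderiv_Cexp_ray.
  - intros t Ht. rewrite Cmod_mult, Cmod_Cexp, re_scal_l. rewrite Rmult_comm.
    apply Rmult_le_compat_r. apply Cmod_ge_0.
    eapply Rle_trans; [|apply exp_le_3].
    pose proof (re_le_Cmod h) as R1. apply Rabs_le_between in R1.
    destruct (Req_dec (t * Re h) 1) as [->|]; [lra|].
    left. apply exp_increasing. nra.
Qed.

(** A quadratic remainder at 0, from the mean value inequality on the segment from 0 to [h], is
    carried to [z] by the functional equation. *)
Lemma cderiv_Cexp (z : C) : cderiv Cexp z (Cexp z).
Proof.
  assert (K0 : forall h, Cmod h <= 1 -> Cmod (Cexp h - 1 - h) <= 3 * Cmod h * Cmod h).
  { intros h Hh.
    assert (K := mean_value_bound (fun t => Cexp (RtoC t * h) - RtoC t * h)%C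
      (fun t => h * Cexp (RtoC t * h) - h)%C 0 1 (3 * Cmod h * Cmod h)).
    cbv beta in K. rewrite Cmult_0_l, Cmult_1_l, Cexp_0, Rminus_0_r, Rmult_1_r in K.
    eapply Cmod_le_of_eq; [|apply K]. ring. lra.
    - intros t Ht. apply deriv_minus. apply pderiv_Cexp_ray.
      apply pderiv_ray.
    - intros t Ht.
      assert (Et : Cmod (RtoC t * h) = t * Cmod h) by (rewrite Cmod_mult, Cmod_R, Rabs_pos_eq; lra).
      pose proof (Cmod_ge_0 h).
      replace (h * Cexp (t * h) - h)%C with ((Cexp (t * h) - 1) * h)%C by ring.
      rewrite Cmod_mult. apply Rmult_le_compat_r. apply Cmod_ge_0.
      eapply Rle_trans; [apply Cexp_minus_1; nra|]. nra. }
  intros eps He. pose proof (exp_pos (Re z)).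
  exists (Rmin 1 (eps / (3 * exp (Re z)))). split.
  { apply Rmin_pos; [lra|apply Rdiv_lt_0_compat; lra]. }
  intros w Hw. unfold Cid in *.
  assert (H1 := Rlt_le_trans _ _ _ Hw (Rmin_l _ _)).
  assert (H2 := Rlt_le_trans _ _ _ Hw (Rmin_r _ _)).
  replace (Cexp w) with (Cexp z * Cexp (w - z))%C by (rewrite <- Cexp_plus; f_equal; ring).
  replace (Cexp z * Cexp (w - z) - Cexp z - Cexp z * (w - z))%C
    with (Cexp z * (Cexp (w - z) - 1 - (w - z)))%C by ring.
  rewrite Cmod_mult, Cmod_Cexp.
  eapply Rle_trans; [apply Rmult_le_compat_l; [lra|apply K0; lra]|].
  set (m := Cmod (w - z)) in *. assert (0 <= m) by apply Cmod_ge_0.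
  assert (m * (3 * exp (Re z)) < eps).
  { apply Rmult_lt_reg_r with (/ (3 * exp (Re z))). apply Rinv_0_lt_compat; lra.
    rewrite Rmult_assoc, Rinv_r by lra. unfold Rdiv in H2; lra. }
  nra.
Qed.

Definition cis (t : R) : C := Cexp (Ci * RtoC t).

Lemma cis_alt (t : R) : cis t = (RtoC (cos t) + Ci * RtoC (sin t))%C.
Proof.
  unfold cis, Cexp. replace (Re (Ci * t)) with 0 by (simpl; ring).
  replace (Im (Ci * t)) with t by (simpl; ring). rewrite exp_0. ring.
Qed.

Lemma Cmod_cis (t : R) : Cmod (cis t) = 1.
Proof. rewrite cis_alt. apply Cmod_cos_sin. Qed.

Lemma cis_neq_0 (t : R) : cis t <> 0%C.
Proof. apply Cexp_neq_0. Qed.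

Lemma cis_0 : cis 0 = 1%C.
Proof. unfold cis. rewrite Cmult_0_r. apply Cexp_0. Qed.

Lemma cis_2PI : cis (2 * PI) = 1%C.
Proof. rewrite cis_alt, cos_2PI, sin_2PI. ring. Qed.

Lemma pderiv_cis (t : R) : pderiv cis t (Ci * cis t)%C.
Proof.
  eapply deriv_ext; [reflexivity| |apply (deriv_comp RtoC Cexp (fun t => Ci * RtoC t)%C);
    [apply cderiv_Cexp|apply deriv_scal, deriv_emb]].
  unfold cis. ring.
Qed.

Lemma pcont_cis (t : R) : pcont cis t.
Proof. eapply deriv_cont, pderiv_cis. Qed.

(** * Cauchy's formula on the unit circle; derivatives of entire functions *)

Lemma deriv_ext_loc {D : Type} (emb : D -> C) (X Y : D -> C) (t : D) (v : C) (rho : R) :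
  0 < rho -> (forall s, Cmod (emb s - emb t) < rho -> X s = Y s) ->
  deriv_along emb X t v -> deriv_along emb Y t v.
Proof.
  intros Hr H HX eps He. destruct (HX eps He) as [d [Hd HH]].
  exists (Rmin d rho). split; [now apply Rmin_pos|]. intros s Hs.
  pose proof (Rlt_le_trans _ _ _ Hs (Rmin_l _ _)).
  pose proof (Rlt_le_trans _ _ _ Hs (Rmin_r _ _)).
  rewrite <- !H; auto.
  replace (emb t - emb t)%C with (RtoC 0) by ring. now rewrite Cmod_0.
Qed.

(** The uniformity in [p] is what differentiation under the integral sign asks for. It comes from
    uniform continuity of the derivative along the segment from [p] to [p + v]. *)
Lemma unif_taylor (F f : C -> C) (M eps : R) :
  (forall z, cderiv F z (f z)) -> (forall z, ccont f z) -> 0 < eps ->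
  exists d, 0 < d /\ forall p v, Cmod p <= M -> Cmod v < d ->
    Cmod (F (p + v) - F p - f p * v)%C <= eps * Cmod v.
Proof.
  intros HF Hf He. destruct (unif_cont_disc f M eps Hf He) as [d [Hd H]].
  exists d. split; trivial. intros p v Hp Hv.
  assert (K := mean_value_bound (fun t => F (p + RtoC t * v) - RtoC t * (f p * v))%C
    (fun t => f (p + RtoC t * v) * v - f p * v)%C 0 1 (eps * Cmod v)).
  cbv beta in K. rewrite Rminus_0_r, Rmult_1_r in K.
  eapply Cmod_le_of_eq; [|apply K].
  - rewrite !Cmult_1_l, !Cmult_0_l, Cplus_0_r. ring.
  - lra.
  - intros t Ht. apply deriv_minus.
    + apply (deriv_comp RtoC F (fun t => p + RtoC t * v)%C). apply HF. apply pderiv_line.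
    + apply pderiv_ray.
  - intros t Ht.
    replace (f (p + t * v) * v - f p * v)%C with ((f (p + t * v) - f p) * v)%C by ring.
    rewrite Cmod_mult. apply Rmult_le_compat_r. apply Cmod_ge_0.
    left. apply H; trivial. replace (p + t * v - p)%C with (RtoC t * v)%C by ring.
    rewrite Cmod_mult, Cmod_R, Rabs_pos_eq by lra. pose proof (Cmod_ge_0 v). nra.
Qed.

(** The radius [rho] limits the continuity hypothesis to parameters near [z], since Cauchy kernels
    are continuous in [t] only while the parameter stays inside the circle. *)
Lemma deriv_pint_param (k : C -> R -> C) (k' : R -> C) (z : C) (rho a b : R) :
  a <= b -> 0 < rho ->
  (forall w, Cmod (w - z) < rho -> forall t, pcont (k w) t) -> (forall t, pcont k' t) ->
  (forall eps, 0 < eps -> exists d, 0 < d /\ forall w, Cmod (w - z) < d -> forall t, a <= t <= b ->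
     Cmod (k w t - k z t - k' t * (w - z)) <= eps * Cmod (w - z)) ->
  cderiv (fun w => pint (k w) a b) z (pint k' a b).
Proof.
  intros Hab Hrho Hk Hk' H eps He.
  destruct (H (eps / (b - a + 1))) as [d [Hd HH]]; [apply Rdiv_lt_0_compat; lra|].
  exists (Rmin d rho). split; [now apply Rmin_pos|]. intros w Hw. unfold Cid in *.
  pose proof (Rlt_le_trans _ _ _ Hw (Rmin_l _ _)) as H1.
  pose proof (Rlt_le_trans _ _ _ Hw (Rmin_r _ _)) as H2.
  assert (Hz : forall t, pcont (k z) t).
  { apply Hk. replace (z - z)%C with (RtoC 0) by ring. now rewrite Cmod_0. }
  assert (E : (pint (k w) a b - pint (k z) a b - pint k' a b * (w - z))%C =
    pint (fun t => 1 * (1 * k w t + (-(1)) * k z t) + (- (w - z)) * k' t)%C a b).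
  { rewrite (pint_lin 1%C (- (w - z))%C (fun t => 1 * k w t + (-(1)) * k z t)%C k'); trivial.
    - rewrite pint_lin by auto. ring.
    - intros t. apply cont_plus; apply cont_scal; auto. }
  rewrite E.
  assert (Hm := Cmod_ge_0 (w - z)).
  eapply Rle_trans; [apply (pint_bound _ a b (eps / (b - a + 1) * Cmod (w - z))); trivial|].
  - intros t. repeat (apply cont_plus || apply cont_scal); auto.
  - intros t Ht. cbv beta. eapply Cmod_le_of_eq; [|apply (HH w H1 t Ht)]. ring.
  - apply Rle_trans with (eps / (b - a + 1) * Cmod (w - z) * (b - a + 1)).
    + apply Rmult_le_compat_l; [|lra]. apply Rmult_le_pos; trivial.
      left. apply Rdiv_lt_0_compat; lra.
    + right. field. lra.
Qed.

Lemma cis_away (z : C) (t : R) : Cmod z < 1 -> 1 - Cmod z <= Cmod (cis t - z).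
Proof.
  intros Hz. pose proof (Cmod_triangle (cis t - z) z) as T.
  replace (cis t - z + z)%C with (cis t) in T by ring. rewrite Cmod_cis in T. lra.
Qed.

Lemma cis_minus_neq_0 (z : C) (t : R) : Cmod z < 1 -> (cis t - z)%C <> 0%C.
Proof. intros Hz. apply Cmod_gt_0. pose proof (cis_away z t Hz). lra. Qed.

Lemma pderiv_cis_minus (z : C) (t : R) : pderiv (fun t => cis t - z)%C t (Ci * cis t)%C.
Proof.
  eapply deriv_ext; [reflexivity| |apply deriv_minus; [apply pderiv_cis|apply deriv_const]]. ring.
Qed.

(** The integral of [g(x) / (x - z)^n] over the unit circle, without the factor [1 / (2 PI i)]; the
    index is the exponent of the kernel, so Cauchy's formula is the case 1. *)
Definition cauchy_int (g : C -> C) (n : nat) (z : C) : C :=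
  pint (fun t => g (cis t) * (Ci * cis t) * (/ (cis t - z)) ^ n)%C 0 (2 * PI).

Lemma pcont_pow (X : R -> C) (t : R) (n : nat) : pcont X t -> pcont (fun t => X t ^ n)%C t.
Proof.
  intros H. induction n as [|n IH].
  - exact (cont_const RtoC 1%C t).
  - exact (cont_mult RtoC _ _ t H IH).
Qed.

Lemma pcont_cauchy_kernel (g : C -> C) (n : nat) (z : C) (t : R) :
  (forall w, ccont g w) -> Cmod z < 1 ->
  pcont (fun t => g (cis t) * (Ci * cis t) * (/ (cis t - z)) ^ n)%C t.
Proof.
  intros Hg Hz. apply cont_mult; [apply cont_mult|].
  - apply (cont_comp RtoC g cis). apply Hg. apply pcont_cis.
  - apply cont_scal, pcont_cis.
  - apply pcont_pow. eapply deriv_cont, deriv_inv. now apply cis_minus_neq_0. apply pderiv_cis_minus.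
Qed.

(** Here [w] and [w'] stand for [1 / (x - z)] and [1 / (x - z')] with [h = z' - z], which satisfy
    the resolvent identity in the hypothesis. The constant depends only on a bound for [w] and [w'],
    hence is uniform along the circle. *)
Lemma resolvent_pow_taylor (m : R) (n : nat) : 0 <= m ->
  exists M, 0 <= M /\ forall w w' h : C, Cmod w <= m -> Cmod w' <= m -> (w' - w = h * w * w')%C ->
    Cmod (w' ^ n - w ^ n - RtoC (INR n) * h * w ^ (S n))%C <= M * (Cmod h * Cmod h).
Proof.
  intros Hm. induction n as [|n IH].
  - exists 0. split; [lra|]. intros. simpl.
    eapply Cmod_le_of_eq; [|right; rewrite Rmult_0_l; apply Cmod_0]. ring.
  - destruct IH as [M [HM IH]].
    exists (m * M + INR (S n) * (m ^ (S (S n)) * m)). split.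
    { apply Rplus_le_le_0_compat. nra. apply Rmult_le_pos. apply pos_INR.
      apply Rmult_le_pos; trivial. now apply pow_le. }
    intros w w' h Hw Hw' E. specialize (IH w w' h Hw Hw' E).
    assert (E2 : (w' ^ S n - w ^ S n - RtoC (INR (S n)) * h * w ^ S (S n))%C =
      (w' * (w' ^ n - w ^ n - RtoC (INR n) * h * w ^ S n)
        + RtoC (INR (S n)) * (w ^ (S (S n)) * w') * (h * h))%C).
    { rewrite S_INR, RtoC_plus. simpl Cpow.
      apply Ceq_minus.
      replace (_ - _)%C with ((w' - w - h * w * w') * (w ^ n + RtoC (INR n) * h * (w * w ^ n) + h * (w * w ^ n)))%C by ring.
      rewrite E. ring. }
    rewrite E2. eapply Rle_trans; [apply Cmod_triangle|].
    rewrite !Cmod_mult, Cmod_R, Cmod_pow, Rabs_pos_eq by apply pos_INR.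
    pose proof (Cmod_ge_0 h). pose proof (Cmod_ge_0 w). pose proof (Cmod_ge_0 w').
    assert (0 <= Cmod h * Cmod h) by nra.
    assert (K1 : Cmod w' * Cmod (w' ^ n - w ^ n - RtoC (INR n) * h * w ^ S n) <= m * (M * (Cmod h * Cmod h))).
    { apply Rmult_le_compat; trivial. apply Cmod_ge_0. }
    assert (K2 : Cmod w ^ S (S n) * Cmod w' <= m ^ S (S n) * m).
    { apply Rmult_le_compat; trivial. now apply pow_le. apply pow_incr; lra. }
    assert (K3 : INR (S n) * (Cmod w ^ S (S n) * Cmod w') * (Cmod h * Cmod h) <=
      INR (S n) * (m ^ S (S n) * m) * (Cmod h * Cmod h)).
    { apply Rmult_le_compat_r; trivial. apply Rmult_le_compat_l; trivial. apply pos_INR. }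
    lra.
Qed.

Lemma cderiv_cauchy_int (g : C -> C) (n : nat) (z : C) :
  (forall w, ccont g w) -> Cmod z < 1 ->
  cderiv (cauchy_int g n) z (RtoC (INR n) * cauchy_int g (S n) z)%C.
Proof.
  intros Hg Hz. unfold cauchy_int.
  set (k := fun t => (g (cis t) * (Ci * cis t) * (/ (cis t - z)) ^ (S n))%C).
  assert (Hk : forall t, pcont k t) by (intros; now apply pcont_cauchy_kernel).
  assert (E := pint_lin (RtoC (INR n)) 0%C _ _ 0 (2 * PI) Hk Hk).
  rewrite Cmult_0_l, Cplus_0_r in E. rewrite <- E.
  pose proof PI_RGT_0.
  set (rho := (1 - Cmod z) / 2). assert (Hrho : 0 < rho) by (unfold rho; lra).
  assert (Hin : forall w, Cmod (w - z) < rho -> Cmod w < 1 - rho).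
  { intros w Hw. pose proof (Cmod_triangle (w - z) z) as T.
    replace (w - z + z)%C with w in T by ring. unfold rho in *. lra. }
  apply (deriv_pint_param _ _ z rho); trivial.
  - lra.
  - intros w Hw t. apply pcont_cauchy_kernel; trivial. specialize (Hin w Hw). lra.
  - intros t. apply cont_plus; now apply cont_scal.
  - intros eps He.
    destruct (bounded_disc g 1 Hg) as [B [HB HgB]].
    destruct (resolvent_pow_taylor (/ rho) n) as [M [HM HT]].
    { left; now apply Rinv_0_lt_compat. }
    exists (Rmin rho (eps / (B * (M + 1)))). split.
    { apply Rmin_pos; trivial. apply Rdiv_lt_0_compat; trivial. nra. }
    intros w Hw t Ht.
    pose proof (Rlt_le_trans _ _ _ Hw (Rmin_l _ _)) as H1.
    pose proof (Rlt_le_trans _ _ _ Hw (Rmin_r _ _)) as H2.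
    assert (Hw1 := Hin w H1).
    assert (N1 : (cis t - z)%C <> 0%C) by (apply cis_minus_neq_0; trivial).
    assert (N2 : (cis t - w)%C <> 0%C) by (apply cis_minus_neq_0; lra).
    unfold k.
    replace (g (cis t) * (Ci * cis t) * (/ (cis t - w)) ^ n -
      g (cis t) * (Ci * cis t) * (/ (cis t - z)) ^ n -
      (RtoC (INR n) * (g (cis t) * (Ci * cis t) * (/ (cis t - z)) ^ S n) +
       0 * (g (cis t) * (Ci * cis t) * (/ (cis t - z)) ^ S n)) * (w - z))%C
    with (g (cis t) * (Ci * cis t) *
      ((/ (cis t - w)) ^ n - (/ (cis t - z)) ^ n - RtoC (INR n) * (w - z) * (/ (cis t - z)) ^ S n))%C by ring.
    rewrite !Cmod_mult, Cmod_Ci, Cmod_cis.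
    assert (K := HT (/ (cis t - z))%C (/ (cis t - w))%C (w - z)%C).
    set (q := Cmod (w - z)) in *. assert (0 <= q) by apply Cmod_ge_0.
    assert (K' : Cmod ((/ (cis t - w)) ^ n - (/ (cis t - z)) ^ n - RtoC (INR n) * (w - z) * (/ (cis t - z)) ^ S n) <= M * (q * q)).
    { apply K.
      - rewrite Cmod_inv by trivial. apply Rinv_le_contravar; trivial.
        pose proof (cis_away z t Hz). unfold rho in *. lra.
      - rewrite Cmod_inv by trivial. apply Rinv_le_contravar; trivial.
        pose proof (cis_away w t ltac:(lra)). lra.
      - field. split; trivial. }
    eapply Rle_trans; [apply Rmult_le_compat|].
    + rewrite !Rmult_1_r. apply Cmod_ge_0.
    + apply Cmod_ge_0.
    + rewrite !Rmult_1_r. apply HgB. rewrite Cmod_cis. lra.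
    + apply K'.
    + assert (q * (B * (M + 1)) < eps).
      { apply Rmult_lt_reg_r with (/ (B * (M + 1))). apply Rinv_0_lt_compat; nra.
        rewrite Rmult_assoc, Rinv_r by nra. unfold Rdiv in H2; lra. }
      assert (B * (M * (q * q)) <= q * (B * (M + 1)) * q) by nra. nra.
Qed.

(** The derivative in [z] is the integral of [1 / (x - z)^2], which has the primitive
    [- 1 / (x - z)] on the closed circle and so vanishes. The value is therefore the one at 0, where
    the integrand is constant. *)
Lemma cauchy_int_one (z : C) : Cmod z < 1 -> cauchy_int (fun _ => 1%C) 1 z = (2 * PI * Ci)%C.
Proof.
  intros Hz.
  assert (H1 : forall w, ccont (fun _ => 1%C) w) by (intros; apply cont_const).
  assert (Hd : forall w, Cmod w < 1 -> cderiv (cauchy_int (fun _ => 1%C) 1) w 0%C).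
  { intros w Hw. eapply deriv_ext; [reflexivity| |apply cderiv_cauchy_int; trivial].
    unfold cauchy_int. rewrite (pint_ftc _ (fun t => - / (cis t - w))%C).
    - rewrite cis_2PI, cis_0. ring.
    - intros t. now apply (pcont_cauchy_kernel (fun _ => 1%C) 2 w t).
    - intros t. pose proof (cis_minus_neq_0 w t Hw) as N.
      apply (deriv_ext RtoC (fun t => (-(1)) * / (cis t - w))%C _ t
        ((-(1)) * (- (Ci * cis t) / ((cis t - w) * (cis t - w))))%C).
      + intros s. ring.
      + simpl. field. trivial.
      + apply deriv_scal. apply (deriv_inv RtoC (fun t => cis t - w)%C); trivial.
        apply pderiv_cis_minus. }
  assert (E : cauchy_int (fun _ => 1%C) 1 z = cauchy_int (fun _ => 1%C) 1 0%C).
  { apply Ceq_minus, Cmod_eq_0, Rle_antisym; [|apply Cmod_ge_0].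
    assert (K := mean_value_bound (fun t => cauchy_int (fun _ => 1%C) 1 (0 + RtoC t * z)%C)
      (fun _ => 0%C) 0 1 0).
    cbv beta in K. rewrite Cmult_1_l, Cmult_0_l, !Cplus_0_l, Rmult_0_l in K. apply K.
    - lra.
    - intros t Ht. eapply deriv_ext; [reflexivity| |eapply deriv_comp; [|apply pderiv_line]].
      2: apply Hd. ring. rewrite Cplus_0_l, Cmod_mult, Cmod_R, Rabs_pos_eq by lra.
      pose proof (Cmod_ge_0 z). nra.
    - intros. rewrite Cmod_0. lra. }
  rewrite E. unfold cauchy_int.
  rewrite (pint_ftc _ (fun t => Ci * RtoC t)%C).
  - rewrite RtoC_mult. ring.
  - intros t. apply (pcont_cauchy_kernel (fun _ => 1%C) 1 0%C t); trivial. rewrite Cmod_0; lra.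
  - intros t. eapply deriv_ext; [reflexivity| |apply deriv_scal, deriv_emb].
    simpl. pose proof (cis_neq_0 t). field. replace (cis t - 0)%C with (cis t) by ring. trivial.
Qed.

(* The homotopy [tau |-> z + tau (cis t - z)] contracts the circle to [z];
   the integral does not depend on [tau]. *)
Lemma cauchy_formula (F f : C -> C) (z : C) :
  (forall w, cderiv F w (f w)) -> (forall w, ccont f w) -> Cmod z < 1 ->
  cauchy_int F 1 z = (2 * PI * Ci * F z)%C.
Proof.
  intros HF Hf Hz.
  assert (HFc : forall w, ccont F w) by (intros; eapply deriv_cont, HF).
  pose proof PI_RGT_0 as HPI.
  set (q := fun t => (Ci * cis t * / (cis t - z))%C).
  assert (Hq : forall t, pcont q t).
  { intros t. apply cont_mult. apply cont_scal, pcont_cis.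
    eapply deriv_cont, deriv_inv. now apply cis_minus_neq_0. apply pderiv_cis_minus. }
  assert (Hline : forall tau t, pderiv (fun t => z + tau * (cis t - z))%C t (tau * (Ci * cis t))%C).
  { intros tau t. eapply deriv_ext; [reflexivity| |apply deriv_plus; [apply deriv_const|apply deriv_scal, pderiv_cis_minus]]. ring. }
  set (J := fun tau => pint (fun t => F (z + tau * (cis t - z)) * q t)%C 0 (2 * PI)).
  assert (HJ : forall tau, cderiv J tau 0%C).
  { intros tau.
    assert (Hk' : forall t, pcont (fun t => f (z + tau * (cis t - z)) * (Ci * cis t))%C t).
    { intros t. apply cont_mult; [|apply cont_scal, pcont_cis].
      apply (cont_comp RtoC f (fun t => z + tau * (cis t - z))%C); trivial.
      eapply deriv_cont, Hline. }
    (* The derivative of [J] integrates an exact derivative in [t]: that of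
       [F (z + tau (cis t - z)) / tau] for [tau <> 0], that of [f z * cis t] for [tau = 0]. Both
       take equal values at the two ends of the period. *)
    assert (E : pint (fun t => f (z + tau * (cis t - z)) * (Ci * cis t))%C 0 (2 * PI) = 0%C).
    { destruct (Ceq_dec tau 0%C) as [->|Ht].
      - rewrite (pint_ftc _ (fun t => f z * cis t)%C); trivial.
        + rewrite cis_2PI, cis_0. ring.
        + intros t. eapply deriv_ext; [reflexivity| |apply deriv_scal, pderiv_cis].
          replace (z + 0 * (cis t - z))%C with z by ring. ring.
      - rewrite (pint_ftc _ (fun t => / tau * F (z + tau * (cis t - z)))%C); trivial.
        + rewrite cis_2PI, cis_0. ring.
        + intros t. eapply deriv_ext; [reflexivity| |apply deriv_scal; eapply deriv_comp; [apply HF|apply Hline]].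
          field. trivial. }
    rewrite <- E.
    apply (deriv_pint_param _ _ tau 1); trivial.
    - lra.
    - lra.
    - intros w _ t. apply cont_mult; trivial.
      apply (cont_comp RtoC F (fun t => z + w * (cis t - z))%C); trivial.
      eapply deriv_cont, Hline.
    - intros eps He.
      (* The base points [z + tau (cis t - z)] lie in this disc because [|z| < 1] and
         [|cis t - z| <= 2]. *)
      destruct (unif_taylor F f (1 + Cmod tau * 2) eps HF Hf He) as [d [Hd H]].
      exists (d / 2). split; [lra|]. intros w Hw t _.
      assert (Hcz : Cmod (cis t - z) <= 2).
      { eapply Rle_trans; [apply Cmod_minus_triangle|]. rewrite Cmod_cis. lra. }
      assert (N1 := cis_minus_neq_0 z t Hz).
      assert (Hpos : 0 < Cmod (cis t - z)) by (apply Cmod_gt_0; trivial).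
      specialize (H (z + tau * (cis t - z))%C ((w - tau) * (cis t - z))%C).
      assert (E1 : (F (z + w * (cis t - z)) * q t - F (z + tau * (cis t - z)) * q t -
         f (z + tau * (cis t - z)) * (Ci * cis t) * (w - tau))%C =
       ((F (z + tau * (cis t - z) + (w - tau) * (cis t - z)) - F (z + tau * (cis t - z)) -
         f (z + tau * (cis t - z)) * ((w - tau) * (cis t - z))) * q t)%C).
      { replace (z + tau * (cis t - z) + (w - tau) * (cis t - z))%C with (z + w * (cis t - z))%C by ring.
        unfold q. field. trivial. }
      rewrite E1, Cmod_mult.
      pose proof (Cmod_ge_0 (w - tau)).
      rewrite !Cmod_mult in H.
      eapply Rle_trans; [apply Rmult_le_compat_r; [apply Cmod_ge_0|apply H]|].
      + eapply Rle_trans; [apply Cmod_triangle|]. rewrite Cmod_mult.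
        pose proof (Cmod_ge_0 tau). nra.
      + nra.
      + unfold q. rewrite !Cmod_mult, Cmod_inv, Cmod_Ci, Cmod_cis by trivial.
        right. field. lra. }
  assert (E : J 1%C = J 0%C).
  { apply Ceq_minus, Cmod_eq_0, Rle_antisym; [|apply Cmod_ge_0].
    assert (K := mean_value_bound (fun t => J (RtoC t)) (fun _ => 0%C) 0 1 0).
    cbv beta in K. rewrite Rmult_0_l in K. apply K.
    - lra.
    - intros t Ht. eapply deriv_ext; [reflexivity| |eapply deriv_comp; [apply HJ|apply deriv_emb]]. ring.
    - intros. rewrite Cmod_0. lra. }
  unfold cauchy_int.
  rewrite (pint_ext _ (fun t => F (z + 1 * (cis t - z)) * q t)%C).
  2: { intros t. replace (z + 1 * (cis t - z))%C with (cis t) by ring. unfold q. simpl. ring. }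
  fold (J 1%C). rewrite E. unfold J.
  rewrite (pint_ext _ (fun t => F z * q t + 0 * q t)%C).
  2: { intros t. replace (z + 0 * (cis t - z))%C with z by ring. ring. }
  rewrite pint_lin by trivial.
  assert (E2 : pint q 0 (2 * PI) = (2 * PI * Ci)%C).
  { rewrite <- (cauchy_int_one z Hz). apply pint_ext. intros t. unfold q. simpl. ring. }
  rewrite E2. ring.
Qed.

(** The Cauchy formula above assumes a continuous derivative, which is not yet known for [f] itself.
    It is known for a primitive [F], whose derivative [f] is continuous; so [F] is represented by
    [cauchy_int F 1], and three differentiations of the kernel reach the derivative of [C_derive f].
    This is done at 0 and then translated. *)
Lemma entire_derive (f : C -> C) : entire f -> entire (C_derive f).
Proof.
  assert (at0 : forall f, entire f -> exists l, cderiv (C_derive f) 0%C l).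
  { intros g Hg. destruct (entire_primitive g Hg) as [F HF].
    assert (HFc : forall w, ccont F w) by (intros; eapply deriv_cont, HF).
    assert (Hgc := entire_cont g Hg).
    set (c := (/ (2 * PI * Ci))%C).
    assert (Hc : (2 * PI * Ci)%C <> 0%C).
    { apply Cmult_neq_0; [|apply Ci_nz]. rewrite <- RtoC_mult. intro A. apply RtoC_inj in A.
      pose proof PI_RGT_0; lra. }
    assert (open_disc : forall w, Cmod w < 1 -> forall s, Cmod (Cid s - Cid w) < 1 - Cmod w -> Cmod s < 1).
    { intros w Hw s Hs. unfold Cid in Hs. pose proof (Cmod_triangle (s - w) w) as T.
      replace (s - w + w)%C with s in T by ring. lra. }
    assert (E0 : forall w, Cmod w < 1 -> F w = (c * cauchy_int F 1 w)%C).
    { intros w Hw. rewrite (cauchy_formula F g w) by trivial. unfold c. field.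
      split. apply Ci_nz. intro A. apply RtoC_inj in A. pose proof PI_RGT_0; lra. }
    assert (E1 : forall w, Cmod w < 1 -> g w = (c * cauchy_int F 2 w)%C).
    { intros w Hw. rewrite <- (cderiv_unique F w (g w) (HF w)). apply cderiv_unique.
      apply (deriv_ext_loc Cid (fun w => c * cauchy_int F 1 w)%C F w _ (1 - Cmod w)).
      - lra.
      - intros s Hs. symmetry. eapply E0, open_disc; eauto.
      - eapply deriv_ext; [reflexivity| |apply deriv_scal, cderiv_cauchy_int; trivial]. simpl. ring. }
    assert (E2 : forall w, Cmod w < 1 -> C_derive g w = (c * (2 * cauchy_int F 3 w))%C).
    { intros w Hw. apply cderiv_unique.
      apply (deriv_ext_loc Cid (fun w => c * cauchy_int F 2 w)%C g w _ (1 - Cmod w)).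
      - lra.
      - intros s Hs. symmetry. eapply E1, open_disc; eauto.
      - eapply deriv_ext; [reflexivity| |apply deriv_scal, cderiv_cauchy_int; trivial].
        simpl INR. replace (1 + 1) with 2 by ring. ring. }
    exists (c * (2 * (RtoC (INR 3) * cauchy_int F 4 0)))%C.
    apply (deriv_ext_loc Cid (fun w => c * (2 * cauchy_int F 3 w))%C _ _ _ 1).
    - lra.
    - intros s Hs. symmetry. apply E2. unfold Cid in Hs.
      replace s with (s - 0)%C by ring. trivial.
    - apply deriv_scal, deriv_scal, cderiv_cauchy_int; trivial. rewrite Cmod_0; lra. }
  intros Hf a.
  assert (Hsh : forall z b : C, cderiv (fun z => z + b)%C z 1%C).
  { intros z b. eapply deriv_ext; [reflexivity| |apply (deriv_plus Cid Cid); [apply deriv_emb|apply deriv_const]]. ring. }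
  assert (Hfa : forall z, cderiv (fun z => f (z + a))%C z (C_derive f (z + a))).
  { intros z. eapply deriv_ext; [reflexivity| |eapply (deriv_comp Cid f (fun z => z + a)%C); [apply (proj1 (entire_cderiv f) Hf)|apply Hsh]]. ring. }
  destruct (at0 (fun z => f (z + a))%C (entire_intro _ _ Hfa)) as [l Hl].
  exists l. apply cderiv_is_derive.
  assert (K : cderiv (fun z => C_derive (fun z => f (z + a))%C (z + - a))%C a (l * 1)%C).
  { apply (deriv_comp Cid (C_derive (fun z => f (z + a))%C) (fun z => z + - a)%C); [|apply Hsh].
    replace (a + - a)%C with (RtoC 0) by ring. trivial. }
  revert K. apply deriv_ext.
  - intros s. rewrite (cderiv_unique _ _ _ (Hfa _)). f_equal. ring.
  - ring.
Qed.

(** * Division by z *)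

(** This is [(f z - f 0) / z], with value [f'(0)] at 0. Written as an integral it is entire by
    differentiation under the integral sign, so that no removable singularity has to be treated. *)
Definition quot (f : C -> C) (z : C) : C := pint (fun t => C_derive f (RtoC t * z))%C 0 1.

Lemma quot_spec (f : C -> C) (z : C) : entire f -> f z = (f 0 + z * quot f z)%C.
Proof.
  intros Hf. pose proof (entire_cont _ (entire_derive f Hf)) as Hc.
  assert (Hp : forall t, pcont (fun t => C_derive f (RtoC t * z)%C) t).
  { intros t. apply (cont_comp RtoC (C_derive f) (fun t => RtoC t * z)%C); trivial.
    eapply deriv_cont, pderiv_ray. }
  unfold quot. assert (E := pint_lin z 0%C _ _ 0 1 Hp Hp). rewrite Cmult_0_l, Cplus_0_r in E.
  rewrite <- E.
  rewrite (pint_ftc _ (fun t => f (0 + RtoC t * z))%C).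
  - rewrite Cmult_0_l, Cmult_1_l, !Cplus_0_l. ring.
  - intros. apply cont_plus; now apply cont_scal.
  - intros t. eapply deriv_ext; [reflexivity| |eapply deriv_comp; [apply (proj1 (entire_cderiv f) Hf)|apply pderiv_line]].
    rewrite Cplus_0_l. ring.
Qed.

Lemma entire_quot (f : C -> C) : entire f -> entire (quot f).
Proof.
  intros Hf z. pose proof (entire_derive f Hf) as Hf1. pose proof (entire_derive _ Hf1) as Hf2.
  pose proof (entire_cont _ Hf1) as Hc1. pose proof (entire_cont _ Hf2) as Hc2.
  assert (Hl : forall z t, pcont (fun t => RtoC t * z)%C t).
  { intros w t. eapply deriv_cont, pderiv_ray. }
  exists (pint (fun t => C_derive (C_derive f) (RtoC t * z) * RtoC t)%C 0 1).
  apply cderiv_is_derive. apply (deriv_pint_param _ _ z 1); try lra.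
  - intros w _ t. apply (cont_comp RtoC (C_derive f) (fun t => RtoC t * w)%C); trivial.
  - intros t. apply cont_mult; [|eapply deriv_cont, deriv_emb].
    apply (cont_comp RtoC (C_derive (C_derive f)) (fun t => RtoC t * z)%C); trivial.
  - intros eps He.
    destruct (unif_taylor (C_derive f) (C_derive (C_derive f)) (Cmod z) eps) as [d [Hd H]]; trivial.
    { apply entire_cderiv; trivial. }
    exists d. split; trivial. intros w Hw t Ht.
    specialize (H (RtoC t * z)%C (RtoC t * (w - z))%C).
    rewrite !Cmod_mult, !Cmod_R, !Rabs_pos_eq in H by lra.
    pose proof (Cmod_ge_0 z). pose proof (Cmod_ge_0 (w - z)).
    eapply Rle_trans; [eapply Cmod_le_of_eq; [|apply H; nra]|].
    + replace (t * z + t * (w - z))%C with (RtoC t * w)%C by ring. ring.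
    + apply Rmult_le_compat_l; nra.
Qed.

(** * Closure properties of entire functions *)

Lemma entire_const (c : C) : entire (fun _ => c).
Proof. apply (entire_intro _ (fun _ => 0%C)). intros; apply deriv_const. Qed.

Lemma entire_id : entire (fun z => z).
Proof. apply (entire_intro _ (fun _ => 1%C)). intros; apply (deriv_emb Cid). Qed.

Lemma entire_plus (f g : C -> C) : entire f -> entire g -> entire (fun z => f z + g z)%C.
Proof.
  intros Hf Hg. rewrite entire_cderiv in Hf, Hg. eapply entire_intro. intros z. now apply deriv_plus.
Qed.

Lemma entire_minus (f g : C -> C) : entire f -> entire g -> entire (fun z => f z - g z)%C.
Proof.
  intros Hf Hg. rewrite entire_cderiv in Hf, Hg. eapply entire_intro. intros z. now apply deriv_minus.
Qed.

Lemma entire_mult (f g : C -> C) : entire f -> entire g -> entire (fun z => f z * g z)%C.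
Proof.
  intros Hf Hg. rewrite entire_cderiv in Hf, Hg. eapply entire_intro. intros z. now apply deriv_mult.
Qed.

Lemma entire_comp (f g : C -> C) : entire f -> entire g -> entire (fun z => f (g z)).
Proof.
  intros Hf Hg. rewrite entire_cderiv in Hf, Hg. eapply entire_intro. intros z.
  eapply deriv_comp. apply Hf. apply Hg.
Qed.

Lemma entire_pow (n : nat) : entire (fun z => z ^ n)%C.
Proof. eapply entire_intro. intros z. apply (deriv_pow Cid Cid), deriv_emb. Qed.

Lemma entire_Cexp : entire Cexp.
Proof. eapply entire_intro. apply cderiv_Cexp. Qed.

(** * Limits at infinity and Abel summation *)

Definition clim (X : R -> C) (l : C) : Prop :=
  forall eps : R, 0 < eps -> exists W : R, forall t : R, W <= t -> Cmod (X t - l) < eps.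

Lemma clim_filterlim (X : R -> C) (l : C) :
  clim X l <-> filterlim X (Rbar_locally p_infty) (locally (T := C_R_NormedModule) l).
Proof.
  split.
  - intros H. apply filterlim_locally. intros eps. destruct (H eps (cond_pos eps)) as [W HW].
    exists W. intros t Ht. apply C_NormedModule_mixin_compat1. apply HW. lra.
  (* Balls in the product metric bound the coordinates; halving [eps] absorbs the factor [sqrt 2]
     lost in passing to [Cmod]. *)
  - intros H eps He. apply filterlim_locally with (eps := mkposreal (eps / 2) ltac:(lra)) in H.
    destruct H as [W HW]. exists (W + 1). intros t Ht.
    specialize (HW t ltac:(lra)). apply C_NormedModule_mixin_compat2 in HW. simpl in HW.
    eapply Rlt_le_trans; [apply HW|].
    assert (sqrt 2 < 2).
    { apply Rsqr_incrst_0; try lra. rewrite Rsqr_sqrt by lra. unfold Rsqr; lra. apply sqrt_pos. }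
    nra.
Qed.

Lemma clim_cauchy (X : R -> C) :
  (forall eps, 0 < eps -> exists W, forall s t, W <= s <= t -> Cmod (X t - X s) < eps) ->
  exists l, clim X l.
Proof.
  intros H.
  destruct (proj1 (filterlim_locally_cauchy (U := C_R_CompleteNormedModule)
    (F := Rbar_locally p_infty) X)) as [l Hl].
  - intros eps. destruct (H eps (cond_pos eps)) as [W HW].
    exists (fun t => W < t). split. exists W; auto.
    intros s t Hs Ht. apply C_NormedModule_mixin_compat1.
    change (Cmod (X t - X s) < eps).
    destruct (Rle_dec s t); [|rewrite Cmod_minus_sym]; apply HW; lra.
  - exists l. now apply clim_filterlim.
Qed.

Lemma clim_ext (X Y : R -> C) (l : C) (W : R) :
  (forall t, W <= t -> X t = Y t) -> clim X l -> clim Y l.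
Proof.
  intros E H eps He. destruct (H eps He) as [V HV]. exists (Rmax V W). intros t Ht.
  rewrite <- E. apply HV. eapply Rle_trans; [apply Rmax_l|apply Ht].
  eapply Rle_trans; [apply Rmax_r|apply Ht].
Qed.

Lemma clim_plus (X Y : R -> C) (l l' : C) :
  clim X l -> clim Y l' -> clim (fun t => X t + Y t)%C (l + l')%C.
Proof.
  intros H H' eps He. destruct (H (eps / 2)) as [W HW]; [lra|].
  destruct (H' (eps / 2)) as [W' HW']; [lra|]. exists (Rmax W W'). intros t Ht.
  specialize (HW t (Rle_trans _ _ _ (Rmax_l _ _) Ht)).
  specialize (HW' t (Rle_trans _ _ _ (Rmax_r _ _) Ht)).
  eapply Rle_lt_trans; [eapply Cmod_le_of_eq; [|apply (Cmod_triangle (X t - l) (Y t - l'))]; ring|]. lra.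
Qed.

Lemma clim_scal (c : C) (X : R -> C) (l : C) : clim X l -> clim (fun t => c * X t)%C (c * l)%C.
Proof.
  intros H eps He. pose proof (Cmod_ge_0 c).
  destruct (H (eps / (Cmod c + 1))) as [W HW]; [apply Rdiv_lt_0_compat; lra|].
  exists W. intros t Ht. specialize (HW t Ht).
  replace (c * X t - c * l)%C with (c * (X t - l))%C by ring. rewrite Cmod_mult.
  pose proof (Cmod_ge_0 (X t - l)).
  assert (Cmod (X t - l) * (Cmod c + 1) < eps).
  { apply Rmult_lt_reg_r with (/ (Cmod c + 1)). apply Rinv_0_lt_compat; lra.
    rewrite Rmult_assoc, Rinv_r by lra. unfold Rdiv in HW; lra. }
  nra.
Qed.

Lemma is_derive_pow_S (n : nat) (t : R) : is_derive (fun t => t ^ S n) t (INR (S n) * t ^ n).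
Proof. apply is_derive_Reals. exact (derivable_pt_lim_pow t (S n)). Qed.

Lemma is_derive_exp_pow (a : R) (n : nat) (t : R) :
  is_derive (fun t => exp (- (a * t ^ S n))) t (- (a * (INR (S n) * t ^ n)) * exp (- (a * t ^ S n))).
Proof.
  apply (is_derive_comp exp (fun t => - (a * t ^ S n))).
  - apply is_derive_Reals, derivable_pt_lim_exp.
  - apply (is_derive_opp (V := R_NormedModule)). apply is_derive_scal, is_derive_pow_S.
Qed.

(** On the ray [w = t cis alpha] the factor [exp (- delta w^N)] has this form with
    [c = cis (N alpha)]; on the positive real axis [c = 1]. *)
Definition damping (delta : R) (c : C) (N : nat) (t : R) : C := Cexp (RtoC (- (delta * t ^ N)) * c).

Lemma Cmod_damping (delta : R) (c : C) (N : nat) (t : R) :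
  Cmod (damping delta c N t) = exp (- (delta * Re c * t ^ N)).
Proof. unfold damping. rewrite Cmod_Cexp, re_scal_l. f_equal. ring. Qed.

Lemma pderiv_damping (delta : R) (c : C) (n : nat) (t : R) :
  pderiv (damping delta c (S n)) t
    (RtoC (- (delta * (INR (S n) * t ^ n))) * c * damping delta c (S n) t)%C.
Proof.
  eapply deriv_ext; [reflexivity| |eapply (deriv_comp RtoC Cexp (fun t => RtoC (- (delta * t ^ S n)) * c)%C);
    [apply cderiv_Cexp|]].
  2: { eapply (deriv_mult RtoC (fun t => RtoC (- (delta * t ^ S n))) (fun _ => c)); [|apply deriv_const].
    apply (pderiv_RtoC (fun t => - (delta * t ^ S n)) t (- (delta * (INR (S n) * t ^ n)))).
    apply (is_derive_opp (V := R_NormedModule)). apply is_derive_scal, is_derive_pow_S. }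
  unfold damping. ring.
Qed.

(** Integration by parts: with [E] the damping factor, [X = V - (p - l) E] has derivative
    [- (p - l) E']. Up to a fixed [rho] this is of the order of [delta]; beyond it [p - l] is small
    and [E] has total variation at most [|c| / Re c]. As [V] is any primitive, the lemma applies to
    restrictions to a ray of functions on the plane. *)
Lemma abel_summation (p p' : R -> C) (l c : C) (n : nat) (eps : R) :
  (forall t, pderiv p t (p' t)) -> clim p l -> 0 < Re c -> 0 < eps ->
  exists del0, 0 < del0 /\ forall delta, 0 < delta < del0 -> exists W0, forall V : R -> C,
    (forall t, pderiv V t (p' t * damping delta c (S n) t)%C) ->
    forall W, W0 <= W -> Cmod (V W - V 0 - (l - p 0))%C <= eps.
Proof.
  intros Hp Hl Hc He.
  assert (Hcc : Re c <= Cmod c) by (eapply Rle_trans; [apply Rle_abs|apply re_le_Cmod]).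
  (* Chosen so that [eta] times the variation bound [|c| / Re c] equals [eps / 4]. *)
  set (eta := eps * Re c / (4 * Cmod c)).
  assert (Heta : 0 < eta) by (apply Rdiv_lt_0_compat; nra).
  assert (Eeta : eta * Cmod c / Re c = eps / 4) by (unfold eta; field; lra).
  assert (Heta' : eta <= eps / 4).
  { rewrite <- Eeta. apply Rmult_le_reg_r with (Re c); trivial.
    replace (eta * Cmod c / Re c * Re c) with (eta * Cmod c) by (field; lra). nra. }
  destruct (Hl eta Heta) as [rho0 Hrho0].
  set (rho := Rmax rho0 1).
  assert (Hrho : 1 <= rho) by apply Rmax_r.
  assert (Hq : forall t, rho <= t -> Cmod (p t - l) <= eta).
  { intros t Ht. left. apply Hrho0. eapply Rle_trans; [apply Rmax_l|apply Ht]. }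
  (* Composition with [Re] turns the bound on discs into one on the interval from 0 to [rho]. *)
  destruct (bounded_disc (fun z => p (Re z) - l)%C rho) as [M [HM HB]].
  { intros z e Hee. destruct (deriv_cont _ _ _ _ (Hp (Re z)) e Hee) as [d [Hd H]].
    exists d. split; trivial. intros s Hs. unfold Cid in Hs.
    replace (p (Re s) - l - (p (Re z) - l))%C with (p (Re s) - p (Re z))%C by ring.
    apply H. rewrite <- RtoC_minus, Cmod_R. eapply Rle_lt_trans; [|apply Hs].
    eapply Rle_trans; [|apply re_le_Cmod]. right. unfold Cminus. rewrite re_plus, re_opp. reflexivity. }
  assert (HBt : forall t, 0 <= t <= rho -> Cmod (p t - l) <= M).
  { intros t Ht. specialize (HB (RtoC t)). rewrite re_RtoC in HB. apply HB.
    rewrite Cmod_R, Rabs_pos_eq; lra. }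
  assert (Hrn : 0 < rho ^ S n) by (apply pow_lt; lra).
  assert (Hden : 0 < 4 * (M * Cmod c * rho ^ S n + 1)).
  { assert (0 < M * Cmod c) by nra. nra. }
  exists (eps / (4 * (M * Cmod c * rho ^ S n + 1))).
  split; [now apply Rdiv_lt_0_compat|].
  intros delta [Hd1 Hd2]. exists rho. intros V HV W HW.
  set (E := damping delta c (S n)) in *.
  set (X := fun t => (V t - (p t - l) * E t)%C).
  set (X' := fun t => (- ((p t - l) * (RtoC (- (delta * (INR (S n) * t ^ n))) * c * E t)))%C).
  assert (HX : forall t, pderiv X t (X' t)).
  { intros t. eapply deriv_ext; [reflexivity| |apply deriv_minus; [apply HV|apply deriv_mult;
      [apply deriv_minus; [apply Hp|apply deriv_const]|apply pderiv_damping]]].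
    unfold X', E. ring. }
  assert (HX' : forall t, 0 <= t -> Cmod (X' t) =
     Cmod (p t - l) * (Cmod c * (delta * (INR (S n) * t ^ n) * exp (- (delta * Re c * t ^ S n))))).
  { intros t Ht. unfold X'. rewrite Cmod_opp, !Cmod_mult, Cmod_R. unfold E. rewrite Cmod_damping.
    rewrite Rabs_Ropp, Rabs_pos_eq. ring.
    apply Rmult_le_pos; [lra|]. apply Rmult_le_pos. apply pos_INR. now apply pow_le. }
  assert (Hnn : forall t, 0 <= t -> 0 <= delta * (INR (S n) * t ^ n)).
  { intros t Ht. apply Rmult_le_pos; [lra|]. apply Rmult_le_pos. apply pos_INR. now apply pow_le. }
  assert (K1 : Cmod (X rho - X 0)%C <= eps / 4).
  { eapply Rle_trans; [apply (mean_value_ineq X X' (fun t => M * Cmod c * delta * t ^ S n)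
      (fun t => M * Cmod c * delta * (INR (S n) * t ^ n)))|].
    - lra.
    - intros; apply HX.
    - intros t Ht. apply is_derive_scal, is_derive_pow_S.
    - intros t Ht. rewrite HX' by lra.
      assert (exp (- (delta * Re c * t ^ S n)) <= 1).
      { rewrite <- exp_0. (destruct (Req_dec (delta * Re c * t ^ S n) 0) as [->|N];
          [rewrite Ropp_0; lra|left; apply exp_increasing]).
        assert (0 <= delta * Re c * t ^ S n) by (apply Rmult_le_pos; [nra|apply pow_le; lra]). lra. }
      pose proof (exp_pos (- (delta * Re c * t ^ S n))).
      specialize (Hnn t ltac:(lra)). specialize (HBt t Ht).
      replace (M * Cmod c * delta * (INR (S n) * t ^ n)) with (M * (Cmod c * (delta * (INR (S n) * t ^ n)))) by ring.
      pose proof (Cmod_ge_0 c).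
      apply Rmult_le_compat; trivial. apply Cmod_ge_0.
      apply Rmult_le_pos; trivial. apply Rmult_le_pos; lra.
      apply Rmult_le_compat_l; trivial. nra.
    - replace (0 ^ S n) with 0 by (simpl; ring).
      assert (delta * (4 * (M * Cmod c * rho ^ S n + 1)) < eps).
      { apply Rmult_lt_reg_r with (/ (4 * (M * Cmod c * rho ^ S n + 1))). now apply Rinv_0_lt_compat.
        rewrite Rmult_assoc, Rinv_r by lra. unfold Rdiv in Hd2; lra. }
      lra. }
  assert (K2 : Cmod (X W - X rho)%C <= eps / 4).
  { eapply Rle_trans; [apply (mean_value_ineq X X' (fun t => - (eta * Cmod c / Re c) * exp (- (delta * Re c * t ^ S n)))
      (fun t => eta * (Cmod c * (delta * (INR (S n) * t ^ n) * exp (- (delta * Re c * t ^ S n))))))|].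
    - lra.
    - intros; apply HX.
    - intros t Ht.
      replace (eta * (Cmod c * (delta * (INR (S n) * t ^ n) * exp (- (delta * Re c * t ^ S n)))))
        with (- (eta * Cmod c / Re c) *
          (- (delta * Re c * (INR (S n) * t ^ n)) * exp (- (delta * Re c * t ^ S n)))) by (field; lra).
      apply is_derive_scal, is_derive_exp_pow.
    - intros t Ht. rewrite HX' by lra. apply Rmult_le_compat_r.
      + apply Rmult_le_pos. apply Cmod_ge_0. apply Rmult_le_pos. apply Hnn; lra. left; apply exp_pos.
      + apply Hq. lra.
    - rewrite Eeta. pose proof (exp_pos (- (delta * Re c * W ^ S n))).
      assert (exp (- (delta * Re c * rho ^ S n)) <= 1).
      { rewrite <- exp_0. left; apply exp_increasing. assert (0 < delta * Re c) by nra. nra. }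
      nra. }
  assert (K3 : Cmod ((p W - l) * E W) <= eps / 4).
  { rewrite Cmod_mult. unfold E. rewrite Cmod_damping.
    assert (exp (- (delta * Re c * W ^ S n)) <= 1).
    { rewrite <- exp_0. left; apply exp_increasing. assert (0 < delta * Re c) by nra.
      assert (0 < W ^ S n) by (apply pow_lt; lra). nra. }
    pose proof (exp_pos (- (delta * Re c * W ^ S n))).
    specialize (Hq W HW). pose proof (Cmod_ge_0 (p W - l)). nra. }
  assert (E0 : E 0 = 1%C).
  { unfold E, damping. replace (- (delta * 0 ^ S n)) with 0 by (simpl; ring).
    rewrite Cmult_0_l. apply Cexp_0. }
  replace (V W - V 0 - (l - p 0))%C with ((X W - X rho) + (X rho - X 0) + (p W - l) * E W)%C.
  - eapply Rle_trans; [apply Cmod_triangle3|]. lra.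
  - unfold X. rewrite E0. ring.
Qed.

(** * Rotating the path of integration *)

Lemma cis_plus (s t : R) : cis (s + t) = (cis s * cis t)%C.
Proof. unfold cis. rewrite <- Cexp_plus. f_equal. rewrite RtoC_plus. ring. Qed.

Lemma cis_INR (n : nat) (t : R) : (cis t ^ n)%C = cis (INR n * t).
Proof. unfold cis. rewrite <- Cexp_INR. f_equal. rewrite RtoC_mult. ring. Qed.

Lemma Re_cis (t : R) : Re (cis t) = cos t.
Proof. rewrite cis_alt. simpl. ring. Qed.

Lemma Im_cis (t : R) : Im (cis t) = sin t.
Proof. rewrite cis_alt. simpl. ring. Qed.

Lemma cis_PI : cis PI = (- (1))%C.
Proof. rewrite cis_alt, cos_PI, sin_PI. change (-1) with (- (1)). rewrite RtoC_opp. ring. Qed.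

Lemma pderiv_polar (r alpha t : R) :
  pderiv (fun t => RtoC r * cis (alpha * t))%C t (RtoC r * (RtoC alpha * (Ci * cis (alpha * t))))%C.
Proof.
  apply deriv_scal.
  eapply deriv_ext; [intros s; reflexivity| |
    apply (deriv_comp RtoC Cexp (fun t => Ci * RtoC (alpha * t))%C); [apply cderiv_Cexp|apply deriv_scal]].
  2: { apply (pderiv_RtoC (fun t => alpha * t) t alpha). auto_derive; trivial. ring. }
  unfold cis. ring.
Qed.

Lemma exp_le (x y : R) : x <= y -> exp x <= exp y.
Proof. intros [H| ->]; [left; now apply exp_increasing|right; reflexivity]. Qed.

(** With [X = W ^ n] the exponent is at most [- 2 X] as soon as [c W >= sigma + 2]. One factor
    [exp (- X)] absorbs [X], the other is at most [/ W]. *)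
Lemma pow_exp_decay (sigma c W : R) (n : nat) :
  0 <= sigma -> 0 < c -> (1 <= n)%nat -> 1 <= W -> (sigma + 2) / c <= W ->
  W ^ n * exp (sigma * W ^ n - c * W ^ S n) <= / W.
Proof.
  intros Hs Hc Hn HW HW2.
  assert (H1 : sigma + 2 <= c * W).
  { apply Rmult_le_reg_r with (/ c). now apply Rinv_0_lt_compat.
    replace (c * W * / c) with W by (field; lra). exact HW2. }
  assert (HWn : W <= W ^ n).
  { rewrite <- (pow_1 W) at 1. apply Rle_pow; trivial. }
  set (X := W ^ n) in *.
  assert (Hle : sigma * X - c * W ^ S n <= - X - X) by (simpl; fold X; nra).
  apply Rle_trans with (X * (exp (- X) * exp (- X))).
  { apply Rmult_le_compat_l; [lra|]. rewrite <- exp_plus. apply exp_le. lra. }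
  assert (HX : X * exp (- X) <= 1).
  { rewrite exp_Ropp. apply Rmult_le_reg_r with (exp X). apply exp_pos.
    rewrite Rmult_assoc, Rinv_l by (pose proof (exp_pos X); lra).
    pose proof (exp_ineq1_le X). lra. }
  assert (HX2 : exp (- X) <= / W).
  { rewrite exp_Ropp. apply Rinv_le_contravar; [lra|].
    pose proof (exp_ineq1_le X). lra. }
  pose proof (exp_pos (- X)). nra.
Qed.

Lemma cos_decr_abs (x y : R) : Rabs x <= Rabs y -> Rabs y <= PI -> cos y <= cos x.
Proof.
  intros H1 H2.
  assert (E : forall u, cos u = cos (Rabs u)).
  { intros u. unfold Rabs. destruct (Rcase_abs u); [now rewrite cos_neg|reflexivity]. }
  rewrite (E x), (E y). pose proof (Rabs_pos x). apply cos_decr_1; lra.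
Qed.

(* The substitution [z = w ^ n] makes the convergence factor
   [exp (- delta z^(1 + 1/n))] entire; for large [n] it beats every exponential
   in sectors of half-opening close to [PI / 2]. *)
Definition damped (k : C -> C) (n : nat) (delta : R) (w : C) : C :=
  (k (w ^ n) * (RtoC (INR n) * w ^ (pred n) * Cexp (RtoC (- delta) * w ^ S n)))%C.

Lemma entire_damped (k : C -> C) (n : nat) (delta : R) : entire k -> entire (damped k n delta).
Proof.
  intros Hk. unfold damped. apply entire_mult.
  - apply (entire_comp k (fun w => w ^ n)%C); trivial. apply entire_pow.
  - apply entire_mult. apply entire_mult. apply entire_const. apply entire_pow.
    apply (entire_comp Cexp (fun w => RtoC (- delta) * w ^ S n)%C). apply entire_Cexp.
    apply entire_mult. apply entire_const. apply entire_pow.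
Qed.

Lemma polar_pow (r t : R) (n : nat) : ((RtoC r * cis t) ^ n)%C = (RtoC (r ^ n) * cis (INR n * t))%C.
Proof. rewrite Cpow_mult_l, <- RtoC_pow, cis_INR. reflexivity. Qed.

(** In the variable [w] the arc from [W] to [W cis alpha] contributes [O(1 / W)], because
    [Re (w ^ S n)] stays positive on the wedge and order [n + 1] beats [exp (sigma |w|^n)]. The
    damped integral on the positive axis thus agrees in the limit with the one on the ray, which
    Abel summation evaluates through [l], the limit of [P] there. No behaviour of [P] on the real
    axis is assumed. *)
Lemma wedge_rotation (k P : C -> C) (n : nat) (alpha A sigma : R) (l : C) (eps : R) :
  (1 <= n)%nat -> (forall z, cderiv P z (k z)) -> Rabs (INR (S n) * alpha) < PI / 2 ->
  0 <= A -> 0 <= sigma ->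
  (forall r t, 1 <= r -> 0 <= t <= 1 ->
     Cmod (k (RtoC (r ^ n) * cis (INR n * (alpha * t)))%C) <= A * exp (sigma * r ^ n)) ->
  clim (fun r => P (RtoC (r ^ n) * cis (INR n * alpha))%C) l -> 0 < eps ->
  exists del0, 0 < del0 /\ forall delta, 0 < delta < del0 -> forall V : C -> C,
    (forall w, cderiv V w (damped k n delta w)) ->
    exists W0, forall W, W0 <= W -> Cmod (V (RtoC W) - V 0 - (l - P 0))%C <= eps.
Proof.
  intros Hn HP Halpha HA Hsig Hk Hl He.
  set (c := cis (INR (S n) * alpha)).
  assert (Hc : 0 < Re c).
  { unfold c. rewrite Re_cis. apply Rabs_def2 in Halpha. apply cos_gt_0; lra. }
  set (p := fun r => P (RtoC (r ^ n) * cis (INR n * alpha))%C).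
  set (ray := fun r => (RtoC r * cis alpha)%C).
  assert (Hray : forall r, pderiv ray r (cis alpha)) by (intros; apply pderiv_ray).
  assert (Ep : forall r, p r = P (ray r ^ n)%C) by (intros; unfold ray; now rewrite polar_pow).
  assert (Hp : forall r, pderiv p r (k (ray r ^ n) * (RtoC (INR n) * ray r ^ pred n * cis alpha))%C).
  { intros r. apply (deriv_ext RtoC (fun r => P (ray r ^ n)%C) p r
      (k (ray r ^ n) * (RtoC (INR n) * ray r ^ pred n * cis alpha))%C); auto.
    apply (deriv_comp RtoC P (fun r => ray r ^ n)%C). apply HP. apply deriv_pow, Hray. }
  destruct (abel_summation p _ l c n (eps / 2) Hp Hl Hc ltac:(lra)) as [del0 [Hd0 HAbel]].
  exists del0. split; trivial. intros delta Hdelta V HV.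
  destruct (HAbel delta Hdelta) as [W1 HW1]. specialize (HW1 (fun r => V (ray r))).
  assert (HVray : forall W, W1 <= W -> Cmod (V (ray W) - V 0 - (l - P 0))%C <= eps / 2).
  { intros W HW. assert (E0 : ray 0 = 0%C) by (unfold ray; ring).
    assert (Ep0 : p 0 = P 0%C).
    { rewrite Ep, E0. destruct n; [lia|]. rewrite Cpow_S, Cmult_0_l. reflexivity. }
    cbv beta in HW1. rewrite E0, Ep0 in HW1. apply HW1; trivial.
    intros r. eapply deriv_ext; [reflexivity| |eapply deriv_comp; [apply HV|apply Hray]].
    unfold damped, damping.
    replace (RtoC (- (delta * r ^ S n)) * c)%C with (RtoC (- delta) * ray r ^ S n)%C. ring.
    unfold ray, c. rewrite polar_pow, !RtoC_opp, RtoC_mult. ring. }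
  set (c0 := cos (INR (S n) * alpha)).
  assert (Hc0 : 0 < c0) by (unfold c in Hc; rewrite Re_cis in Hc; exact Hc).
  set (B := A * INR n * Rabs alpha).
  assert (HB : 0 <= B).
  { unfold B. apply Rmult_le_pos; [apply Rmult_le_pos; trivial; apply pos_INR|apply Rabs_pos]. }
  assert (Harc : forall W, 1 <= W -> (sigma + 2) / (delta * c0) <= W ->
    Cmod (V (ray W) - V (RtoC W))%C <= B * / W).
  { intros W H1 H2.
    assert (K := mean_value_bound (fun t => V (RtoC W * cis (alpha * t))%C)
      (fun t => damped k n delta (RtoC W * cis (alpha * t)) * (RtoC W * (RtoC alpha * (Ci * cis (alpha * t)))))%C
      0 1 (B * / W)).
    cbv beta in K. rewrite Rmult_0_r, Rmult_1_r, cis_0, Cmult_1_r, Rminus_0_r, Rmult_1_r in K.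
    apply K; clear K.
    - lra.
    - intros t _. apply (deriv_comp RtoC V (fun t => RtoC W * cis (alpha * t))%C). apply HV. apply pderiv_polar.
    - intros t Ht. unfold damped. rewrite !Cmod_mult, Cmod_Cexp, Cmod_pow, Cmod_mult, !Cmod_cis, Cmod_Ci, !Cmod_R.
      rewrite (Rabs_pos_eq W), (Rabs_pos_eq (INR n)), !Rmult_1_r by (try apply pos_INR; lra).
      rewrite !polar_pow.
      specialize (Hk W t H1 Ht).
      assert (HRe : Re (RtoC (- delta) * (RtoC (W ^ S n) * cis (INR (S n) * (alpha * t)))) <= - (delta * c0 * W ^ S n)).
      { rewrite re_scal_l, re_scal_l, Re_cis.
        (* The cosine is smallest on the final ray [t = 1], so its value there serves the whole
           arc. *)
        assert (c0 <= cos (INR (S n) * (alpha * t))).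
        { apply cos_decr_abs; [|pose proof PI_RGT_0; lra]. rewrite <- Rmult_assoc, Rabs_mult, (Rabs_pos_eq t) by lra.
          pose proof (Rabs_pos (INR (S n) * alpha)). nra. }
        assert (0 < W ^ S n) by (apply pow_lt; lra).
        assert (0 < delta * W ^ S n) by nra. nra. }
      apply exp_le in HRe.
      pose proof (pow_exp_decay sigma (delta * c0) W n Hsig ltac:(nra) Hn H1 H2) as Hdec.
      assert (EW : W ^ pred n * W = W ^ n) by (destruct n; [lia|simpl; ring]).
      set (K := Cmod (k (RtoC (W ^ n) * cis (INR n * (alpha * t))))%C) in *.
      set (Ex := exp (Re _)) in *.
      replace (K * (INR n * W ^ pred n * Ex) * (W * Rabs alpha)) with
        (K * (INR n * Rabs alpha * (W ^ n) * Ex)) by (rewrite <- EW; ring).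
      assert (Hq : 0 <= INR n * Rabs alpha * W ^ n).
      { apply Rmult_le_pos; [apply Rmult_le_pos; [apply pos_INR|apply Rabs_pos]|apply pow_le; lra]. }
      assert (0 < Ex) by apply exp_pos.
      apply Rle_trans with (A * exp (sigma * W ^ n) * (INR n * Rabs alpha * W ^ n * exp (- (delta * c0 * W ^ S n)))).
      + apply Rmult_le_compat; trivial. apply Cmod_ge_0. apply Rmult_le_pos; lra.
        apply Rmult_le_compat_l; trivial.
      + replace (A * exp (sigma * W ^ n) * (INR n * Rabs alpha * W ^ n * exp (- (delta * c0 * W ^ S n))))
          with (B * (W ^ n * exp (sigma * W ^ n - delta * c0 * W ^ S n))).
        * apply Rmult_le_compat_l; trivial.
        * unfold B, Rminus. rewrite exp_plus. ring. }
  exists (Rmax (Rmax W1 1) (Rmax ((sigma + 2) / (delta * c0)) (2 * B / eps))).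
  intros W HW.
  assert (G1 : W1 <= W) by (eapply Rle_trans; [|apply HW]; eapply Rle_trans; [apply Rmax_l|apply Rmax_l]).
  assert (G2 : 1 <= W) by (eapply Rle_trans; [|apply HW]; eapply Rle_trans; [apply Rmax_r|apply Rmax_l]).
  assert (G3 : (sigma + 2) / (delta * c0) <= W) by (eapply Rle_trans; [|apply HW]; eapply Rle_trans; [apply Rmax_l|apply Rmax_r]).
  assert (G4 : 2 * B / eps <= W) by (eapply Rle_trans; [|apply HW]; eapply Rle_trans; [apply Rmax_r|apply Rmax_r]).
  specialize (HVray W G1). specialize (Harc W G2 G3).
  assert (B * / W <= eps / 2).
  { apply Rmult_le_reg_r with W; [lra|]. rewrite Rmult_assoc, Rinv_l by lra.
    apply Rmult_le_reg_r with (2 / eps). apply Rdiv_lt_0_compat; lra.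
    replace (eps / 2 * W * (2 / eps)) with W by (field; lra).
    replace (B * 1 * (2 / eps)) with (2 * B / eps) by (field; lra). trivial. }
  replace (V (RtoC W) - V 0 - (l - P 0))%C with
    ((V (ray W) - V 0 - (l - P 0)) - (V (ray W) - V (RtoC W)))%C by ring.
  eapply Rle_trans; [apply Cmod_minus_triangle|]. lra.
Qed.

(* Both rays at angles [th] and [PI - th], with [sin th > sigma / lambda], lie
   where [k] is integrable; the Abel means on the two half-lines are rotated to
   these rays, and an arc joining the rays contributes nothing. *)
Lemma symmetric_integral_zero (k P : C -> C) (A B sigma lambda : R) (l : C) :
  entire k -> (forall z, cderiv P z (k z)) -> 0 < sigma < lambda -> 0 <= A -> 0 <= B ->
  (forall z, 0 <= Im z -> 1 <= Cmod z ->
     Cmod (k z) <= A * exp (sigma * Cmod z - lambda * Im z) + B / (Cmod z * Cmod z)) ->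
  clim (fun r => P (RtoC r) - P (- RtoC r))%C l -> l = 0%C.
Proof.
  intros Hk HP Hsl HA HB Hbound Hl.
  pose proof PI_RGT_0 as HPI.
  (* The midpoint of [sigma / lambda] and 1: above the first, so that [lambda sin th - sigma] leaves
     the decay rate [a], and below 1, so that [th < PI / 2]. *)
  set (x0 := (1 + sigma / lambda) / 2).
  assert (Hx0 : sigma / lambda < x0 < 1 /\ 0 < sigma / lambda).
  { assert (0 < sigma / lambda) by (apply Rdiv_lt_0_compat; lra).
    assert (sigma / lambda < 1).
    { apply Rmult_lt_reg_r with lambda; [lra|]. unfold Rdiv. rewrite Rmult_assoc, Rinv_l; lra. }
    unfold x0; lra. }
  set (th := asin x0).
  assert (Hsin : sin th = x0) by (apply sin_asin; lra).
  assert (Hth : 0 < th < PI / 2).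
  { split.
    - apply Rnot_le_lt. intro Hle. pose proof (asin_bound x0 : - (PI / 2) <= th <= PI / 2).
      assert (sin th <= sin 0) by (apply sin_incr_1; lra). rewrite sin_0 in *. lra.
    - apply asin_bound_lt; lra. }
  assert (Ha : sigma < lambda * x0).
  { replace sigma with (lambda * (sigma / lambda)) by (field; lra). apply Rmult_lt_compat_l; lra. }
  set (a := lambda * x0 - sigma).
  assert (Ha' : 0 < a) by (unfold a; lra).
  assert (sin_ge : forall t, th <= t <= PI - th -> x0 <= sin t).
  { intros t Ht. rewrite <- Hsin. destruct (Rle_dec t (PI / 2)).
    - apply sin_incr_1; lra.
    - rewrite <- (sin_PI_x t). apply sin_incr_1; lra. }
  assert (polar_bound : forall r t, 1 <= r -> 0 <= t <= PI ->
    Cmod (k (RtoC r * cis t)%C) <= A * exp (sigma * r - lambda * (r * sin t)) + B / (r * r)).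
  { intros r t Hr Ht. specialize (Hbound (RtoC r * cis t)%C).
    rewrite Cmod_mult, Cmod_cis, Cmod_R, Rmult_1_r, Rabs_pos_eq, im_scal_l, Im_cis in Hbound by lra.
    apply Hbound; trivial. apply Rmult_le_pos; [lra|]. apply sin_ge_0; lra. }
  assert (mid_bound : forall r t, 1 <= r -> th <= t <= PI - th ->
    Cmod (k (RtoC r * cis t)%C) <= A * exp (- (a * r)) + B / (r * r)).
  { intros r t Hr Ht. eapply Rle_trans; [apply polar_bound; lra|].
    apply Rplus_le_compat_r, Rmult_le_compat_l; trivial. apply exp_le.
    specialize (sin_ge t Ht). unfold a.
    assert (lambda * (r * x0) <= lambda * (r * sin t)) by (apply Rmult_le_compat_l; [lra|apply Rmult_le_compat_l; lra]).
    lra. }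
  (* The first quantity bounds the tail from [r] of an integral of [k] along a ray in the middle
     sector, the second its integral over the arc of radius [r] there. *)
  assert (small : forall eps, 0 < eps -> exists W, 1 <= W /\ forall r, W <= r ->
     A / a * exp (- (a * r)) + B / r < eps /\ r * PI * (A * exp (- (a * r)) + B / (r * r)) < eps).
  { intros eps He.
    (* A crude total of the constants left after [exp (- (a r))] is replaced by [1 / (a r)] in the
       first quantity and by [4 / (a r)^2] in the second. *)
    set (Q := 8 * (A / (a * a) + B + A * PI / (a * a) + B * PI)).
    assert (HQ1 : 0 <= A / (a * a)) by (apply Rmult_le_pos; [lra|left; apply Rinv_0_lt_compat; nra]).
    assert (HQ2 : 0 <= A * PI / (a * a)).
    { apply Rmult_le_pos; [nra|left; apply Rinv_0_lt_compat; nra]. }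
    assert (HQ3 : 0 <= B * PI) by nra.
    exists (Rmax 1 (Q / eps + 1)). split; [apply Rmax_l|]. intros r Hr.
    assert (G1 : 1 <= r) by (eapply Rle_trans; [apply Rmax_l|apply Hr]).
    assert (G2 : Q / eps + 1 <= r) by (eapply Rle_trans; [apply Rmax_r|apply Hr]).
    assert (HQr : Q < eps * r).
    { apply Rmult_lt_reg_r with (/ eps). now apply Rinv_0_lt_compat.
      replace (eps * r * / eps) with r by (field; lra). unfold Rdiv in G2. lra. }
    assert (Hex1 : exp (- (a * r)) <= / (a * r)).
    { rewrite exp_Ropp. apply Rinv_le_contravar. nra. pose proof (exp_ineq1_le (a * r)). nra. }
    assert (Hex2 : exp (- (a * r)) <= 4 * / (a * r * (a * r))).
    { replace (- (a * r)) with (- (a * r / 2) + - (a * r / 2)) by field. rewrite exp_plus.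
      assert (Hh : exp (- (a * r / 2)) <= 2 * / (a * r)).
      { rewrite exp_Ropp. replace (2 * / (a * r)) with (/ (a * r / 2)) by (field; split; nra).
        apply Rinv_le_contravar. nra. pose proof (exp_ineq1_le (a * r / 2)). nra. }
      pose proof (exp_pos (- (a * r / 2))).
      replace (4 * / (a * r * (a * r))) with (2 * / (a * r) * (2 * / (a * r))) by (field; split; nra).
      apply Rmult_le_compat; lra. }
    split.
    - apply Rmult_lt_reg_r with r; [lra|].
      assert (A / a * exp (- (a * r)) * r <= A / (a * a)).
      { replace (A / (a * a)) with (A / a * / (a * r) * r) by (field; split; nra).
        apply Rmult_le_compat_r; [lra|]. apply Rmult_le_compat_l; trivial.
        apply Rmult_le_pos; [lra|left; now apply Rinv_0_lt_compat]. }
      replace ((A / a * exp (- (a * r)) + B / r) * r) with (A / a * exp (- (a * r)) * r + B) by (field; lra).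
      unfold Q in *. lra.
    - apply Rmult_lt_reg_r with r; [lra|].
      assert (A * PI * exp (- (a * r)) * (r * r) <= 4 * (A * PI / (a * a))).
      { replace (4 * (A * PI / (a * a))) with (A * PI * (4 * / (a * r * (a * r))) * (r * r)) by (field; split; nra).
        apply Rmult_le_compat_r; [nra|]. apply Rmult_le_compat_l; trivial. nra. }
      replace (r * PI * (A * exp (- (a * r)) + B / (r * r)) * r) with
        (A * PI * exp (- (a * r)) * (r * r) + B * PI) by (field; lra).
      unfold Q in *. lra. }
  destruct (clim_cauchy (fun r => P (RtoC r * cis th)%C)) as [L HL].
  { intros eps He. destruct (small eps He) as [W [HW1 HW]]. exists W. intros s t Hst.
    eapply Rle_lt_trans; [apply (mean_value_ineq (fun r => P (RtoC r * cis th)%C)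
      (fun r => k (RtoC r * cis th) * cis th)%C
      (fun r => - (A / a) * exp (- (a * r)) - B * / r) (fun r => A * exp (- (a * r)) + B / (r * r)) s t)|].
    - lra.
    - intros r _. apply (deriv_comp RtoC P (fun r => RtoC r * cis th)%C). apply HP. apply pderiv_ray.
    - intros r Hr. auto_derive. lra. field. split; lra.
    - intros r Hr. rewrite Cmod_mult, Cmod_cis, Rmult_1_r. apply mid_bound; lra.
    - destruct (HW s ltac:(lra)) as [K _].
      assert (0 <= A / a * exp (- (a * t))).
      { apply Rmult_le_pos; [apply Rmult_le_pos; [lra|left; now apply Rinv_0_lt_compat]|left; apply exp_pos]. }
      assert (0 <= B * / t) by (apply Rmult_le_pos; [lra|left; apply Rinv_0_lt_compat; lra]).
      unfold Rdiv in *. lra. }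
  (* The arc joining the two rays lies in the region of [mid_bound] and contributes at most the
     second quantity of [small]; hence both rays have the same limit. *)
  assert (HL' : clim (fun r => P (RtoC r * cis (PI - th))%C) L).
  { intros eps He. destruct (HL (eps / 2)) as [W1 HW1]; [lra|].
    destruct (small (eps / 2)) as [W2 [H21 HW2]]; [lra|].
    exists (Rmax W1 W2). intros r Hr.
    assert (G1 : W1 <= r) by (eapply Rle_trans; [apply Rmax_l|apply Hr]).
    assert (G2 : W2 <= r) by (eapply Rle_trans; [apply Rmax_r|apply Hr]).
    specialize (HW1 r G1). destruct (HW2 r G2) as [_ K2].
    assert (K := mean_value_bound (fun t => P (RtoC r * cis (1 * t))%C)
      (fun t => k (RtoC r * cis (1 * t)) * (RtoC r * (RtoC 1 * (Ci * cis (1 * t)))))%C th (PI - th)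
      (r * (A * exp (- (a * r)) + B / (r * r)))).
    cbv beta in K. rewrite !Rmult_1_l in K.
    assert (K' : Cmod (P (RtoC r * cis (PI - th)) - P (RtoC r * cis th))%C <=
       r * (A * exp (- (a * r)) + B / (r * r)) * (PI - th - th)).
    { apply K; clear K.
      - lra.
      - intros t _. apply (deriv_comp RtoC P (fun t => RtoC r * cis (1 * t))%C). apply HP. apply pderiv_polar.
      - intros t Ht. rewrite !Cmod_mult, !Cmod_cis, Cmod_Ci, !Cmod_R, !Rmult_1_l, !Rmult_1_r.
        rewrite Rabs_pos_eq, Rabs_R1 by lra. rewrite Rmult_1_r, Rmult_comm.
        apply Rmult_le_compat_l; [lra|]. apply mid_bound; lra. }
    assert (0 <= A * exp (- (a * r)) + B / (r * r)).
    { apply Rplus_le_le_0_compat. apply Rmult_le_pos; [lra|left; apply exp_pos].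
      apply Rmult_le_pos; [lra|left; apply Rinv_0_lt_compat; nra]. }
    pose proof (Cmod_triangle_minus (P (RtoC r * cis (PI - th))%C) (P (RtoC r * cis th)%C) L).
    assert (r * (A * exp (- (a * r)) + B / (r * r)) * (PI - th - th) <=
      r * PI * (A * exp (- (a * r)) + B / (r * r))).
    { replace (r * PI * (A * exp (- (a * r)) + B / (r * r))) with
       (r * (A * exp (- (a * r)) + B / (r * r)) * PI) by ring.
      apply Rmult_le_compat_l; [|lra]. apply Rmult_le_pos; lra. }
    lra. }
  (* The inequality [n > th / (PI / 2 - th)] is equivalent to [(n + 1) th / n < PI / 2], the
     condition for damping up to the ray [th]. *)
  destruct (nfloor_ex (th / (PI / 2 - th))) as [n0 [_ Hn0]].
  { apply Rmult_le_pos; [lra|left; apply Rinv_0_lt_compat; lra]. }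
  set (n := S n0).
  assert (Hn : (1 <= n)%nat) by (unfold n; lia).
  assert (HnR : 0 < INR n) by (apply lt_0_INR; lia).
  set (alpha := th / INR n).
  assert (Ena : INR n * alpha = th) by (unfold alpha; field; lra).
  assert (Hna : Rabs (INR (S n) * alpha) < PI / 2).
  { rewrite S_INR, Rmult_plus_distr_r, Ena, Rmult_1_l.
    assert (0 < alpha) by (apply Rdiv_lt_0_compat; lra).
    rewrite Rabs_pos_eq by lra.
    assert (alpha < PI / 2 - th); [|lra].
    unfold alpha. apply Rmult_lt_reg_r with (INR n / (PI / 2 - th)).
    { apply Rdiv_lt_0_compat; lra. }
    replace (th / INR n * (INR n / (PI / 2 - th))) with (th / (PI / 2 - th)) by (field; lra).
    replace ((PI / 2 - th) * (INR n / (PI / 2 - th))) with (INR n) by (field; lra).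
    unfold n. rewrite S_INR. trivial. }
  assert (pow_ge : forall r, 1 <= r -> r <= r ^ n).
  { intros r Hr. rewrite <- (pow_1 r) at 1. apply Rle_pow; trivial. }
  assert (clim_pow : forall X l, clim X l -> clim (fun r => X (r ^ n)) l).
  { intros X l' HX eps He. destruct (HX eps He) as [W HW]. exists (Rmax 1 W). intros t Ht. apply HW.
    assert (1 <= t) by (eapply Rle_trans; [apply Rmax_l|apply Ht]).
    assert (W <= t) by (eapply Rle_trans; [apply Rmax_r|apply Ht]).
    specialize (pow_ge t ltac:(trivial)). lra. }
  assert (gen_bound : forall r t, 1 <= r -> 0 <= t <= PI ->
    Cmod (k (RtoC r * cis t)%C) <= (A + B) * exp (sigma * r)).
  { intros r t Hr Ht. eapply Rle_trans; [apply polar_bound; trivial|].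
    assert (exp (sigma * r - lambda * (r * sin t)) <= exp (sigma * r)).
    { apply exp_le. assert (0 <= r * sin t) by (apply Rmult_le_pos; [lra|apply sin_ge_0; lra]). nra. }
    assert (1 <= exp (sigma * r)). { rewrite <- exp_0. apply exp_le. nra. }
    assert (/ (r * r) <= 1).
    { rewrite <- Rinv_1. apply Rinv_le_contravar; nra. }
    unfold Rdiv. nra. }
  assert (neg_polar : forall r t, (- (RtoC r * cis t))%C = (RtoC r * cis (PI + t))%C).
  { intros. rewrite cis_plus, cis_PI. ring. }
  apply Cmod_eq_0, Rle_antisym; [|apply Cmod_ge_0]. apply Rnot_lt_le. intro Hneg.
  (* In the end [l] is a signed sum of three errors of size at most [eps], which contradicts
     [|l| = 4 eps]. *)
  set (eps := Cmod l / 4). assert (He : 0 < eps) by (unfold eps; lra).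
  destruct (wedge_rotation k P n alpha (A + B) sigma L eps) as [d1 [Hd1 H1]]; trivial; try lra.
  { intros r t Hr Ht. rewrite <- Rmult_assoc, Ena. apply gen_bound.
    eapply Rle_trans; [apply Hr|now apply pow_ge]. nra. }
  { rewrite Ena. exact (clim_pow _ _ HL). }
  assert (HPn : forall z, cderiv (fun z => (- (1)) * P (- z))%C z (k (- z)%C)).
  { intros z. eapply deriv_ext; [reflexivity| |apply deriv_scal, (deriv_comp Cid P (fun z => - z)%C); [apply HP|]].
    2: { apply (deriv_ext Cid (fun z => (- (1)) * Cid z)%C (fun z => - z)%C z (- (1) * 1)%C).
         intros; unfold Cid; ring. reflexivity. apply deriv_scal, deriv_emb. }
    ring. }
  (* The negative half-line is the positive one for [k (- z)], and the angle [- alpha] sends [- w^n]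
     to the ray [PI - th], still in the upper half-plane. The primitive is [- P (- z)], so the limit
     is [- L] and cancels that of the first rotation. *)
  destruct (wedge_rotation (fun z => k (- z)%C) (fun z => (- (1)) * P (- z))%C n (- alpha) (A + B) sigma
    (- (1) * L)%C eps) as [d2 [Hd2 H2]]; trivial; try lra.
  { rewrite <- Ropp_mult_distr_r, Rabs_Ropp. trivial. }
  { intros r t Hr Ht. rewrite neg_polar.
    replace (PI + INR n * (- alpha * t)) with (PI - th * t) by (rewrite <- Ena; ring).
    apply gen_bound. eapply Rle_trans; [apply Hr|now apply pow_ge].
    assert (0 <= th * t <= PI / 2) by nra. lra. }
  { apply clim_scal.
    eapply (clim_ext (fun r => P (RtoC (r ^ n) * cis (PI - th))%C) _ _ 0); [|exact (clim_pow _ _ HL')].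
    intros r _. rewrite neg_polar. f_equal. f_equal. f_equal. rewrite <- Ena. ring. }
  (* After [z = r ^ n] the two damped integrals add up, on the real axis, to an Abel mean with
     [c = 1] of the convergent symmetric integral. Their sum is therefore close to [l], while the
     rotated evaluations make it close to 0. *)
  set (g := fun r => (P (RtoC r) - P (- RtoC r))%C).
  set (gp := fun r => (P (RtoC r ^ n) + (- (1)) * P (- (RtoC r ^ n)))%C).
  assert (Hgp : forall r, pderiv gp r
    ((k (RtoC r ^ n) + k (- (RtoC r ^ n))) * (RtoC (INR n) * RtoC r ^ pred n * 1))%C).
  { intros r. pose proof (deriv_pow RtoC RtoC r 1%C n (deriv_emb RtoC r)) as Dp.
    eapply deriv_ext; [reflexivity| |apply deriv_plus;
      [apply (deriv_comp RtoC P (fun r => RtoC r ^ n)%C); [apply HP|apply Dp]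
      |apply (deriv_comp RtoC (fun z => (- (1)) * P (- z))%C (fun r => RtoC r ^ n)%C); [apply HPn|apply Dp]]].
    ring. }
  assert (Hgl : clim gp l).
  { eapply (clim_ext (fun r => g (r ^ n)) gp l 0); [|exact (clim_pow _ _ Hl)].
    intros r _. unfold g, gp. rewrite RtoC_pow. ring. }
  destruct (abel_summation gp _ l 1%C n eps Hgp Hgl ltac:(simpl; lra) He) as [d3 [Hd3 H3]].
  set (delta := Rmin d1 (Rmin d2 d3) / 2).
  assert (Hm : 0 < Rmin d1 (Rmin d2 d3)) by (repeat apply Rmin_pos; trivial).
  assert (Hm1 := Rmin_l d1 (Rmin d2 d3)). assert (Hm2 := Rmin_r d1 (Rmin d2 d3)).
  assert (Hm3 := Rmin_l d2 d3). assert (Hm4 := Rmin_r d2 d3).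
  assert (Hkn : entire (fun z => k (- z)%C)).
  { apply (entire_comp k (fun z => - z)%C); trivial.
    apply (entire_intro _ (fun _ => (-(1))%C)). intros z.
    apply (deriv_ext Cid (fun z => (- (1)) * Cid z)%C (fun z => - z)%C z (- (1) * 1)%C).
    intros; unfold Cid; ring. ring. apply deriv_scal, deriv_emb. }
  destruct (entire_primitive _ (entire_damped k n delta Hk)) as [V1 HV1].
  destruct (entire_primitive _ (entire_damped _ n delta Hkn)) as [V2 HV2].
  destruct (H1 delta ltac:(unfold delta; lra) V1 HV1) as [W1 G1].
  destruct (H2 delta ltac:(unfold delta; lra) V2 HV2) as [W2 G2].
  destruct (H3 delta ltac:(unfold delta; lra)) as [W3 G3].
  specialize (G3 (fun r => V1 (RtoC r) + V2 (RtoC r))%C).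
  set (W := Rmax W1 (Rmax W2 W3)).
  specialize (G1 W (Rmax_l _ _)).
  specialize (G2 W (Rle_trans _ _ _ (Rmax_l _ _) (Rmax_r _ _))).
  assert (G3' : Cmod (V1 (RtoC W) + V2 (RtoC W) - (V1 0 + V2 0) - (l - gp 0))%C <= eps).
  { apply G3; [|apply (Rle_trans _ _ _ (Rmax_r W2 W3) (Rmax_r _ _))].
    intros r. eapply deriv_ext; [reflexivity| |apply deriv_plus;
      (eapply deriv_comp; [first [apply HV1|apply HV2]|apply deriv_emb])].
    unfold damped, damping.
    replace (RtoC (- (delta * r ^ S n)) * 1)%C with (RtoC (- delta) * RtoC r ^ S n)%C. ring.
    rewrite <- RtoC_pow, !RtoC_opp, RtoC_mult. ring. }
  assert (E0 : gp 0 = 0%C).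
  { unfold gp, n. rewrite Cpow_S, Cmult_0_l, Copp_0. ring. }
  rewrite E0 in G3'. rewrite Copp_0 in G2.
  replace l with ((V1 (RtoC W) - V1 0 - (L - P 0)) + (V2 (RtoC W) - V2 0 - (- (1) * L - - (1) * P 0))
    - (V1 (RtoC W) + V2 (RtoC W) - (V1 0 + V2 0) - (l - 0)))%C in Hneg by ring.
  assert (Hfin : Cmod ((V1 (RtoC W) - V1 0 - (L - P 0)) + (V2 (RtoC W) - V2 0 - (- (1) * L - - (1) * P 0))
    - (V1 (RtoC W) + V2 (RtoC W) - (V1 0 + V2 0) - (l - 0)))%C <= 3 * eps).
  { eapply Rle_trans; [apply Cmod_minus_triangle|].
    eapply Rle_trans; [apply Rplus_le_compat_r, Cmod_triangle|]. lra. }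
  replace ((V1 (RtoC W) - V1 0 - (L - P 0)) + (V2 (RtoC W) - V2 0 - (- (1) * L - - (1) * P 0))
    - (V1 (RtoC W) + V2 (RtoC W) - (V1 0 + V2 0) - (l - 0)))%C with l in * by ring.
  unfold eps in Hfin. lra.
Qed.

(** * Taylor coefficients *)

Definition csum (a : nat -> C) (n : nat) : C := sum_n (G := C_AbelianMonoid) a n.

Lemma csum_O (a : nat -> C) : csum a 0 = a O.
Proof. apply sum_O. Qed.

Lemma csum_S (a : nat -> C) (n : nat) : csum a (S n) = (csum a n + a (S n))%C.
Proof. apply (sum_Sn (G := C_AbelianMonoid)). Qed.

Lemma csum_first (a : nat -> C) (n : nat) : csum a (S n) = (a O + csum (fun k => a (S k)) n)%C.
Proof.
  induction n as [|n IH].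
  - now rewrite csum_S, !csum_O.
  - rewrite csum_S, IH, csum_S. ring.
Qed.

Lemma csum_ext (a b : nat -> C) (n : nat) : (forall k, (k <= n)%nat -> a k = b k) -> csum a n = csum b n.
Proof. apply sum_n_ext_loc. Qed.

Lemma csum_scal (c : C) (a : nat -> C) (n : nat) : csum (fun k => c * a k)%C n = (c * csum a n)%C.
Proof.
  induction n as [|n IH]. now rewrite !csum_O. rewrite !csum_S, IH. ring.
Qed.

Lemma csum_pairs (a : nat -> C) (m : nat) :
  csum a (2 * m + 1) = csum (fun k => a k + a (2 * m + 1 - k)%nat)%C m.
Proof.
  revert a. induction m as [|m IH]; intros a.
  - simpl. rewrite csum_S, !csum_O. reflexivity.
  - replace (2 * S m + 1)%nat with (S (S (2 * m + 1))) by lia.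
    rewrite csum_S, csum_first, IH, csum_first.
    rewrite (csum_ext (fun k => a (S k) + a (S (S (2 * m + 1)) - S k)%nat)%C
      (fun k => a (S k) + a (S (2 * m + 1 - k))%nat)%C).
    + rewrite Nat.sub_0_r. ring.
    + intros k Hk. do 2 f_equal. lia.
Qed.

Lemma csum_even (a : nat -> C) (m : nat) :
  (forall k, (k <= 2 * m)%nat -> Nat.Odd k -> a k = 0%C) -> csum a (2 * m) = csum (fun l => a (2 * l)%nat) m.
Proof.
  intros H. induction m as [|m IH]. now rewrite !csum_O.
  replace (2 * S m)%nat with (S (S (2 * m))) by lia.
  rewrite !csum_S, IH, (H (S (2 * m))).
  - replace (2 * S m)%nat with (S (S (2 * m))) by lia. ring.
  - lia.
  - exists m; lia.
  - intros k Hk. apply H. lia.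
Qed.

Lemma csum_RtoC (a : nat -> R) (n : nat) :
  RtoC (sum_n (G := R_AbelianMonoid) a n) = csum (fun k => RtoC (a k)) n.
Proof.
  induction n as [|n IH]. now rewrite csum_O, sum_O.
  rewrite csum_S, (sum_Sn (G := R_AbelianMonoid)), <- IH. apply RtoC_plus.
Qed.

Lemma RtoC_neq_0 (x : R) : x <> 0 -> RtoC x <> 0%C.
Proof. intros H A. apply RtoC_inj in A. auto. Qed.

Lemma ccont_eq_0 (f g : C -> C) :
  ccont f 0%C -> ccont g 0%C -> (forall z : C, z <> 0%C -> f z = g z) -> f 0%C = g 0%C.
Proof.
  intros Hf Hg E. apply Ceq_minus, Cmod_eq_0, Rle_antisym; [|apply Cmod_ge_0].
  apply Rnot_lt_le. intro A.
  destruct (Hf (Cmod (f 0 - g 0)%C / 2)) as [d [Hd H]]; [lra|].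
  destruct (Hg (Cmod (f 0 - g 0)%C / 2)) as [d' [Hd' H']]; [lra|].
  assert (Hm : 0 < Rmin d d') by now apply Rmin_pos.
  set (z := RtoC (Rmin d d' / 2)).
  assert (Hz : Cmod (Cid z - Cid 0)%C = Rmin d d' / 2).
  { unfold Cid, z. rewrite <- RtoC_minus, Cmod_R, Rminus_0_r, Rabs_pos_eq; lra. }
  pose proof (Rmin_l d d'). pose proof (Rmin_r d d').
  specialize (H z ltac:(lra)). specialize (H' z ltac:(lra)).
  rewrite E in H by (apply RtoC_neq_0; lra).
  pose proof (Cmod_triangle_minus (f 0%C) (g z) (g 0%C)).
  rewrite (Cmod_minus_sym (f 0%C) (g z)) in *. lra.
Qed.

(** * Iterated division by z *)

(** Off 0 the equation determines [g], at 0 continuity does. The rules for [tail] under linear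
    combinations, reflection and products come from exhibiting such a decomposition, not from the
    integral that defines [quot]. *)
Lemma quot_unique (f g : C -> C) (c : C) :
  entire f -> entire g -> (forall z : C, f z = c + z * g z)%C -> quot f = g.
Proof.
  intros Hf Hg E.
  assert (E0 : f 0%C = c) by (rewrite E; ring).
  assert (En : forall z : C, z <> 0%C -> quot f z = g z).
  { intros z Hz. pose proof (quot_spec f z Hf) as S. rewrite E, E0 in S.
    replace (quot f z) with ((c + z * quot f z - c) / z)%C by (field; trivial).
    rewrite <- S. field. trivial. }
  apply functional_extensionality. intros z. destruct (Ceq_dec z 0%C) as [->|Hz]; auto.
  apply ccont_eq_0; trivial; apply entire_cont; trivial. now apply entire_quot.
Qed.

(** This is [f] minus its Taylor polynomial of degree below [n], divided by [z^n]; in other words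
    [f / z^n] without its polar part. *)
Fixpoint tail (n : nat) (f : C -> C) : C -> C :=
  match n with
  | O => f
  | S n => tail n (quot f)
  end.

Definition tcoef (n : nat) (f : C -> C) : C := tail n f 0%C.

Lemma entire_tail (n : nat) (f : C -> C) : entire f -> entire (tail n f).
Proof. revert f. induction n; intros f Hf; simpl; auto using entire_quot. Qed.

Lemma tail_S (n : nat) (f : C -> C) : tail (S n) f = quot (tail n f).
Proof. revert f. induction n; intros f. reflexivity. apply IHn. Qed.

Lemma tail_spec (n : nat) (f : C -> C) (z : C) : entire f ->
  tail n f z = (tcoef n f + z * tail (S n) f z)%C.
Proof. intros Hf. rewrite tail_S. apply quot_spec. now apply entire_tail. Qed.

Lemma entire_scal (c : C) (f : C -> C) : entire f -> entire (fun z => c * f z)%C.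
Proof. apply entire_mult, entire_const. Qed.

Lemma tail_lin (n : nat) (c d : C) (f g : C -> C) : entire f -> entire g ->
  tail n (fun z => c * f z + d * g z)%C = (fun z => c * tail n f z + d * tail n g z)%C.
Proof.
  revert f g. induction n as [|n IH]; intros f g Hf Hg. reflexivity.
  simpl. rewrite <- IH by now apply entire_quot. f_equal.
  apply (quot_unique _ _ (c * f 0 + d * g 0)%C).
  - apply entire_plus; now apply entire_scal.
  - apply entire_plus; apply entire_scal; now apply entire_quot.
  - intros z. rewrite (quot_spec f z Hf), (quot_spec g z Hg). ring.
Qed.

(** The two claims share one induction, since linearity of [tail] needs the partial sum to be
    entire. *)
Lemma tail_csum (n N : nat) (c : nat -> C) (f : nat -> C -> C) : (forall k, entire (f k)) ->
  entire (fun z => csum (fun k => c k * f k z)%C N) /\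
  tail n (fun z => csum (fun k => c k * f k z)%C N) = (fun z => csum (fun k => c k * tail n (f k) z)%C N).
Proof.
  intros Hf.
  assert (E0 : forall g : nat -> C -> C, (fun z => csum (fun k => c k * g k z)%C O) = (fun z => c O * g O z)%C).
  { intros g. apply functional_extensionality. intros; apply csum_O. }
  assert (ES : forall M (g : nat -> C -> C), (fun z => csum (fun k => c k * g k z)%C (S M))
     = (fun z => 1 * csum (fun k => c k * g k z)%C M + c (S M) * g (S M) z)%C).
  { intros M g. apply functional_extensionality. intros; rewrite csum_S; ring. }
  induction N as [|N [IH1 IH2]].
  - rewrite !E0. split. now apply entire_scal.
    replace (fun z => c O * f O z)%C with (fun z => c O * f O z + 0 * f O z)%C
      by (apply functional_extensionality; intros; ring).
    rewrite tail_lin by trivial. apply functional_extensionality; intros; ring.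
  - rewrite !ES. split.
    + apply entire_plus; now apply entire_scal.
    + rewrite tail_lin by auto. now rewrite IH2.
Qed.

Lemma entire_opp_arg (f : C -> C) : entire f -> entire (fun z => f (- z)%C).
Proof.
  intros Hf. apply (entire_comp f (fun z => - z)%C); trivial.
  replace (fun z => - z)%C with (fun z => 0 - z)%C by (apply functional_extensionality; intros; ring).
  apply entire_minus. apply entire_const. apply entire_id.
Qed.

Lemma tail_opp_arg (n : nat) (f : C -> C) : entire f ->
  tail n (fun z => f (- z)%C) = (fun z => (- (1)) ^ n * tail n f (- z))%C.
Proof.
  revert f. induction n as [|n IH]; intros f Hf.
  - apply functional_extensionality. intros; simpl; ring.
  - simpl tail. pose proof (entire_quot f Hf) as Hq.
    rewrite (quot_unique (fun z => f (- z)%C) (fun z => - (1) * quot f (- z) + 0 * quot f (- z))%C (f 0%C)).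
    + rewrite (tail_lin n (- (1))%C 0%C (fun z => quot f (- z)%C) (fun z => quot f (- z)%C))
        by now apply entire_opp_arg.
      rewrite IH by trivial. apply functional_extensionality. intros. simpl. ring.
    + now apply entire_opp_arg.
    + apply entire_plus; apply entire_scal; now apply entire_opp_arg.
    + intros z. rewrite (quot_spec f (- z) Hf). ring.
Qed.

Lemma tail_pow_mult (n : nat) (g : C -> C) : entire g -> tail n (fun z => z ^ n * g z)%C = g.
Proof.
  intros Hg. induction n as [|n IH].
  - apply functional_extensionality. intros; simpl; ring.
  - change (tail n (quot (fun z => z ^ S n * g z)%C) = g).
    rewrite (quot_unique _ (fun z => z ^ n * g z)%C 0%C); trivial.
    + apply entire_mult; trivial. apply (entire_pow (S n)).
    + apply entire_mult; trivial. apply (entire_pow n).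
    + intros z. simpl. ring.
Qed.

Lemma tcoef_mult (n : nat) (f g : C -> C) : entire f -> entire g ->
  tcoef n (fun z => f z * g z)%C = csum (fun j => tcoef j f * tcoef (n - j) g)%C n.
Proof.
  revert f. induction n as [|n IH]; intros f Hf Hg.
  - rewrite csum_O. reflexivity.
  - pose proof (entire_quot f Hf) as Hf1. pose proof (entire_quot g Hg) as Hg1.
    unfold tcoef at 1. simpl tail.
    (* An asymmetric product rule: [f g = f(0) g(0) + z (f(0) quot g + (quot f) g)]. Iterated on the
       second term it produces the Cauchy product. *)
    rewrite (quot_unique _ (fun z => f 0 * quot g z + 1 * (quot f z * g z))%C (f 0 * g 0)%C).
    + rewrite tail_lin by (trivial; now apply entire_mult).
      fold (tcoef n (quot g)) (tcoef n (fun z => quot f z * g z)%C).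
      rewrite IH, csum_first by trivial. rewrite Nat.sub_0_r.
      change (tcoef (S n) g) with (tcoef n (quot g)). change (tcoef 0 f) with (f 0%C).
      rewrite Cmult_1_l. reflexivity.
    + now apply entire_mult.
    + apply entire_plus; apply entire_scal; trivial. now apply entire_mult.
    + intros z. rewrite (quot_spec f z Hf), (quot_spec g z Hg). ring.
Qed.

Lemma entire_C_derive_n (n : nat) (f : C -> C) : entire f -> entire (C_derive_n f n).
Proof. intros Hf. induction n; simpl; trivial. now apply entire_derive. Qed.

Lemma C_derive_n_tcoef (n : nat) (f : C -> C) : entire f ->
  C_derive_n f n 0%C = (RtoC (INR (fact n)) * tcoef n f)%C.
Proof.
  revert f. induction n as [|n IH]; intros f Hf.
  - unfold tcoef; simpl. ring.
  - pose proof (entire_quot f Hf) as Hq.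
    (* Leibniz's rule for [f = f(0) + z quot f]. At 0 only the second term remains, which gives the
       recursion of the factorial. *)
    assert (step : forall k, C_derive_n f (S k) = (fun z => z * C_derive_n (quot f) (S k) z
       + RtoC (INR (S k)) * C_derive_n (quot f) k z)%C).
    { assert (D : forall j z, cderiv (C_derive_n (quot f) j) z (C_derive_n (quot f) (S j) z)).
      { intros j. apply (proj1 (entire_cderiv _)). now apply entire_C_derive_n. }
      induction k as [|k IHk]; apply functional_extensionality; intros z.
      - apply cderiv_unique.
        apply (deriv_ext Cid (fun z => f 0 + z * quot f z)%C f z
           (0 + (1 * quot f z + z * C_derive_n (quot f) 1 z))%C).
        + intros s. symmetry. now apply quot_spec.
        + simpl. ring.
        + apply deriv_plus. apply deriv_const. apply (deriv_mult Cid Cid). apply deriv_emb. apply (D O).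
      - change (C_derive_n f (S (S k)) z) with (C_derive (C_derive_n f (S k)) z). rewrite IHk.
        apply cderiv_unique.
        eapply deriv_ext; [reflexivity| |apply deriv_plus;
          [apply (deriv_mult Cid Cid); [apply deriv_emb|apply D]|apply deriv_scal, D]].
        rewrite (S_INR (S k)), RtoC_plus. unfold Cid. ring. }
    rewrite step, Cmult_0_l, Cplus_0_l, IH by trivial.
    rewrite fact_simpl, mult_INR, RtoC_mult. change (tcoef (S n) f) with (tcoef n (quot f)). ring.
Qed.

Lemma RtoC_fact_neq_0 (n : nat) : RtoC (INR (fact n)) <> 0%C.
Proof. apply RtoC_neq_0, INR_fact_neq_0. Qed.

Lemma tcoef_derive (n : nat) (f : C -> C) : entire f ->
  tcoef n f = (C_derive_n f n 0 / RtoC (INR (fact n)))%C.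
Proof. intros Hf. rewrite C_derive_n_tcoef by trivial. field. apply RtoC_fact_neq_0. Qed.

Lemma entire_exp_lin (c : C) : entire (fun z => Cexp (c * z)).
Proof.
  apply (entire_comp Cexp (fun z => c * z)%C). apply entire_Cexp. apply entire_scal, entire_id.
Qed.

Lemma tcoef_exp (n : nat) (c : C) : tcoef n (fun z => Cexp (c * z)) = (c ^ n / RtoC (INR (fact n)))%C.
Proof.
  rewrite tcoef_derive by apply entire_exp_lin. f_equal.
  assert (E : forall k, C_derive_n (fun z => Cexp (c * z)) k = (fun z => c ^ k * Cexp (c * z))%C).
  { induction k as [|k IH]; apply functional_extensionality; intros z.
    - simpl. ring.
    - change (C_derive (C_derive_n (fun z => Cexp (c * z)) k) z = (c ^ S k * Cexp (c * z))%C).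
      rewrite IH. apply cderiv_unique.
      eapply deriv_ext; [reflexivity| |apply deriv_scal, (deriv_comp Cid Cexp (fun z => c * Cid z)%C);
        [apply cderiv_Cexp|apply deriv_scal, deriv_emb]].
      unfold Cid. simpl. ring. }
  rewrite E, Cmult_0_r, Cexp_0. ring.
Qed.

(* Compare the Taylor coefficients of [Cexp ((a + b) z) = Cexp (a z) Cexp (b z)]. *)
Lemma Cbinomial (a b : C) (n : nat) :
  ((a + b) ^ n)%C = csum (fun j => RtoC (INR (fact n) / (INR (fact j) * INR (fact (n - j)))) * (a ^ j * b ^ (n - j)))%C n.
Proof.
  assert (K : tcoef n (fun z : C => Cexp ((a + b) * z)) =
    csum (fun j => tcoef j (fun z : C => Cexp (a * z)) * tcoef (n - j) (fun z : C => Cexp (b * z)))%C n).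
  { rewrite <- tcoef_mult by apply entire_exp_lin. f_equal.
    apply functional_extensionality. intros. rewrite <- Cexp_plus. f_equal. ring. }
  rewrite tcoef_exp in K.
  replace ((a + b) ^ n)%C with (RtoC (INR (fact n)) * ((a + b) ^ n / RtoC (INR (fact n))))%C
    by (field; apply RtoC_fact_neq_0).
  rewrite K, <- csum_scal. apply csum_ext. intros j Hj. rewrite !tcoef_exp.
  rewrite RtoC_div by (apply Rmult_integral_contrapositive; split; apply INR_fact_neq_0).
  rewrite RtoC_mult. field. split; apply RtoC_fact_neq_0.
Qed.

Lemma tcoef_even (n : nat) (f : C -> C) :
  entire f -> (forall z, f (- z)%C = f z) -> Nat.Odd n -> tcoef n f = 0%C.
Proof.
  intros Hf He [k ->].
  pose proof (tail_opp_arg (2 * k + 1) f Hf) as K.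
  replace (fun z => f (- z)%C) with f in K by (apply functional_extensionality; auto).
  apply (f_equal (fun g : C -> C => g 0%C)) in K. cbv beta in K. rewrite Copp_0 in K.
  fold (tcoef (2 * k + 1) f) in K.
  rewrite Cpow_add_r, Cpow_mult_r in K.
  replace ((- (1)) ^ 2)%C with (RtoC 1) in K by (simpl; ring). rewrite Cpow_1_l in K. simpl Cpow in K.
  assert (H2 : RtoC 2 <> 0%C) by (apply RtoC_neq_0; lra).
  set (x := tcoef (2 * k + 1) f) in *.
  replace x with ((x + x) / 2)%C by (field; trivial). rewrite K at 1. field.
Qed.

Lemma tail_bound (n : nat) (f : C -> C) : entire f ->
  exists B, 0 <= B /\ forall z, 1 <= Cmod z -> Cmod (tail n f z) <= Cmod (f z) + B / Cmod z.
Proof.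
  intros Hf. induction n as [|n [B [HB IH]]].
  - exists 0. split; [lra|]. intros z Hz. simpl. unfold Rdiv. rewrite Rmult_0_l. lra.
  - pose proof (Cmod_ge_0 (tcoef n f)) as Hc. exists (B + Cmod (tcoef n f)). split; [lra|].
    intros z Hz. assert (Hz0 : z <> 0%C) by (apply Cmod_gt_0; lra).
    assert (E : tail (S n) f z = ((tail n f z - tcoef n f) / z)%C).
    { rewrite (tail_spec n f z Hf). field. trivial. }
    rewrite E, Cmod_div by trivial. specialize (IH z Hz).
    pose proof (Cmod_minus_triangle (tail n f z) (tcoef n f)).
    assert (B / Cmod z <= B).
    { apply Rmult_le_reg_r with (Cmod z); [lra|]. unfold Rdiv. rewrite Rmult_assoc, Rinv_l by lra. nra. }
    pose proof (Cmod_ge_0 (f z)).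
    apply Rmult_le_reg_r with (Cmod z); [lra|].
    replace (Cmod (tail n f z - tcoef n f) / Cmod z * Cmod z) with (Cmod (tail n f z - tcoef n f)) by (field; lra).
    replace ((Cmod (f z) + (B + Cmod (tcoef n f)) / Cmod z) * Cmod z) with
      (Cmod (f z) * Cmod z + (B + Cmod (tcoef n f))) by (field; lra).
    nra.
Qed.

(** The left side is [tail n f z / z]. Restoring the single term [tcoef n f / z] thus leaves an
    error of order [1 / |z|^2], integrable at infinity, beside the growth of [f]. *)
Lemma tail_polar_bound (n : nat) (f : C -> C) : entire f ->
  exists B, 0 <= B /\ forall z, 1 <= Cmod z ->
    Cmod (tail (S n) f z + tcoef n f / z) <= Cmod (f z) + B / (Cmod z * Cmod z).
Proof.
  intros Hf. destruct (tail_bound n f Hf) as [B [HB H]]. exists B. split; trivial.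
  intros z Hz. assert (Hz0 : z <> 0%C) by (apply Cmod_gt_0; lra).
  replace (tail (S n) f z + tcoef n f / z)%C with (tail n f z / z)%C
    by (rewrite (tail_spec n f z Hf); field; trivial).
  rewrite Cmod_div by trivial. specialize (H z Hz). pose proof (Cmod_ge_0 (f z)).
  apply Rmult_le_reg_r with (Cmod z); [lra|].
  replace (Cmod (tail n f z) / Cmod z * Cmod z) with (Cmod (tail n f z)) by (field; lra).
  replace ((Cmod (f z) + B / (Cmod z * Cmod z)) * Cmod z) with (Cmod (f z) * Cmod z + B / Cmod z) by (field; lra).
  nra.
Qed.

(** * The Dirichlet integral *)

(** Along the semicircle, [P (r cis t) + i t] has derivative [i exp (i lambda r cis t)], the term
    [i t] accounting for the [- 1 / z] in the integrand. This derivative has modulus at most 1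
    everywhere and is uniformly small away from the two ends. *)
Lemma dirichlet_integral (lambda : R) (P : C -> C) : 0 < lambda ->
  (forall z, cderiv P z (quot (fun z => Cexp (Ci * RtoC lambda * z)) z)) ->
  clim (fun r => P (RtoC r) - P (- RtoC r))%C (Ci * RtoC PI)%C.
Proof.
  intros Hlam HP eps He. pose proof PI_RGT_0 as HPI.
  (* The two end arcs of angle [eta] cost at most [eps / 8] each; the middle one costs as much once
     [r] is large. *)
  set (eta := Rmin (eps / 8) (PI / 4)).
  assert (Heta : 0 < eta) by (apply Rmin_pos; lra).
  assert (Heta1 : eta <= eps / 8) by apply Rmin_l.
  assert (Heta2 : eta <= PI / 4) by apply Rmin_r.
  assert (Hs : 0 < sin eta) by (apply sin_gt_0; lra).
  exists (Rmax 1 (8 * PI / (eps * (lambda * sin eta)))). intros r Hr.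
  assert (G1 : 1 <= r) by (eapply Rle_trans; [apply Rmax_l|apply Hr]).
  assert (G2 : 8 * PI / (eps * (lambda * sin eta)) <= r) by (eapply Rle_trans; [apply Rmax_r|apply Hr]).
  set (q := lambda * sin eta) in *. assert (Hq : 0 < q) by (unfold q; nra).
  assert (Hsm : PI * exp (- (q * r)) <= eps / 8).
  { assert (exp (- (q * r)) <= / (q * r)).
    { rewrite exp_Ropp. apply Rinv_le_contravar. nra. pose proof (exp_ineq1_le (q * r)). nra. }
    apply Rle_trans with (PI * / (q * r)); [apply Rmult_le_compat_l; lra|].
    apply Rmult_le_reg_r with (8 * r / eps). apply Rdiv_lt_0_compat; lra.
    replace (eps / 8 * (8 * r / eps)) with r by (field; lra).
    replace (PI * / (q * r) * (8 * r / eps)) with (8 * PI / (eps * q)) by (field; repeat split; lra).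
    trivial. }
  set (X := fun t => (P (RtoC r * cis (1 * t)) + Ci * RtoC t)%C).
  set (X' := fun t => (Ci * Cexp (Ci * RtoC lambda * (RtoC r * cis (1 * t))))%C).
  assert (HX : forall t, pderiv X t (X' t)).
  { intros t. eapply deriv_ext; [reflexivity| |apply deriv_plus;
      [apply (deriv_comp RtoC P (fun t => RtoC r * cis (1 * t))%C); [apply HP|apply pderiv_polar]
      |apply deriv_scal, deriv_emb]].
    unfold X'. set (z := (RtoC r * cis (1 * t))%C).
    pose proof (quot_spec (fun z => Cexp (Ci * RtoC lambda * z)) z (entire_exp_lin _)) as S.
    cbv beta in S. rewrite Cmult_0_r, Cexp_0 in S. rewrite S. unfold z. ring. }
  assert (HX' : forall t, Cmod (X' t) = exp (- (lambda * r * sin t))).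
  { intros t. unfold X'. rewrite Cmod_mult, Cmod_Ci, Cmod_Cexp, Rmult_1_l, Rmult_1_l. f_equal.
    rewrite <- Cmult_assoc, Cmult_comm, re_mult_Ci, im_scal_l, im_scal_l, Im_cis. ring. }
  assert (one : forall t, 0 <= t <= PI -> Cmod (X' t) <= 1).
  { intros t Ht. rewrite HX', <- exp_0. apply exp_le.
    assert (0 <= sin t) by (apply sin_ge_0; lra).
    assert (0 <= lambda * r) by nra. nra. }
  assert (K1 := mean_value_bound X X' 0 eta 1 ltac:(lra) (fun t _ => HX t) (fun t Ht => one t ltac:(lra))).
  assert (K3 := mean_value_bound X X' (PI - eta) PI 1 ltac:(lra) (fun t _ => HX t) (fun t Ht => one t ltac:(lra))).
  assert (K2 : Cmod (X (PI - eta)%R - X eta)%C <= exp (- (q * r)) * (PI - eta - eta)).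
  { apply (mean_value_bound X X'); [lra|auto|]. intros t Ht. rewrite HX'. apply exp_le.
    assert (sin eta <= sin t).
    { destruct (Rle_dec t (PI / 2)).
      - apply sin_incr_1; lra.
      - rewrite <- (sin_PI_x t). apply sin_incr_1; lra. }
    unfold q. assert (0 < lambda * r) by nra. nra. }
  assert (E : (P (RtoC r) - P (- RtoC r) - Ci * RtoC PI)%C =
    (- ((X PI - X (PI - eta)%R) + (X (PI - eta)%R - X eta) + (X eta - X 0%R)))%C).
  { replace (P (RtoC r)) with (X 0) by (unfold X; rewrite Rmult_0_r, cis_0, Cmult_1_r; ring).
    replace (P (- RtoC r)%C) with (X PI - Ci * RtoC PI)%C.
    - ring.
    - unfold X. rewrite Rmult_1_l, cis_PI. replace (r * - (1))%C with (- r)%C by ring. ring. }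
  rewrite E, Cmod_opp. eapply Rle_lt_trans; [apply Cmod_triangle3|].
  pose proof (exp_pos (- (q * r))). nra.
Qed.

(** * The analytic half of an odd power of the sine *)

Definition freq (m k : nat) (lambda : R) : R := INR (2 * m - 2 * k + 1) * lambda.

(** A signed binomial coefficient over [(-4)^m = (2 i)^(2 m)]. Of the denominator [(2 i)^(2 m + 1)]
    of the odd power of the sine, one factor [2 i] stays outside. *)
Definition half_weight (m k : nat) : C :=
  (RtoC ((-1) ^ k * (INR (fact (2 * m + 1)) / (INR (fact k) * INR (fact (2 * m + 1 - k)))))
   / (- (4)) ^ m)%C.

(* [sin (lambda z) ^ (2 m + 1) = (sin_half z - sin_half (- z)) / (2 i)], where
   [sin_half] collects the exponentials that decay in the upper half-plane. *)
Definition sin_half (m : nat) (lambda : R) (z : C) : C :=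
  csum (fun k => half_weight m k * Cexp (Ci * RtoC (freq m k lambda) * z))%C m.

Definition two_i_sin (lambda : R) (z : C) : C :=
  (Cexp (Ci * RtoC lambda * z) - Cexp (- (Ci * RtoC lambda) * z))%C.

Lemma four_pow_neq_0 (m : nat) : ((- (4)) ^ m)%C <> 0%C.
Proof.
  apply Cpow_nz. rewrite <- RtoC_opp. apply RtoC_neq_0. lra.
Qed.

(** Truncated subtraction makes this true also for [k > m], so that [sin_half_bound] can treat sums
    of any length. *)
Lemma freq_ge (m k : nat) (lambda : R) : 0 <= lambda -> lambda <= freq m k lambda.
Proof.
  intros H. unfold freq. rewrite plus_INR. simpl (INR 1). pose proof (pos_INR (2 * m - 2 * k)). nra.
Qed.

Lemma entire_sin_half (m : nat) (lambda : R) : entire (sin_half m lambda).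
Proof.
  apply (proj1 (tail_csum 0 m (half_weight m) (fun k z => Cexp (Ci * RtoC (freq m k lambda) * z))
    (fun k => entire_exp_lin _))).
Qed.

Lemma tcoef_sin_half (m : nat) (lambda : R) (n : nat) :
  tcoef n (sin_half m lambda) =
  csum (fun k => half_weight m k * ((Ci * RtoC (freq m k lambda)) ^ n / RtoC (INR (fact n))))%C m.
Proof.
  unfold tcoef, sin_half.
  rewrite (proj2 (tail_csum n m (half_weight m) (fun k z => Cexp (Ci * RtoC (freq m k lambda) * z))
    (fun k => entire_exp_lin _))).
  apply csum_ext. intros k _. f_equal. apply tcoef_exp.
Qed.

Lemma sin_half_bound (m : nat) (lambda : R) : 0 <= lambda ->
  exists S, 0 <= S /\ forall z, 0 <= Im z -> Cmod (sin_half m lambda z) <= S * exp (- (lambda * Im z)).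
Proof.
  intros Hl. unfold sin_half.
  (* The upper limit of the sum is separated from the [m] inside the terms, as the induction changes
     only the former. *)
  assert (key : forall N, exists S, 0 <= S /\ forall z, 0 <= Im z ->
    Cmod (csum (fun k => half_weight m k * Cexp (Ci * RtoC (freq m k lambda) * z))%C N)
      <= S * exp (- (lambda * Im z))).
  { assert (term : forall k z, 0 <= Im z ->
      Cmod (half_weight m k * Cexp (Ci * RtoC (freq m k lambda) * z))%C
        <= Cmod (half_weight m k) * exp (- (lambda * Im z))).
    { intros k z Hz. rewrite Cmod_mult. apply Rmult_le_compat_l; [apply Cmod_ge_0|].
      rewrite Cmod_Cexp. apply exp_le. rewrite <- Cmult_assoc, Cmult_comm, re_mult_Ci, im_scal_l.
      pose proof (freq_ge m k lambda Hl). nra. }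
    induction N as [|N [S [HS IH]]].
    - exists (Cmod (half_weight m 0)). split; [apply Cmod_ge_0|]. intros z Hz. rewrite csum_O. auto.
    - exists (S + Cmod (half_weight m (Datatypes.S N))).
      pose proof (Cmod_ge_0 (half_weight m (Datatypes.S N))). split; [lra|].
      intros z Hz. rewrite csum_S. eapply Rle_trans; [apply Cmod_triangle|].
      specialize (IH z Hz). specialize (term (Datatypes.S N) z Hz). lra. }
  apply key.
Qed.

Lemma neg_one_pow_RtoC (k : nat) : RtoC ((-1) ^ k) = ((- (1)) ^ k)%C.
Proof. rewrite RtoC_pow. f_equal. change (-1) with (- (1)). apply RtoC_opp. Qed.

(** In the binomial expansion of an odd power the indices [k] and [2 m + 1 - k] carry equal
    coefficients, opposite signs and opposite frequencies; each pair is one term of the difference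
    on the left. *)
Lemma sin_half_odd_part (m : nat) (lambda : R) (z : C) :
  (sin_half m lambda z - sin_half m lambda (- z))%C = (two_i_sin lambda z ^ (2 * m + 1) / (- (4)) ^ m)%C.
Proof.
  set (a := (Ci * RtoC lambda * z)%C).
  pose proof (four_pow_neq_0 m) as H4.
  (* With the negative exponential first, the index [k] gives the frequency [2 m + 1 - 2 k],
     positive exactly for [k <= m]. *)
  replace (two_i_sin lambda z) with (- (1) * Cexp (- a) + Cexp a)%C.
  2: { unfold two_i_sin, a. replace (- (Ci * lambda * z))%C with (- (Ci * lambda) * z)%C by ring. ring. }
  rewrite Cbinomial, csum_pairs.
  replace (sin_half m lambda z - sin_half m lambda (- z))%C with
    (csum (fun k => half_weight m k * (Cexp (Ci * RtoC (freq m k lambda) * z)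
      - Cexp (Ci * RtoC (freq m k lambda) * - z)))%C m).
  2: { unfold sin_half.
    assert (G : forall N (x y : nat -> C), csum (fun k => half_weight m k * (x k - y k))%C N =
      (csum (fun k => half_weight m k * x k)%C N - csum (fun k => half_weight m k * y k)%C N)%C).
    { intros N x y. induction N as [|N IH]. rewrite !csum_O; ring. rewrite !csum_S, IH; ring. }
    apply G. }
  unfold Cdiv. rewrite Cmult_comm, <- csum_scal. apply csum_ext. intros k Hk.
  set (N := (2 * m + 1)%nat).
  replace (N - (N - k))%nat with k by (unfold N; lia).
  rewrite (Rmult_comm (INR (fact (N - k)))).
  unfold half_weight. fold N.
  set (w := INR (fact N) / (INR (fact k) * INR (fact (N - k)))).
  rewrite RtoC_mult, neg_one_pow_RtoC.
  rewrite !Cpow_mult_l, <- !Cexp_INR.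
  assert (Esgn : ((- (1)) ^ (N - k))%C = (- (- (1)) ^ k)%C).
  { assert (E1 : ((- (1)) ^ (N - k) * (- (1)) ^ k = - (1))%C).
    { rewrite <- Cpow_add_r. replace (N - k + k)%nat with (2 * m + 1)%nat by (unfold N; lia).
      rewrite Cpow_add_r, Cpow_mult_r. replace ((- (1)) ^ 2)%C with (RtoC 1) by (simpl; ring).
      rewrite Cpow_1_l. simpl. ring. }
    assert (E2 : ((- (1)) ^ k * (- (1)) ^ k = 1)%C).
    { rewrite <- Cpow_add_r. replace (k + k)%nat with (2 * k)%nat by lia.
      rewrite Cpow_mult_r. replace ((- (1)) ^ 2)%C with (RtoC 1) by (simpl; ring). apply Cpow_1_l. }
    replace ((- (1)) ^ (N - k))%C with ((- (1)) ^ (N - k) * ((- (1)) ^ k * (- (1)) ^ k))%C by (rewrite E2; ring).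
    rewrite Cmult_assoc, E1. ring. }
  rewrite Esgn.
  assert (Efr : RtoC (freq m k lambda) = ((RtoC (INR (N - k)) - RtoC (INR k)) * RtoC lambda)%C).
  { unfold freq. rewrite <- RtoC_minus, <- RtoC_mult. f_equal. f_equal.
    rewrite <- minus_INR by (unfold N; lia). f_equal. unfold N. lia. }
  assert (Ep : Cexp (Ci * RtoC (freq m k lambda) * z) = (Cexp (INR k * - a) * Cexp (INR (N - k) * a))%C).
  { rewrite <- Cexp_plus. f_equal. rewrite Efr. unfold a. ring. }
  assert (Em : Cexp (Ci * RtoC (freq m k lambda) * - z) = (Cexp (INR (N - k) * - a) * Cexp (INR k * a))%C).
  { rewrite <- Cexp_plus. f_equal. rewrite Efr. unfold a. ring. }
  rewrite Ep, Em. field. trivial.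
Qed.

Lemma two_i_sin_real (lambda x : R) : two_i_sin lambda (RtoC x) = (2 * Ci * RtoC (sin (lambda * x)))%C.
Proof.
  unfold two_i_sin.
  replace (Ci * lambda * x)%C with (Ci * RtoC (lambda * x))%C by (rewrite RtoC_mult; ring).
  replace (- (Ci * lambda) * x)%C with (Ci * RtoC (- (lambda * x)))%C by (rewrite RtoC_opp, RtoC_mult; ring).
  change (cis (lambda * x) - cis (- (lambda * x)) = 2 * Ci * RtoC (sin (lambda * x)))%C.
  rewrite !cis_alt, cos_neg, sin_neg, RtoC_opp. ring.
Qed.

Lemma entire_two_i_sin (lambda : R) : entire (two_i_sin lambda).
Proof. apply entire_minus; apply entire_exp_lin. Qed.

(** * Growth bound, decomposition of the integrand and evaluation *)

Lemma exponential_type_bound (f : C -> C) (tau sigma : R) :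
  entire f -> exponential_type f tau -> tau < sigma -> 0 <= sigma ->
  exists A, 0 <= A /\ forall z, Cmod (f z) <= A * exp (sigma * Cmod z).
Proof.
  intros Hf Ht Hs Hs0. destruct (Ht (sigma - tau)) as [r Hr]; [lra|].
  replace (tau + (sigma - tau)) with sigma in Hr by ring.
  destruct (bounded_disc f r (entire_cont f Hf)) as [B [HB H]].
  exists (1 + B). split; [lra|]. intros z.
  assert (1 <= exp (sigma * Cmod z)).
  { rewrite <- exp_0. apply exp_le. pose proof (Cmod_ge_0 z). nra. }
  destruct (Rle_dec r (Cmod z)) as [G|G].
  - specialize (Hr z G). nra.
  - specialize (H z ltac:(lra)). nra.
Qed.

Lemma is_RInt_gen_clim (g : R -> C) (l : C) :
  is_RInt_gen (V := C_R_NormedModule) g (at_point 0) (Rbar_locally p_infty) l ->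
  forall v : R -> C, (forall r, 0 < r -> is_RInt (V := C_R_NormedModule) g 0 r (v r)) -> clim v l.
Proof.
  intros H v Hv. apply clim_filterlim. apply filterlim_locally. intros eps.
  specialize (H (ball (l : C_R_NormedModule) eps) (locally_ball _ eps)).
  destruct H as [Q S HQ [W HS] H].
  exists (Rmax W 0). intros r Hr.
  assert (W < r) by (eapply Rle_lt_trans; [apply Rmax_l|apply Hr]).
  assert (0 < r) by (eapply Rle_lt_trans; [apply Rmax_r|apply Hr]).
  destruct (H 0 r HQ (HS r ltac:(trivial))) as [y [Hy Hb]]. simpl in Hy.
  replace (v r) with y; trivial.
  rewrite <- (is_RInt_unique (V := C_R_CompleteNormedModule) _ _ _ _ Hy).
  apply (is_RInt_unique (V := C_R_CompleteNormedModule)). auto.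
Qed.

(** With [N = 2 m + 1], the difference [u z - u (- z)] is divisible by [z^N], as the sine vanishes
    at 0; its quotient [g] is the integrand up to the factor [2 i]. Since [N] is odd, reflection
    turns the difference into a sum of tails, and no polar part survives. *)
Lemma integrand_tail (f : C -> C) (m : nat) (lambda x : R) :
  entire f -> (forall z : C, f (- z)%C = f z) -> 0 < x ->
  let E := tail (2 * m + 1) (fun z => sin_half m lambda z * f z)%C in
  integrand f m lambda x = ((E (RtoC x) + E (- RtoC x)) / (2 * Ci))%C.
Proof.
  intros Hf He Hx. cbv zeta. set (N := (2 * m + 1)%nat).
  set (u := fun z => (sin_half m lambda z * f z)%C).
  assert (Hu : entire u) by (apply entire_mult; trivial; apply entire_sin_half).
  pose proof (entire_two_i_sin lambda) as Hs. pose proof (entire_quot _ Hs) as Hq.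
  pose proof (four_pow_neq_0 m) as H4.
  set (g := fun z => (/ (- (4)) ^ m * f z * quot (two_i_sin lambda) z ^ N)%C).
  assert (Hg : entire g).
  { apply entire_mult. now apply entire_scal.
    apply (entire_comp (fun z => z ^ N)%C); trivial. apply entire_pow. }
  assert (Es : forall z, two_i_sin lambda z = (z * quot (two_i_sin lambda) z)%C).
  { intros z. rewrite (quot_spec _ z Hs) at 1.
    replace (two_i_sin lambda 0) with (RtoC 0). ring.
    unfold two_i_sin. rewrite !Cmult_0_r. ring. }
  assert (Ev : (fun z => 1 * u z + - (1) * u (- z))%C = (fun z => z ^ N * g z)%C).
  { apply functional_extensionality. intros z. unfold u, g. rewrite He.
    replace (1 * (sin_half m lambda z * f z) + - (1) * (sin_half m lambda (- z) * f z))%C with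
      ((sin_half m lambda z - sin_half m lambda (- z)) * f z)%C by ring.
    rewrite sin_half_odd_part. fold N. rewrite Es at 1. rewrite Cpow_mult_l. field. trivial. }
  assert (Et : forall z, (tail N u z + tail N u (- z))%C = g z).
  { intros z. rewrite <- (tail_pow_mult N g Hg), <- Ev.
    rewrite (tail_lin N 1%C (- (1))%C u (fun z => u (- z)%C) Hu (entire_opp_arg u Hu)).
    rewrite tail_opp_arg by trivial.
    unfold N. rewrite Cpow_add_r, Cpow_mult_r.
    replace ((- (1)) ^ 2)%C with (RtoC 1) by (simpl; ring). rewrite Cpow_1_l. simpl. ring. }
  rewrite Et. unfold g, integrand.
  assert (Hx0 : RtoC x <> 0%C) by (apply RtoC_neq_0; lra).
  assert (H2 : RtoC 2 <> 0%C) by (apply RtoC_neq_0; lra).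
  replace (quot (two_i_sin lambda) x) with (2 * Ci * RtoC (sin (lambda * x)) / x)%C.
  2: { rewrite <- two_i_sin_real, Es. field. trivial. }
  fold N. unfold Cdiv.
  rewrite !Cpow_mult_l, Cpow_inv, <- !RtoC_pow by trivial.
  (* Splitting one factor [2 i] off [(2 i)^N] leaves the power of [-4] in the weights. *)
  assert (E4 : (RtoC (2 ^ N) * Ci ^ N)%C = ((- (4)) ^ m * (2 * Ci))%C).
  { rewrite RtoC_pow, <- Cpow_mult_l. unfold N. rewrite Cpow_add_r, Cpow_mult_r.
    replace ((2 * Ci) ^ 2)%C with (- (4))%C. simpl; ring.
    simpl. replace (2 * Ci * (2 * Ci * 1))%C with (4 * (Ci * Ci))%C by ring. rewrite Ci_sqr. ring. }
  rewrite E4. pose proof Ci_nz. field. repeat split; trivial.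
  apply RtoC_neq_0, pow_nonzero. lra.
Qed.

Lemma Ci_pow_even (l : nat) (w : R) : ((Ci * RtoC w) ^ (2 * l))%C = RtoC ((-1) ^ l * w ^ (2 * l)).
Proof.
  rewrite RtoC_mult, neg_one_pow_RtoC, Cpow_mult_l, RtoC_pow, Cpow_mult_r. f_equal. f_equal.
  simpl. rewrite Cmult_1_r. apply Ci_sqr.
Qed.

(** The coefficient of [z^(2 m)] in [sin_half * f] is a Cauchy product. The factor of degree [2 l]
    from [sin_half] gives [lambda^(2 l)] and the inner sum of [D_coef], and the one from [f] gives
    the derivative at 0. *)
Lemma tcoef_value (f : C -> C) (m : nat) (lambda : R) :
  entire f -> (forall z : C, f (- z)%C = f z) ->
  (RtoC (PI / 2) * tcoef (2 * m) (fun z => sin_half m lambda z * f z))%C =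
  (RtoC ((-1) ^ m * PI * INR (fact (2 * m + 1)) / 2 ^ (2 * m + 1))%R
     * csum (fun l : nat => D_coef f l m * RtoC (lambda ^ (2 * l))%R) m)%C.
Proof.
  intros Hf He.
  rewrite tcoef_mult by (trivial; apply entire_sin_half).
  rewrite csum_even.
  (* For odd [k] the complementary index [2 m - k] is odd too, and evenness of [f] kills that
     coefficient. *)
  2: { intros k Hk [j ->]. rewrite (tcoef_even (2 * m - (2 * j + 1)) f Hf He). ring.
    exists (m - j - 1)%nat. lia. }
  rewrite <- !csum_scal. apply csum_ext. intros l Hl.
  rewrite tcoef_sin_half, tcoef_derive by trivial.
  unfold D_coef. rewrite csum_RtoC.
  set (F := C_derive_n f (2 * m - 2 * l) 0).
  set (N := (2 * m + 1)%nat).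
  assert (Eh : csum (fun k => half_weight m k * ((Ci * RtoC (freq m k lambda)) ^ (2 * l) / RtoC (INR (fact (2 * l)))))%C m
    = (RtoC ((-1) ^ l * lambda ^ (2 * l) * INR (fact N) / INR (fact (2 * l))) / (- (4)) ^ m *
       csum (fun k => RtoC ((-1) ^ k * INR (2 * m - 2 * k + 1) ^ (2 * l)
         / (INR (fact k) * INR (fact (N - k))))) m)%C).
  { rewrite <- csum_scal. apply csum_ext. intros k Hk. rewrite Ci_pow_even. unfold half_weight. fold N.
    pose proof (four_pow_neq_0 m) as H4.
    pose proof (INR_fact_neq_0 k). pose proof (INR_fact_neq_0 (N - k)). pose proof (INR_fact_neq_0 (2 * l)).
    rewrite <- RtoC_div by trivial. unfold Cdiv.
    replace (RtoC ((-1) ^ l * lambda ^ (2 * l) * INR (fact N) / INR (fact (2 * l))) * / (- (4)) ^ m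
      * RtoC ((-1) ^ k * INR (2 * m - 2 * k + 1) ^ (2 * l) / (INR (fact k) * INR (fact (N - k)))))%C
    with (RtoC ((-1) ^ l * lambda ^ (2 * l) * INR (fact N) / INR (fact (2 * l)) *
      ((-1) ^ k * INR (2 * m - 2 * k + 1) ^ (2 * l) / (INR (fact k) * INR (fact (N - k))))) * / (- (4)) ^ m)%C
      by (rewrite RtoC_mult; ring).
    replace (RtoC ((-1) ^ k * (INR (fact N) / (INR (fact k) * INR (fact (N - k))))) * / (- (4)) ^ m *
      RtoC ((-1) ^ l * freq m k lambda ^ (2 * l) / INR (fact (2 * l))))%C
    with (RtoC ((-1) ^ k * (INR (fact N) / (INR (fact k) * INR (fact (N - k)))) *
      ((-1) ^ l * freq m k lambda ^ (2 * l) / INR (fact (2 * l)))) * / (- (4)) ^ m)%C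
      by (rewrite RtoC_mult; ring).
    f_equal. f_equal. unfold freq. rewrite Rpow_mult_distr. field. auto. }
  rewrite Eh.
  set (S := csum _ m).
  (* This gives the sign [(-1)^m]; the factor [1 / 2^(2 m)] joins [PI / 2] to form the denominator
     [2^(2 m + 1)]. *)
  assert (E4 : (/ (- (4)) ^ m)%C = RtoC ((-1) ^ m / 2 ^ (2 * m))).
  { rewrite RtoC_div by (apply pow_nonzero; lra). rewrite neg_one_pow_RtoC.
    rewrite pow_mult, RtoC_pow. replace (2 ^ 2) with 4 by ring.
    replace (- (4))%C with (- (1) * 4)%C by ring. rewrite Cpow_mult_l.
    assert (E1 : ((- (1)) ^ m * (- (1)) ^ m = 1)%C).
    { rewrite <- Cpow_mult_l. replace (- (1) * - (1))%C with (RtoC 1) by ring. apply Cpow_1_l. }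
    assert (N1 : ((- (1)) ^ m)%C <> 0%C).
    { apply Cpow_nz. rewrite <- RtoC_opp. apply RtoC_neq_0. lra. }
    assert (N4 : (4 ^ m)%C <> 0%C) by (apply Cpow_nz, RtoC_neq_0; lra).
    replace (/ ((- (1)) ^ m * 4 ^ m))%C with (((- (1)) ^ m * (- (1)) ^ m) / ((- (1)) ^ m * 4 ^ m))%C
      by (rewrite E1; field; auto).
    field. auto. }
  pose proof (INR_fact_neq_0 (2 * l)). pose proof (INR_fact_neq_0 (2 * m - 2 * l)).
  unfold Cdiv. rewrite E4.
  rewrite <- !RtoC_inv by (trivial; apply Rmult_integral_contrapositive; auto).
  transitivity (RtoC (PI / 2 * ((-1) ^ l * lambda ^ (2 * l) * INR (fact N) / INR (fact (2 * l)) * ((-1) ^ m / 2 ^ (2 * m)) * / INR (fact (2 * m - 2 * l)))) * F * S)%C.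
  { rewrite !RtoC_mult. ring. }
  transitivity (RtoC ((-1) ^ m * PI * INR (fact N) / 2 ^ N * ((-1) ^ l * / (INR (fact (2 * l)) * INR (fact (2 * m - 2 * l))) * lambda ^ (2 * l))) * F * S)%C.
  { f_equal. f_equal. f_equal. unfold N. rewrite (pow_add 2). field. repeat split; trivial. apply pow_nonzero; lra. }
  rewrite !RtoC_mult. ring.
Qed.

(** Convergence of the integral is a hypothesis: for [f = cosh (tau z)] the oscillations of the
    integrand grow exponentially along the real axis. *)
Theorem theorem2 (f : C -> C) (tau : R) (Htau : 0 < tau)
    (Hentire : entire f) (Htype : exponential_type f tau)
    (Heven : forall z : C, f (- z)%C = f z)
    (m : nat) (lambda : R) (Hlambda : tau < lambda)
    (Hconv : ex_RInt_gen (V := C_R_NormedModule) (integrand f m lambda)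
               (at_point 0) (Rbar_locally p_infty)) :
  is_RInt_gen (V := C_R_NormedModule) (integrand f m lambda)
    (at_point 0) (Rbar_locally p_infty)
    (RtoC ((-1) ^ m * PI * INR (fact (2 * m + 1)) / 2 ^ (2 * m + 1))%R
     * sum_n (G := C_AbelianMonoid)
         (fun l : nat => D_coef f l m * RtoC (lambda ^ (2 * l))%R) m)%C.
Proof.
  destruct Hconv as [L HL].
  change (sum_n (G := C_AbelianMonoid) (fun l : nat => D_coef f l m * RtoC (lambda ^ (2 * l))%R)%C m)
    with (csum (fun l : nat => D_coef f l m * RtoC (lambda ^ (2 * l))%R)%C m).
  rewrite <- tcoef_value by trivial.
  set (u := fun z => (sin_half m lambda z * f z)%C).
  set (b := tcoef (2 * m) u).
  assert (Hu : entire u) by (apply entire_mult; trivial; apply entire_sin_half).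
  set (E := tail (2 * m + 1) u).
  assert (HE : entire E) by now apply entire_tail.
  set (w := quot (fun z => Cexp (Ci * RtoC lambda * z))).
  assert (Hw : entire w) by apply entire_quot, entire_exp_lin.
  destruct (entire_primitive E HE) as [PE HPE].
  destruct (entire_primitive w Hw) as [Pw HPw].
  assert (Hi : Ci <> 0%C) by apply Ci_nz.
  assert (H2 : RtoC 2 <> 0%C) by (apply RtoC_neq_0; lra).
  (* [PE z - PE (- z)] is a primitive of [E z + E (- z)] that vanishes at 0, so each truncated
     integral is a symmetric increment of [PE] over [2 i]. *)
  assert (HPE' : clim (fun r => (PE (RtoC r) - PE (- RtoC r)) / (2 * Ci))%C L).
  { apply (is_RInt_gen_clim _ _ HL). intros r Hr.
    (* Only the open interval is compared, which keeps the junk value of the integrand at 0 out. *)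
    apply (is_RInt_ext (V := C_R_NormedModule) (fun x => (E (RtoC x) + E (- RtoC x)) / (2 * Ci))%C).
    { intros x Hx. rewrite Rmin_left in Hx by lra. symmetry. apply integrand_tail; trivial. lra. }
    assert (Hd : forall t, pderiv (fun r => / (2 * Ci) * (PE (RtoC r) - PE (- (1) * RtoC r)))%C t
      (/ (2 * Ci) * (E (RtoC t) * 1 - E (- (1) * RtoC t) * (- (1) * 1)))%C).
    { intros t. apply deriv_scal, deriv_minus.
      - apply (deriv_comp RtoC PE RtoC). apply HPE. apply deriv_emb.
      - apply (deriv_comp RtoC PE (fun t => - (1) * RtoC t)%C). apply HPE. apply deriv_scal, deriv_emb. }
    assert (Eo : forall t : C, (- (1) * t)%C = (- t)%C) by (intros; ring).
    pose proof (is_RInt_derive (V := C_R_CompleteNormedModule)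
      (fun r => / (2 * Ci) * (PE (RtoC r) - PE (- (1) * RtoC r)))%C
      (fun t => / (2 * Ci) * (E (RtoC t) * 1 - E (- (1) * RtoC t) * (- (1) * 1)))%C 0 r) as K.
    replace ((PE (RtoC r) - PE (- RtoC r)) / (2 * Ci))%C with
      (minus (G := C_R_CompleteNormedModule) (/ (2 * Ci) * (PE (RtoC r) - PE (- (1) * RtoC r)))%C
        (/ (2 * Ci) * (PE (RtoC 0) - PE (- (1) * RtoC 0)))%C).
    2: { change (/ (2 * Ci) * (PE (RtoC r) - PE (- (1) * RtoC r)) - / (2 * Ci) * (PE (RtoC 0) - PE (- (1) * RtoC 0))
        = (PE (RtoC r) - PE (- RtoC r)) / (2 * Ci))%C.
      rewrite !Eo, Copp_0. unfold Cdiv. ring. }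
    apply (is_RInt_ext (V := C_R_NormedModule)
      (fun t => / (2 * Ci) * (E (RtoC t) * 1 - E (- (1) * RtoC t) * (- (1) * 1)))%C).
    { intros x _. change (/ (2 * Ci) * (E (RtoC x) * 1 - E (- (1) * RtoC x) * (- (1) * 1))
        = (E (RtoC x) + E (- RtoC x)) / (2 * Ci))%C.
      rewrite Eo. unfold Cdiv. ring. }
    apply K.
    - intros t _. apply pderiv_is_derive. apply Hd.
    - intros t _. apply pcont_continuous. pose proof (entire_cont E HE) as Hc.
      apply cont_scal.
      assert (C1 : pcont (fun t => E (RtoC t)) t).
      { apply (cont_comp RtoC E RtoC). apply Hc. eapply deriv_cont, deriv_emb. }
      assert (C2 : pcont (fun t => E (- (1) * RtoC t)%C) t).
      { apply (cont_comp RtoC E (fun t => - (1) * RtoC t)%C). apply Hc.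
        eapply deriv_cont, deriv_scal, deriv_emb. }
      intros e Hee. destruct (cont_plus RtoC _ _ t C1 C2 e Hee) as [d [Hd1 Hd2]].
      exists d. split; trivial. intros s Hs. eapply Rle_lt_trans; [|apply (Hd2 s Hs)].
      right. f_equal. ring. }
  set (k := fun z => (E z - b * w z)%C).
  assert (Hk : entire k) by (apply entire_minus; trivial; now apply entire_scal).
  set (P := fun z => (PE z - b * Pw z)%C).
  assert (HP : forall z, cderiv P z (k z)).
  { intros z. apply deriv_minus. apply HPE. apply deriv_scal, HPw. }
  (* Strictly above [tau], to bound [f] everywhere by [A exp (sigma |z|)], and strictly below
     [lambda], to leave sectors where [u] decays. *)
  set (sigma := (tau + lambda) / 2).
  destruct (exponential_type_bound f tau sigma Hentire Htype) as [A [HA HfA]];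
    [unfold sigma; lra|unfold sigma; lra|].
  destruct (sin_half_bound m lambda) as [S [HS HeS]]; [lra|].
  destruct (tail_polar_bound (2 * m) u Hu) as [B [HB HEB]].
  assert (Hzero : (2 * Ci * L - b * (Ci * RtoC PI))%C = 0%C).
  { pose proof (Cmod_ge_0 b) as Hb.
    apply (symmetric_integral_zero k P (S * A + Cmod b) B sigma lambda); trivial.
    - unfold sigma; lra.
    - assert (0 <= S * A) by now apply Rmult_le_pos. lra.
    - intros z Hz1 Hz2.
      assert (Hz0 : z <> 0%C) by (apply Cmod_gt_0; lra).
      (* The two terms in [b / z] cancel. The first bracket falls under [tail_polar_bound], and the
         exponential decays with [Im z]. *)
      assert (Ek : k z = ((E z + b / z) - b * (Cexp (Ci * RtoC lambda * z) / z))%C).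
      { unfold k, w. pose proof (quot_spec (fun z => Cexp (Ci * RtoC lambda * z)) z (entire_exp_lin _)) as Q.
        cbv beta in Q. rewrite Cmult_0_r, Cexp_0 in Q. rewrite Q. field. trivial. }
      rewrite Ek. eapply Rle_trans; [apply Cmod_minus_triangle|].
      assert (HEz : Cmod (E z + b / z)%C <= Cmod (u z) + B / (Cmod z * Cmod z)).
      { unfold E, b. replace (2 * m + 1)%nat with (Datatypes.S (2 * m)) by lia. now apply HEB. }
      assert (Huz : Cmod (u z) <= S * A * exp (sigma * Cmod z - lambda * Im z)).
      { unfold u. rewrite Cmod_mult. unfold Rminus. rewrite exp_plus.
        replace (S * A * (exp (sigma * Cmod z) * exp (- (lambda * Im z)))) with
          (S * exp (- (lambda * Im z)) * (A * exp (sigma * Cmod z))) by ring.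
        apply Rmult_le_compat; auto using Cmod_ge_0. }
      assert (Hexp : Cmod (b * (Cexp (Ci * RtoC lambda * z) / z))%C <= Cmod b * exp (sigma * Cmod z - lambda * Im z)).
      { rewrite Cmod_mult. apply Rmult_le_compat_l; trivial. rewrite Cmod_div, Cmod_Cexp by trivial.
        rewrite <- Cmult_assoc, (Cmult_comm Ci), re_mult_Ci, im_scal_l.
        apply Rle_trans with (exp (- (lambda * Im z))).
        - unfold Rdiv. rewrite <- (Rmult_1_r (exp (- (lambda * Im z)))) at 2.
          apply Rmult_le_compat_l; [left; apply exp_pos|].
          rewrite <- Rinv_1. apply Rinv_le_contravar; lra.
        - apply exp_le. unfold sigma. nra. }
      lra.
    (* The symmetric increment of [P] tends to [2 i L], from the given integral, minus [b i PI],
       from the Dirichlet integral; its vanishing is the equation solved for [L] below. *)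
    - pose proof (clim_plus _ _ _ _ (clim_scal (2 * Ci)%C _ _ HPE')
        (clim_scal (- b)%C _ _ (dirichlet_integral lambda Pw ltac:(lra) HPw))) as K.
      replace (2 * Ci * L - b * (Ci * RtoC PI))%C with (2 * Ci * L + - b * (Ci * RtoC PI))%C by ring.
      revert K. apply (clim_ext _ _ _ 0). intros t _. unfold P. field. auto. }
  assert (solve : forall x y : C, (2 * Ci * x - y * (Ci * RtoC PI))%C = 0%C -> x = (RtoC (PI / 2) * y)%C).
  { intros x y Hxy. rewrite RtoC_div by lra.
    transitivity ((2 * Ci * x - y * (Ci * RtoC PI) + y * (Ci * RtoC PI)) / (2 * Ci))%C.
    - field; auto.
    - rewrite Hxy. field. auto. }
  rewrite <- (solve L b Hzero). exact HL.
Qed.
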